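(* (Affine case.) Let $R$ be a commutative ring. Then the maps $$V\mapsto\mathcal S=\{M\in\operatorname{Mod}R\mid\operatorname{supp}_R(M)\subseteq V\},\qquad \mathcal S\mapsto V=\bigcup_{M\in\mathcal S}\operatorname{supp}_R(M)$$ induce bijections between (1) the set of all subsets $V\subseteq\operatorname{Spec}R$ of the form $V=\bigcup_{i\in\Omega}Y_i$ with $\operatorname{Spec}R\setminus Y_i$ quasi-compact and open for all $i\in\Omega$, and (2) the set of all torsion classes of finite type in $\operatorname{Mod}R$. (Projective case.) Let $A=\bigoplus_{j\ge 0}A_j$ be a commutative (positively) graded ring which is finitely generated as an $A_0$-algebra. Then the maps $$V\mapsto\mathcal S=\{M\in\operatorname{QGr}A\mid\operatorname{supp}_A(M)\subseteq V\},\qquad \mathcal S\mapsto V=\bigcup_{M\in\mathcal S}\operatorname{supp}_A(M)$$ induce bijections between (1) the set of all subsets $V\subseteq\operatorname{Proj}A$ of the form $V=\bigcup_{i\in\Omega}Y_i$ with $\operatorname{Proj}A\setminus Y_i$ quasi-compact and open for all $i\in\Omega$, and (2) the set of all tensor torsion classes of finite type in $\operatorname{QGr}A$.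
   Context: Torsion classes. A Serre subcategory $\mathcal S$ of a Grothendieck category $\mathcal C$ is a full subcategory such that for every short exact sequence $0\to X'\to X\to X''\to 0$ one has $X\in\mathcal S$ iff $X',X''\in\mathcal S$; it is a torsion class if it is also closed under coproducts. The quotient category $\mathcal C/\mathcal S$ is identified with the full subcategory of those $C\in\mathcal C$ with $\operatorname{Hom}(T,C)=0=\operatorname{Ext}^1(T,C)$ for all $T\in\mathcal S$ (the $\mathcal S$-closed objects). The inclusion $\mathcal C/\mathcal S\to\mathcal C$ has an exact left adjoint, the localization (quotient) functor. The torsion class $\mathcal S$ is of finite type if the inclusion $\mathcal C/\mathcal S\to\mathcal C$ preserves directed sums (directed unions of subobjects). Affine notation. $\operatorname{Mod}R$ is the category of $R$-modules; $\operatorname{Spec}R$ has the Zariski topology; $\operatorname{supp}_R(M)=\{P\in\operatorname{Spec}R\mid M_P\ne0\}$. Graded notation. $\operatorname{Gr}A$ is the category of $\mathbb Z$-graded $A$-modules with degree-preserving homomorphisms, with the usual graded tensor product $\otimes$ over $A$. $A_+=\bigoplus_{j\ge1}A_j$, which is a finitely generated ideal since $A$ is a finitely generated $A_0$-algebra. $\operatorname{Tors}A$ is the torsion class of finite type in $\operatorname{Gr}A$ of the graded modules $M$ in which every homogeneous element is annihilated by some power of $A_+$. $\operatorname{QGr}A=\operatorname{Gr}A/\operatorname{Tors}A$, identified with the full subcategory of $\operatorname{Tors}A$-closed graded modules; $Q:\operatorname{Gr}A\to\operatorname{QGr}A$ is the quotient functor. The tensor product on $\operatorname{QGr}A$ is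 $X\boxtimes Y=Q(X\otimes Y)$. A tensor torsion class of $\operatorname{QGr}A$ is a torsion class $\mathcal S$ such that $X\in\mathcal S$ and $Y\in\operatorname{QGr}A$ imply $X\boxtimes Y\in\mathcal S$. $\operatorname{Proj}A$ is the set of homogeneous prime ideals of $A$ not containing $A_+$, with closed sets $V(I)=\{P\in\operatorname{Proj}A\mid P\supseteq I\}$ for homogeneous ideals $I$. For $P\in\operatorname{Proj}A$ and a graded module $M$, $M_P$ is the homogeneous localization of $M$ at $P$, i.e. the graded module obtained by inverting all homogeneous elements of $A$ not in $P$ (all degrees kept), and $\operatorname{supp}_A(M)=\{P\in\operatorname{Proj}A\mid M_P\neq0\}$. *)

(* Defs.v *)
From HB Require Import structures.
From mathcomp Require Import all_boot all_order all_algebra.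
From mathcomp Require Import boolp classical_sets functions topology.
From mathcomp Require Import ring.

Set Implicit Arguments.
Unset Strict Implicit.
Unset Printing Implicit Defensive.

Import GRing.Theory.

Local Open Scope classical_set_scope.
Local Open Scope ring_scope.
Local Open Scope quotient_scope.

Declare Scope cat_scope.
Delimit Scope cat_scope with cat.
Reserved Notation "g \oc f" (at level 50, left associativity).

Record category := Category {
  obj :> Type;
  hom : obj -> obj -> Type;
  idm : forall X, hom X X;
  cmp : forall X Y Z, hom Y Z -> hom X Y -> hom X Z;
  cmp1m : forall X Y (f : hom X Y), cmp (idm Y) f = f;
  cmpm1 : forall X Y (f : hom X Y), cmp f (idm X) = f;
  cmpA : forall X Y Z W (h : hom Z W) (g : hom Y Z) (f : hom X Y),
    cmp h (cmp g f) = cmp (cmp h g) f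
}.
Arguments hom {c} X Y : rename.
Arguments idm {c} X : rename.
Arguments cmp {c X Y Z} g f : rename.
Notation "g \oc f" := (cmp g f) : cat_scope.
Local Open Scope cat_scope.

Record functor (C D : category) := Functor {
  fobj :> C -> D;
  fmap : forall X Y, hom X Y -> hom (fobj X) (fobj Y);
  fmap1 : forall X, fmap (idm X) = idm (fobj X);
  fmapM : forall X Y Z (g : hom Y Z) (f : hom X Y),
    fmap (g \oc f) = fmap g \oc fmap f
}.
Arguments fmap {C D} F {X Y} f : rename.

Section FullSubcategory.
Variables (C : category) (P : C -> Prop).

Definition full_subcategory : category :=
  @Category {X : C | P X}
    (fun X Y => hom (sval X) (sval Y)) (fun X => idm (sval X))
    (fun X Y Z g f => g \oc f)
    (fun X Y f => cmp1m f) (fun X Y f => cmpm1 f)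
    (fun X Y Z W h g f => cmpA h g f).

Definition inclusion : functor full_subcategory C :=
  @Functor full_subcategory C sval (fun X Y f => f)
    (fun X => erefl) (fun X Y Z g f => erefl).

End FullSubcategory.

(* (Z, eta) is universal from M to F; for every M this computes the left
   adjoint of F at M, with unit eta. *)
Definition universal_arrow (C D : category) (F : functor D C) (M : C) (Z : D)
    (eta : hom M (F Z)) : Prop :=
  forall (W : D) (f : hom M (F W)),
    exists! g : hom Z W, fmap F g \oc eta = f.

Section AbelianNotions.
Variable C : category.
Implicit Types (S : C -> Prop).

Definition zero_object (Z : C) : Prop :=
  forall X, (exists! f : hom X Z, True) /\ (exists! f : hom Z X, True).

Definition zero_morphism (X Y : C) (f : hom X Y) : Prop :=
  exists (Z : C) (g : hom Z Y) (h : hom X Z), zero_object Z /\ f = g \oc h.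

Definition monic (X Y : C) (f : hom X Y) : Prop :=
  forall W (u v : hom W X), f \oc u = f \oc v -> u = v.

Definition is_kernel (K X Y : C) (k : hom K X) (g : hom X Y) : Prop :=
  zero_morphism (g \oc k) /\
  forall W (t : hom W X), zero_morphism (g \oc t) ->
    exists! u : hom W K, k \oc u = t.

Definition is_cokernel (X Y Q : C) (f : hom X Y) (q : hom Y Q) : Prop :=
  zero_morphism (q \oc f) /\
  forall W (t : hom Y W), zero_morphism (t \oc f) ->
    exists! u : hom Q W, u \oc q = t.

Definition short_exact (X' X X'' : C) (f : hom X' X) (g : hom X X'') : Prop :=
  is_kernel f g /\ is_cokernel f g.

Definition is_coproduct (I : Type) (X : I -> C) (Y : C)
    (inj : forall i, hom (X i) Y) : Prop :=
  forall (W : C) (f : forall i, hom (X i) W),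
    exists! g : hom Y W, forall i, g \oc inj i = f i.

(* Yoneda description: every extension 0 -> X -> E -> T -> 0 splits. *)
Definition ext1_zero (T X : C) : Prop :=
  forall (E : C) (f : hom X E) (g : hom E T), short_exact f g ->
    exists s : hom T E, g \oc s = idm T.

Definition Serre_subcategory S : Prop :=
  forall (X' X X'' : C) (f : hom X' X) (g : hom X X''), short_exact f g ->
    (S X <-> S X' /\ S X'').

(* The index type may be empty, so a torsion class contains the zero objects. *)
Definition torsion_class S : Prop :=
  Serre_subcategory S /\
  forall (I : Type) (X : I -> C) (Y : C) (inj : forall i, hom (X i) Y),
    (forall i, S (X i)) -> is_coproduct inj -> S Y.

Definition closed_object S (X : C) : Prop :=
  forall T, S T -> (forall h : hom T X, zero_morphism h) /\ ext1_zero T X.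

(* C/S, identified with the full subcategory of the S-closed objects. *)
Definition quotient_category S : category :=
  full_subcategory (closed_object S).

(* [y] is the sum of the subobjects [u i] of X, i.e. their join in the ordered
   class of subobjects of X. *)
Definition is_sum_of_subobjects (I : Type) (X : C) (U : I -> C)
    (u : forall i, hom (U i) X) (Y : C) (y : hom Y X) : Prop :=
  [/\ monic y,
      forall i, exists v : hom (U i) Y, y \oc v = u i
    & forall (W : C) (w : hom W X), monic w ->
        (forall i, exists v : hom (U i) W, w \oc v = u i) ->
        exists v : hom Y W, w \oc v = y].

Definition directed_subobjects (I : Type) (X : C) (U : I -> C)
    (u : forall i, hom (U i) X) : Prop :=
  [/\ forall i, monic (u i),
      exists i : I, True
    & forall i j, exists k,
        (exists v : hom (U i) (U k), u k \oc v = u i) /\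
        (exists v : hom (U j) (U k), u k \oc v = u j)].

End AbelianNotions.

Definition preserves_directed_sums (D C : category) (F : functor D C) : Prop :=
  forall (I : Type) (X : D) (U : I -> D) (u : forall i, hom (U i) X),
    directed_subobjects u ->
    forall (Y : D) (y : hom Y X), is_sum_of_subobjects u y ->
      is_sum_of_subobjects (fun i => fmap F (u i)) (fmap F y).

Definition finite_type (C : category) (S : C -> Prop) : Prop :=
  preserves_directed_sums (inclusion (closed_object S)).

Section ModuleCategory.
Variable R : comPzRingType.

Lemma linear_ext (U V : lmodType R) (f g : {linear U -> V}) :
  f =1 g -> f = g.
Proof.
case: f g => [f [[a] [b]]] [g [[c] [d]]] /= /funext e; subst g.
by congr (GRing.Linear.Pack (GRing.Linear.Class _ _)); congr (_ _);
  exact: Prop_irrelevance.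
Qed.

Definition lin_id (M : lmodType R) : {linear M -> M} := idfun.

Definition lin_comp (M N L : lmodType R) (g : {linear N -> L})
  (f : {linear M -> N}) : {linear M -> L} := (g \o f)%FUN.

Definition Mod : category.
Proof.
apply: (@Category (lmodType R) (fun M N => {linear M -> N})
  lin_id lin_comp); by move=> *; apply: linear_ext.
Defined.

End ModuleCategory.

Record mul_set (R : comPzRingType) := MulSet {
  mul_set_car :> set R;
  mul_set1 : mul_set_car 1;
  mul_setM : forall s t, mul_set_car s -> mul_set_car t -> mul_set_car (s * t)
}.

Section Localization.
Variables (R : comPzRingType) (mS : mul_set R) (M : lmodType R).
Local Notation S := (mul_set_car mS).

Definition denom : Type := {s : R | s \in S}.
HB.instance Definition _ := Choice.on denom.

Lemma denomP (s : denom) : S (sval s). Proof. exact/set_mem/(svalP s). Qed.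

Definition mk_denom (s : R) (Ss : S s) : denom := exist _ s (mem_set Ss).

(* m / s = m' / s' iff u (s' m) = u (s m') for some u in S *)
Definition frac_eq (x y : M * denom) : bool :=
  `[< exists2 u, S u & u *: (sval y.2 *: x.1) = u *: (sval x.2 *: y.1) >].

Lemma frac_eq_refl : reflexive frac_eq.
Proof. by move=> x; apply/asboolP; exists 1 => //; exact: mul_set1. Qed.

Lemma frac_eq_sym : symmetric frac_eq.
Proof. by move=> x y; apply/asboolP/asboolP => -[u Su e]; exists u. Qed.

Lemma frac_eq_trans : transitive frac_eq.
Proof.
move=> [m2 s2] [m1 s1] [m3 s3] /asboolP[u Su /= e1] /asboolP[v Sv /= e2].
apply/asboolP; exists (u * v * sval s2) => /=.
  by apply: mul_setM (denomP _); apply: mul_setM.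
transitivity ((v * sval s3) *: (u *: (sval s2 *: m1))).
  by rewrite !scalerA; congr (_ *: _); ring.
rewrite e1.
transitivity ((u * sval s1) *: (v *: (sval s3 *: m2))).
  by rewrite !scalerA; congr (_ *: _); ring.
by rewrite e2 !scalerA; congr (_ *: _); ring.
Qed.

Canonical frac_equiv := EquivRel frac_eq
  frac_eq_refl frac_eq_sym frac_eq_trans.

Definition localization : Type := {eq_quot frac_equiv}.
HB.instance Definition _ := Choice.on localization.

Definition mk_frac (m : M) (s : denom) : localization :=
  \pi_({eq_quot frac_equiv}) (m, s).

Lemma mk_fracP (m m' : M) (s s' : denom) :
  mk_frac m s = mk_frac m' s' <->
  exists2 u, S u & u *: (sval s' *: m) = u *: (sval s *: m').
Proof. by split=> [/eqmodP/asboolP|h]; last exact/eqmodP/asboolP. Qed.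

Definition lnum (x : localization) : M := (repr (x : {eq_quot frac_equiv})).1.
Definition lden (x : localization) : denom :=
  (repr (x : {eq_quot frac_equiv})).2.

Lemma mk_fracK x : mk_frac (lnum x) (lden x) = x.
Proof. by rewrite /mk_frac /lnum /lden -surjective_pairing reprK. Qed.

Definition den1 : denom := mk_denom (mul_set1 mS).
Definition denM (s t : denom) : denom :=
  mk_denom (mul_setM (denomP s) (denomP t)).

Definition loc_zero : localization := mk_frac 0 den1.
Definition loc_opp (x : localization) := mk_frac (- lnum x) (lden x).
Definition loc_add (x y : localization) :=
  mk_frac (sval (lden y) *: lnum x + sval (lden x) *: lnum y)
    (denM (lden x) (lden y)).
Definition loc_scale (a : R) (x : localization) :=
  mk_frac (a *: lnum x) (lden x).

Lemma loc_elim (P : localization -> Prop) :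
  (forall m s, P (mk_frac m s)) -> forall x, P x.
Proof. by move=> h x; rewrite -(mk_fracK x). Qed.

Lemma loc_oppE m s : loc_opp (mk_frac m s) = mk_frac (- m) s.
Proof.
have /mk_fracP[u Su e] := mk_fracK (mk_frac m s).
by apply/mk_fracP; exists u => //; rewrite !scalerN e.
Qed.

Lemma loc_scaleE a m s : loc_scale a (mk_frac m s) = mk_frac (a *: m) s.
Proof.
have /mk_fracP[u Su e] := mk_fracK (mk_frac m s).
apply/mk_fracP; exists u => //.
move: e => /(congr1 (fun z => a *: z)); rewrite !scalerA => e.
by rewrite [u * _ * a]mulrC mulrA e; congr (_ *: _); ring.
Qed.

Lemma loc_addE m s m' s' : loc_add (mk_frac m s) (mk_frac m' s') =
  mk_frac (sval s' *: m + sval s *: m') (denM s s').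
Proof.
have /mk_fracP[u Su] := mk_fracK (mk_frac m s).
have /mk_fracP[v Sv] := mk_fracK (mk_frac m' s').
rewrite /loc_add.
move: (lnum _) (lden _) (lnum _) (lden _) => n t n' t' e' e.
apply/mk_fracP; exists (u * v); first exact: mul_setM.
rewrite /= !scalerDr; congr (_ + _).
- transitivity ((v * sval s' * sval t') *: (u *: (sval s *: n))).
    by rewrite !scalerA; congr (_ *: _); ring.
  by rewrite e !scalerA; congr (_ *: _); ring.
- transitivity ((u * sval s * sval t) *: (v *: (sval s' *: n'))).
    by rewrite !scalerA; congr (_ *: _); ring.
  by rewrite e' !scalerA; congr (_ *: _); ring.
Qed.

Lemma mk_frac_eq m m' s s' : sval s' *: m = sval s *: m' ->
  mk_frac m s = mk_frac m' s'.
Proof.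
by move=> e; apply/mk_fracP; exists 1; [exact: mul_set1|rewrite e].
Qed.

Lemma loc_addA : associative loc_add.
Proof.
elim/loc_elim => m s; elim/loc_elim => m' s'; elim/loc_elim => m'' s''.
rewrite !loc_addE; apply: mk_frac_eq; rewrite /= !scalerDr !scalerA !addrA.
by congr (_ *: _ + _ *: _ + _ *: _); ring.
Qed.

Lemma loc_addC : commutative loc_add.
Proof.
elim/loc_elim => m s; elim/loc_elim => m' s'.
by rewrite !loc_addE addrC; apply: mk_frac_eq; rewrite /= mulrC.
Qed.

Lemma loc_add0 : left_id loc_zero loc_add.
Proof.
elim/loc_elim => m s; rewrite loc_addE; apply: mk_frac_eq => /=.
by rewrite scaler0 add0r scale1r mul1r.
Qed.

Lemma loc_addN : left_inverse loc_zero loc_opp loc_add.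
Proof.
elim/loc_elim => m s; rewrite loc_oppE loc_addE; apply: mk_frac_eq => /=.
by rewrite scalerN addNr !scaler0.
Qed.

HB.instance Definition _ := GRing.isZmodule.Build localization
  loc_addA loc_addC loc_add0 loc_addN.

Lemma loc_scaleA a b x : loc_scale a (loc_scale b x) = loc_scale (a * b) x.
Proof. by elim/loc_elim: x => m s; rewrite !loc_scaleE scalerA. Qed.

Lemma loc_scale1 : left_id 1 loc_scale.
Proof. by elim/loc_elim => m s; rewrite loc_scaleE scale1r. Qed.

Lemma loc_scaleDr : right_distributive loc_scale +%R.
Proof.
move=> a; elim/loc_elim => m s; elim/loc_elim => m' s'.
rewrite ![_ + _]loc_addE !loc_scaleE [RHS]loc_addE.
congr mk_frac.
by rewrite scalerDr !scalerA; congr (_ *: _ + _ *: _); rewrite mulrC.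
Qed.

Lemma loc_scaleDl x : {morph loc_scale^~ x : a b / a + b}.
Proof.
elim/loc_elim: x => m s a b.
rewrite !loc_scaleE [RHS]loc_addE; apply: mk_frac_eq => /=.
by rewrite !scalerA -scalerDl scalerA -mulrDr mulrA.
Qed.

HB.instance Definition _ := GRing.Zmodule_isLmodule.Build R localization
  loc_scaleA loc_scale1 loc_scaleDr loc_scaleDl.

End Localization.

Definition nonzero_module (R : comPzRingType) (M : lmodType R) : Prop :=
  exists x : M, x <> 0.

(* The library's ideals are decidable and proper, over nontrivial rings. *)
Section Ideals.
Variable R : comPzRingType.
Implicit Types (I J P X : set R).

Definition ideal I : Prop :=
  [/\ I 0, forall x y, I x -> I y -> I (x + y)
    & forall a x, I x -> I (a * x)].

Definition prime_ideal P : Prop :=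
  [/\ ideal P, ~ P 1 & forall a b, P (a * b) -> P a \/ P b].

Definition ideal_span X : set R :=
  [set x | forall J, ideal J -> X `<=` J -> J x].

Definition ideal_pow I (n : nat) : set R :=
  ideal_span [set x | exists2 a : 'I_n -> R,
    forall i, I (a i) & x = \prod_(i < n) a i].

End Ideals.

(* [K] is the class of ideals defining closed sets (all ideals, resp. all
   homogeneous ideals) and [pt] sends a point to its prime ideal. *)
Section Zariski.
Variables (R : comPzRingType) (X : Type) (pt : X -> set R) (K : set (set R)).

Definition zariski_closed_set (I : set R) : set X :=
  [set P | I `<=` pt P].

Definition zariski_open : set (set X) :=
  [set U | exists2 I, K I & U = ~` zariski_closed_set I].

Hypothesis pt_prime : forall P, prime_ideal (pt P).
Hypothesis pt_K : forall P, K (pt P).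
Hypothesis K_ideal : forall I, K I -> ideal I.
Hypothesis K_inter : forall F : set (set R), F `<=` K -> K (\bigcap_(J in F) J).

Lemma zariski_openT : zariski_open setT.
Proof.
exists setT; first by rewrite -[setT](bigcap_set0 id); exact: K_inter.
apply/seteqP; split=> // P _ /(_ 1 I).
by case: (pt_prime P).
Qed.

Lemma zariski_openI : setI_closed zariski_open.
Proof.
move=> _ _ [I KI ->] [J KJ ->]; exists (I `&` J).
  rewrite -bigcap2E; have -> : \bigcap_i bigcap2 I J i =
    \bigcap_(L in [set I; J]) L.
    apply/seteqP; split=> x h.
      by move=> L [->|->]; [exact: (h 0%N)|exact: (h 1%N)].
    by case=> [|[|n]] _ //=; apply: h; [left|right].
  by apply: K_inter => L [->|->].
apply/seteqP; split=> P /=.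
  case=> nI nJ sIJ; apply: nI => x Ix; apply: contrapT => nPx.
  apply: nJ => y Jy; have [_ _ /(_ x y)] := pt_prime P.
  case=> //; apply: sIJ; split; last by have [_ _] := K_ideal KJ; apply.
  by have [_ _] := K_ideal KI; rewrite mulrC; apply.
by move=> nIJ; split=> sub; apply: nIJ => x [Ix Jx]; apply: sub.
Qed.

Lemma zariski_open_bigU (L : Type) (f : L -> set X) :
  (forall i, zariski_open (f i)) -> zariski_open (\bigcup_i f i).
Proof.
move=> of_; pose F := [set J | K J /\
  forall i I, K I -> f i = ~` zariski_closed_set I -> I `<=` J].
exists (\bigcap_(J in F) J); first by apply: K_inter => J [].
apply/seteqP; split=> P /=.
  move=> [i _ fiP] sub; have [I KI fiE] := of_ i.
  move: fiP; rewrite fiE; apply=> x Ix; apply: sub => J [_ h].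
  exact: h _ _ KI fiE _ Ix.
move=> nsub; apply: contrapT => nU; apply: nsub => x.
apply; split=> // i I KI fiE; apply: contrapT => nI.
by apply: nU; exists i => //; rewrite fiE.
Qed.

End Zariski.

Section Spec.
Variable R : comPzRingType.

Record Spec := MkSpec {
  spec_ideal :> set R;
  spec_prime : prime_ideal spec_ideal
}.

HB.instance Definition _ := gen_eqMixin Spec.
HB.instance Definition _ := gen_choiceMixin Spec.

Lemma ideal_inter (F : set (set R)) : F `<=` @ideal R ->
  ideal (\bigcap_(J in F) J).
Proof.
move=> h; split.
- by move=> J /h[].
- by move=> x y Fx Fy J FJ; have [_ + _] := h J FJ; apply; [exact: Fx|exact: Fy].
- by move=> a x Fx J FJ; have [_ _] := h J FJ; apply; exact: Fx.
Qed.

Let spec_is_ideal (P : Spec) : ideal P. Proof. by case: (spec_prime P). Qed.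

HB.instance Definition _ := isOpenTopological.Build Spec
  (zariski_openT spec_prime ideal_inter)
  (zariski_openI spec_prime (fun _ => id) ideal_inter)
  (zariski_open_bigU spec_is_ideal ideal_inter).

Definition spec_compl (P : Spec) : mul_set R.
Proof.
refine (@MulSet R (~` (P : set R)) _ _); case: P => P [] //=.
by move=> _ _ h s t Ps Pt /h[].
Defined.

Definition supp (M : lmodType R) : set Spec :=
  [set P | nonzero_module (localization (spec_compl P) M)].

End Spec.

(* Finite sums are indexed by duplicate-free lists, a being arbitrary off s. *)
Definition internal_direct_sum (T : zmodType) (I : eqType) (B : I -> set T) :
    Prop :=
  [/\ forall i, B i 0 /\ forall x y, B i x -> B i y -> B i (x - y),
      forall x, exists (s : seq I) (a : I -> T),
        [/\ uniq s, forall i, B i (a i) & x = \sum_(i <- s) a i]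
    & forall (s : seq I) (a : I -> T), uniq s -> (forall i, B i (a i)) ->
        \sum_(i <- s) a i = 0 -> {in s, forall i, a i = 0}].

Record graded_ring := GradedRing {
  gr_ring :> comPzRingType;
  gr_comp : nat -> set gr_ring;
  gr_sum : internal_direct_sum gr_comp;
  gr_one : gr_comp 0 1;
  gr_mul : forall i j x y,
    gr_comp i x -> gr_comp j y -> gr_comp (i + j)%N (x * y)
}.

(* The only subring of A containing A_0 and gens is A itself; 1 lies in A_0. *)
Definition fg_algebra (A : graded_ring) : Prop :=
  exists gens : seq A, forall B : set A,
    gr_comp 0 `<=` B -> (forall x, x \in gens -> B x) ->
    (forall x y, B x -> B y -> B (x - y)) ->
    (forall x y, B x -> B y -> B (x * y)) ->
    B = setT.

Section Graded.
Variable A : graded_ring.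

Definition homogeneous : set A := [set x | exists j, gr_comp j x].

Definition irrelevant_ideal : set A :=
  [set x | exists (s : seq nat) (a : nat -> A),
    [/\ {in s, forall j, (0 < j)%N}, forall j, gr_comp j (a j)
      & x = \sum_(j <- s) a j]].

Definition homogeneous_ideal (I : set A) : Prop :=
  ideal I /\
  forall (s : seq nat) (a : nat -> A), uniq s -> (forall j, gr_comp j (a j)) ->
    I (\sum_(j <- s) a j) -> {in s, forall j, I (a j)}.

Record Proj := MkProj {
  proj_ideal :> set A;
  proj_prime : prime_ideal proj_ideal;
  proj_homogeneous : homogeneous_ideal proj_ideal;
  proj_relevant : ~ irrelevant_ideal `<=` proj_ideal
}.

HB.instance Definition _ := gen_eqMixin Proj.
HB.instance Definition _ := gen_choiceMixin Proj.

Lemma homogeneous_ideal_inter (F : set (set A)) : F `<=` homogeneous_ideal ->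
  homogeneous_ideal (\bigcap_(J in F) J).
Proof.
move=> h; split; first by apply: ideal_inter => J /h[].
move=> s a us ha sumF j js J FJ; have [_ H] := h J FJ.
by apply: (H s) => //; exact: sumF.
Qed.

Let homogeneous_is_ideal (I : set A) : homogeneous_ideal I -> ideal I.
Proof. by case. Qed.

HB.instance Definition _ := isOpenTopological.Build Proj
  (zariski_openT proj_prime homogeneous_ideal_inter)
  (zariski_openI proj_prime homogeneous_is_ideal homogeneous_ideal_inter)
  (zariski_open_bigU proj_homogeneous homogeneous_ideal_inter).

Record graded_module := GradedModule {
  gm_mod :> lmodType A;
  gm_comp : int -> set gm_mod;
  gm_sum : internal_direct_sum gm_comp;
  gm_scale : forall (i : nat) (n : int) (a : A) (x : gm_mod),
    gr_comp i a -> gm_comp n x -> gm_comp (i%:Z + n) (a *: x)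
}.

Record graded_hom (M N : graded_module) := GradedHom {
  gh_lin :> {linear M -> N};
  gh_degree : forall n x, gm_comp n x -> gm_comp n (gh_lin x)
}.

Lemma graded_hom_ext (M N : graded_module) (f g : graded_hom M N) :
  f =1 g -> f = g.
Proof.
case: f g => [f hf] [g hg] /= /linear_ext e; subst g.
by congr GradedHom; exact: Prop_irrelevance.
Qed.

Definition gh_id (M : graded_module) : graded_hom M M :=
  @GradedHom M M (lin_id M) (fun n x h => h).

Definition gh_comp (M N L : graded_module) (g : graded_hom N L)
    (f : graded_hom M N) : graded_hom M L :=
  @GradedHom M L (lin_comp g f)
    (fun n x h => gh_degree g (gh_degree f h)).

Definition Gr : category.
Proof.
apply: (@Category graded_module graded_hom gh_id gh_comp);
  by move=> *; apply: graded_hom_ext.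
Defined.

Definition Tors (M : Gr) : Prop :=
  forall (n : int) (x : M), gm_comp n x ->
    exists k : nat, forall a, ideal_pow irrelevant_ideal k a -> a *: x = 0.

Definition QGr : category := quotient_category Tors.

Definition QGr_module (X : QGr) : graded_module := sval X.

Definition bilinear_map (M N T : lmodType A) (b : M -> N -> T) : Prop :=
  (forall x, linear (b x)) /\ (forall y, linear (b^~ y)).

(* T is the tensor product of the underlying modules, graded so that
   deg (x (x) y) = deg x + deg y; since the x (x) y generate T, this determines
   the grading. *)
Definition is_graded_tensor (M N T : graded_module) (b : M -> N -> T) : Prop :=
  [/\ bilinear_map b,
      forall (L : lmodType A) (c : M -> N -> L), bilinear_map c ->
        exists! f : {linear T -> L}, forall x y, f (b x y) = c x y
    & forall (i j : int) x y, gm_comp i x -> gm_comp j y ->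
        gm_comp (i + j) (b x y)].

(* Z = Q(M), where Q is the left adjoint of the inclusion of QGr in Gr *)
Definition is_Q (M : Gr) (Z : QGr) : Prop :=
  exists eta : hom M (inclusion (closed_object Tors) Z), universal_arrow eta.

(* Z = Q (X (x) Y) *)
Definition is_boxtimes (X Y Z : QGr) : Prop :=
  exists (T : graded_module)
    (b : QGr_module X -> QGr_module Y -> T),
    is_graded_tensor b /\ is_Q T Z.

Definition tensor_torsion_class (S : QGr -> Prop) : Prop :=
  torsion_class S /\
  forall X Y Z : QGr, is_boxtimes X Y Z -> S X -> S Z.

Definition proj_compl (P : Proj) : mul_set A.
Proof.
refine (@MulSet A (homogeneous `&` ~` (P : set A)) _ _).
  by split; [exists 0%N; exact: gr_one|case: (proj_prime P)].
move=> s t [[i si] nPs] [[j tj] nPt]; split.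
  by exists (i + j)%N; exact: gr_mul.
by have [_ _ h] := proj_prime P; move=> /h[].
Defined.

(* The degrees of M_P play no role in M_P <> 0, so only the underlying module
   of the homogeneous localization is recorded. *)
Definition gsupp (M : graded_module) : set Proj :=
  [set P | nonzero_module (localization (proj_compl P) M)].

End Graded.

(* [compact] is quasi-compactness: no separation is assumed. *)
Definition union_of_qc_co_open (X : topologicalType) (V : set X) : Prop :=
  exists (Omega : Type) (Y : Omega -> set X),
    (forall i, open (~` Y i) /\ compact (~` Y i)) /\ V = \bigcup_i Y i.

Definition inverse_bijections (T U : Type) (D : T -> Prop) (E : U -> Prop)
    (f : T -> U) (g : U -> T) : Prop :=
  [/\ forall x, D x -> E (f x), forall y, E y -> D (g y),
      forall x, D x -> g (f x) = x & forall y, E y -> f (g y) = y].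

(* Main.v *)
Require Import Defs.
From HB Require Import structures.
From mathcomp Require Import all_boot all_order all_algebra.
From mathcomp Require Import boolp classical_sets functions topology.
From mathcomp Require Import ring.

(** Both cases are instances of one statement about modules graded by an
    abelian group G, over a commutative G-graded ring R: the group with one
    element gives Mod R, the integers give Gr A. A Gabriel filter F of
    homogeneous ideals has torsion elements, those killed by a member of F,
    and closed modules. Both Mod R and QGr A are categories of F-closed
    modules: for the trivial filter, and for the filter of the ideals that
    contain a power of A+. The record [modcat] captures this situation.

    In such a category C, shift invariant torsion classes S correspond to the
    Gabriel filters that contain F. The filter of S consists of the ideals I
    such that the reflection of R / I lies in S ([filter_of],
    [filter_of_gabriel]); S is recovered as the class of modules that are
    torsion for it ([S_char]), and S-closed objects are the modules closed for
    it ([closed_objectE]). So C / S is again a category of closed modules, in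
    which joins of subobjects are saturations of unions ([quot_modcat],
    [sum_of_subobjectsE]). Comparing joins in C / S and in C shows that S is
    of finite type exactly when its filter has a basis of finitely generated
    ideals ([fg_based_finite_type], [finite_type_fg_based]).

    Such a filter is determined by the primes in it: by Zorn's lemma an ideal
    outside it lies in a prime outside it ([maximal_prime_ex]). The primes in
    it that are points of the space form a union of sets V(s) with s a finite
    list of homogeneous elements, and these V(s) are the closed sets with
    quasi-compact complement ([Vseq_compact], [qc_co_open_Vseq]). Conversely a
    union V of such sets defines the filter of the ideals I with V(I) inside
    V; it is generated by the lists s with V(s) inside V, so it is finitely
    generated ([filter_onE]). This gives [torsion_correspondence].

    In QGr A it remains to see that a torsion class is a tensor torsion class
    exactly when it is shift invariant. Torsion passes to tensor products
    ([shift_tensor_torsion]), and the shift X(t) is the product in QGr A of X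
    with the reflection of A(t) ([tensor_shift]). *)

Set Implicit Arguments.
Unset Strict Implicit.
Unset Printing Implicit Defensive.

Import GRing.Theory.

Local Open Scope classical_set_scope.
Local Open Scope ring_scope.
Local Open Scope cat_scope.

Local Notation hom := Defs.hom.
Local Notation monic := Defs.monic.

(** * Homogeneous components *)

Lemma seq_cover (I : eqType) (s t : seq I) : exists u : seq I,
  [/\ uniq u, {subset s <= u}, {subset t <= u}
    & forall i, i \notin u -> i \notin s /\ i \notin t].
Proof.
exists (undup (s ++ t)); split=> [|i|i|i]; rewrite ?undup_uniq // mem_undup mem_cat.
- by move=> ->.
- by move=> ->; rewrite orbT.
- by rewrite negb_or => /andP.
Qed.

Section HomogeneousComponents.
Variables (I : eqType) (T : zmodType) (B : I -> set T).
Hypothesis dsB : internal_direct_sum B.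

Lemma ids0 i : B i 0.
Proof. by case: dsB => h _ _; case: (h i). Qed.

Lemma idsB i x y : B i x -> B i y -> B i (x - y).
Proof. by case: dsB => h _ _; case: (h i) => _; apply. Qed.

Lemma idsN i x : B i x -> B i (- x).
Proof. by move=> Bx; rewrite -sub0r; apply: idsB => //; exact: ids0. Qed.

Lemma idsD i x y : B i x -> B i y -> B i (x + y).
Proof. by move=> Bx By; rewrite -[y]opprK; apply: idsB => //; exact: idsN. Qed.

Lemma sum_widen (s u : seq I) (f : I -> T) : uniq s -> uniq u ->
  {subset s <= u} -> (forall i, i \notin s -> f i = 0) ->
  \sum_(i <- u) f i = \sum_(i <- s) f i.
Proof.
move=> us uu su f0; rewrite (bigID (mem s)) /= [X in _ + X]big1 ?addr0; last first.
  by move=> i; apply: f0.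
rewrite -big_filter; apply: perm_big; apply: uniq_perm => //.
  exact: filter_uniq.
by move=> i; rewrite mem_filter; case: (boolP (i \in s)) => // /su ->.
Qed.

Lemma gpr_ex x : exists f : I -> T, (forall i, B i (f i)) /\
  exists s : seq I, [/\ uniq s, forall i, i \notin s -> f i = 0
    & x = \sum_(i <- s) f i].
Proof.
have [_ /(_ x)[s [a [us Ba ->]]] _] := dsB.
exists (fun i => if i \in s then a i else 0); split.
  by move=> i; case: ifP => // _; exact: ids0.
exists s; split=> //; first by move=> i /negbTE ->.
by rewrite big_seq [RHS]big_seq; apply: eq_bigr => i ->.
Qed.

(** Components are chosen; by [gpr_char] they do not depend on the
    decomposition. *)
Definition gpr (i : I) (x : T) : T := projT1 (cid (gpr_ex x)) i.

Lemma gprP i x : B i (gpr i x).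
Proof. by rewrite /gpr; case: cid => f /= []. Qed.

Lemma gpr_supp x : exists s : seq I,
  [/\ uniq s, forall i, i \notin s -> gpr i x = 0 & x = \sum_(i <- s) gpr i x].
Proof. by rewrite /gpr; case: cid => f /= []. Qed.

Lemma gpr_char x (f : I -> T) (s : seq I) : uniq s -> (forall i, B i (f i)) ->
  (forall i, i \notin s -> f i = 0) -> x = \sum_(i <- s) f i ->
  forall i, gpr i x = f i.
Proof.
move=> us Bf f0 xE i; have [t [ut g0 xE']] := gpr_supp x.
have [u [uu su tu nu]] := seq_cover s t.
have : \sum_(i <- u) (gpr i x - f i) = 0.
  by rewrite sumrB (@sum_widen t u) // (@sum_widen s u) // -xE -xE' subrr.
move=> sum0; have [_ _ /(_ _ _ uu _ sum0) h] := dsB.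
have {h}/h : forall i, B i (gpr i x - f i).
  by move=> j; apply: idsB => //; exact: gprP.
case: (boolP (i \in u)) => [iu /(_ i iu)/subr0_eq //|].
by move=> /nu[i1 i2] _; rewrite g0 ?f0.
Qed.

Lemma gprD i x y : gpr i (x + y) = gpr i x + gpr i y.
Proof.
have [s [us s0 xE]] := gpr_supp x; have [t [ut t0 yE]] := gpr_supp y.
have [u [uu su tu nu]] := seq_cover s t.
apply: (@gpr_char _ (fun i => gpr i x + gpr i y) u).
- exact: uu.
- by move=> j; apply: idsD; exact: gprP.
- by move=> j /nu[/s0-> /t0->]; rewrite addr0.
- by rewrite big_split /= (@sum_widen s u) // (@sum_widen t u) // -xE -yE.
Qed.

Lemma gpr_id i x : B i x -> gpr i x = x.
Proof.
move=> Bx; rewrite (@gpr_char x (fun j => if j == i then x else 0) [:: i]) ?eqxx //.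
- by move=> j; case: eqP => [->//|_]; exact: ids0.
- by move=> j; rewrite inE => /negbTE ->.
- by rewrite big_seq1 eqxx.
Qed.

Lemma gpr_neq i j x : B i x -> j != i -> gpr j x = 0.
Proof.
move=> Bx ji; rewrite (@gpr_char x (fun j => if j == i then x else 0) [:: i]) ?(negbTE ji) //.
- by move=> k; case: eqP => [->//|_]; exact: ids0.
- by move=> k; rewrite inE => /negbTE ->.
- by rewrite big_seq1 eqxx.
Qed.

Lemma gpr0 i : gpr i 0 = 0.
Proof. by rewrite gpr_id //; exact: ids0. Qed.

Lemma gprN i x : gpr i (- x) = - gpr i x.
Proof. by apply/eqP; rewrite -addr_eq0 -gprD addNr gpr0. Qed.

Lemma gprB i x y : gpr i (x - y) = gpr i x - gpr i y.
Proof. by rewrite gprD gprN. Qed.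

Lemma gpr_sum i (J : Type) (s : seq J) (f : J -> T) :
  gpr i (\sum_(j <- s) f j) = \sum_(j <- s) gpr i (f j).
Proof. exact: (big_morph (gpr i) (gprD i) (gpr0 i)). Qed.

Lemma gpr_eq0 x : (forall i, gpr i x = 0) -> x = 0.
Proof.
by move=> h; have [s [_ _ ->]] := gpr_supp x; rewrite big1 // => i _.
Qed.

Lemma gpr_homog i x : (forall j, j != i -> gpr j x = 0) -> B i x.
Proof.
move=> h; suff -> : x = gpr i x by exact: gprP.
apply/eqP; rewrite -subr_eq0; apply/eqP; apply: gpr_eq0 => j.
rewrite gprB; have [->|ji] := eqVneq j i.
  by rewrite [gpr i (gpr i x)]gpr_id ?subrr //; exact: gprP.
by rewrite h // (gpr_neq (gprP i x)) // subrr.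
Qed.

Lemma gpr_ind (Q : T -> Prop) : Q 0 -> (forall x y, Q x -> Q y -> Q (x + y)) ->
  (forall i x, B i x -> Q x) -> forall x, Q x.
Proof.
move=> Q0 QD QB x; have [s [_ _ ->]] := gpr_supp x.
by elim/big_ind: _ => // i _; apply: (QB i); exact: gprP.
Qed.

Lemma gpr_ind_in (Q : T -> Prop) x : Q 0 -> (forall x y, Q x -> Q y -> Q (x + y)) ->
  (forall i, Q (gpr i x)) -> Q x.
Proof.
move=> Q0 QD QB; have [s [_ _ ->]] := gpr_supp x.
by elim/big_ind: _ => // i _; apply: (QB i).
Qed.

End HomogeneousComponents.

(** Multiplication by a homogeneous scalar is the main case: it shifts degrees
    by an injection. *)
Lemma gpr_morph (I I' : eqType) (T T' : zmodType) (B : I -> set T)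
    (B' : I' -> set T') (dB : internal_direct_sum B)
    (dB' : internal_direct_sum B') (f : T -> T') (h : I -> I') :
  f 0 = 0 -> (forall x y, f (x + y) = f x + f y) ->
  injective h -> (forall i x, B i x -> B' (h i) (f x)) ->
  forall i x, gpr dB' (h i) (f x) = f (gpr dB i x).
Proof.
move=> f0 fD hinj fB i; apply: (gpr_ind dB).
- by rewrite f0 !gpr0 f0.
- by move=> x y e1 e2; rewrite fD !gprD e1 e2 -fD.
- move=> j x Bx; have [->|ji] := eqVneq i j.
    by rewrite gpr_id ?(gpr_id dB Bx) //; exact: fB.
  rewrite (gpr_neq dB Bx ji) f0 (@gpr_neq _ _ _ dB' (h j)) ?(inj_eq hinj) //.
  exact: fB.
Qed.

(** Regrading along an injection with partial inverse [k]: shifts, and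
    gradings by naturals seen as gradings by integers. *)
Lemma internal_direct_sum_reindex (I J : eqType) (T : zmodType) (B : I -> set T)
    (h : I -> J) (k : J -> option I) : pcancel h k -> ocancel k h ->
  internal_direct_sum B ->
  internal_direct_sum (fun j => if k j is Some i then B i else [set 0]).
Proof.
move=> hk kh [B0 Bs Bi]; split.
- move=> j; case: (k j) => [i|]; first exact: B0.
  by split=> // x y -> ->; rewrite subr0.
- move=> x; have [s [a [us Ba ->]]] := Bs x.
  exists (map h s), (fun j => if k j is Some i then a i else 0); split.
  + by rewrite map_inj_uniq //; exact: pcan_inj hk.
  + by move=> j; case: (k j).
  + by rewrite big_map; apply: eq_bigr => i _; rewrite hk.
- move=> s a us Ba sum0.
  have a0 j : k j = None -> a j = 0 by move=> kj; have := Ba j; rewrite kj.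
  have hkj j i : k j = Some i -> h i = j by move=> kj; have := kh j; rewrite kj.
  have sE : \sum_(i <- pmap k s) a (h i) = 0.
    rewrite -[RHS]sum0; elim: s {us sum0} => [|j s IH] /=; first by rewrite !big_nil.
    rewrite [RHS]big_cons -IH; case kj: (k j) => [i|] /=.
      by rewrite big_cons (hkj _ _ kj).
    by rewrite a0 // add0r.
  have us' : uniq (pmap k s) by apply: (pmap_uniq kh).
  have Ba' i : B i (a (h i)) by have := Ba (h i); rewrite hk.
  move=> j js; case kj: (k j) => [i|]; last exact: a0.
  rewrite -(hkj _ _ kj); apply: (Bi _ _ us' Ba' sE).
  by rewrite mem_pmap -kj map_f.
Qed.

(** * Subquotients of modules *)

Section Subquotient.
Variables (R : pzRingType) (M : lmodType R).

Definition submodule (N : set M) : Prop :=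
  [/\ N 0, forall x y, N x -> N y -> N (x + y) & forall a x, N x -> N (a *: x)].

Lemma submodN N x : submodule N -> N x -> N (- x).
Proof. by case=> _ _ h Nx; rewrite -scaleN1r; apply: h. Qed.

Lemma submodB N x y : submodule N -> N x -> N y -> N (x - y).
Proof. by move=> sN Nx Ny; have [_ h _] := sN; apply: h => //; exact: submodN. Qed.

Lemma submod_sum N (J : Type) (s : seq J) (f : J -> M) : submodule N ->
  (forall j, N (f j)) -> N (\sum_(j <- s) f j).
Proof. by case=> N0 ND _ h; elim/big_ind: _. Qed.

Record subquotient_data := SubquotientData {
  sqP : set M;
  sqZ : set M;
  sqP_sub : submodule sqP;
  sqZ_sub : submodule sqZ;
  sqZP : sqZ `<=` sqP
}.

Variable D : subquotient_data.
Local Notation P := (sqP D).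
Local Notation Z := (sqZ D).

(** A canonical representative of each coset of [sqZ]; the subquotient is
    carried by the canonical representatives that lie in [sqP]. *)
Definition sq_repr (x : M) : M := xget 0 [set y | Z (x - y)].

Lemma sq_reprP x : Z (x - sq_repr x).
Proof.
have [Z0 _ _] := sqZ_sub D.
by rewrite /sq_repr; case: xgetP => [y _ //|/(_ x)]; rewrite /= subrr.
Qed.

Lemma sq_repr_eq x y : Z (x - y) -> sq_repr x = sq_repr y.
Proof.
move=> Zxy; have [_ ZD _] := sqZ_sub D; congr xget; apply/seteqP; split=> z /= h.
  have -> : y - z = (x - z) - (x - y) by rewrite opprB [RHS]addrC addrA subrK.
  by apply: submodB => //; exact: sqZ_sub.
have -> : x - z = (x - y) + (y - z) by rewrite addrA subrK.
exact: ZD.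
Qed.

Lemma sqP_repr x : P x -> P (sq_repr x).
Proof.
move=> Px; have -> : sq_repr x = x - (x - sq_repr x) by rewrite opprB [RHS]addrC subrK.
by apply: submodB (sqP_sub D) Px _; apply: sqZP; exact: sq_reprP.
Qed.

Definition subquotient : Type := {x : M | `[< P x /\ sq_repr x = x >]}.
HB.instance Definition _ := [Choice of subquotient by <:].

Lemma sq_class_subproof x :
  `[< P (sq_repr (if `[< P x >] then x else 0)) /\
      sq_repr (sq_repr (if `[< P x >] then x else 0)) =
      sq_repr (if `[< P x >] then x else 0) >].
Proof.
apply/asboolP; split.
  by apply: sqP_repr; case: asboolP => // _; case: (sqP_sub D).
apply: sq_repr_eq; rewrite -opprB; apply: submodN (sqZ_sub D) _.
exact: sq_reprP.
Qed.

Definition sq_class x : subquotient :=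
  exist (fun y => `[< P y /\ sq_repr y = y >]) _ (sq_class_subproof x).
Definition sq_val (q : subquotient) : M := sval q.

Lemma sq_valP q : P (sq_val q).
Proof. by case: q => x /= /asboolP[]. Qed.

Lemma sq_valK q : sq_class (sq_val q) = q.
Proof.
case: q => x Px; apply/val_inj => /=; have /asboolP[Px' e] := Px.
by case: asboolP.
Qed.

Lemma sq_class_eq x y : P x -> P y -> (sq_class x = sq_class y <-> Z (x - y)).
Proof.
move=> Px Py; split=> [|h].
  move=> /(congr1 sval) /=; case: asboolP => // _; case: asboolP => // _ e.
  have [_ ZD _] := sqZ_sub D.
  have -> : x - y = (x - sq_repr x) - (y - sq_repr y).
    by rewrite e opprB addrA subrK.
  by apply: submodB (sqZ_sub D) _ _; exact: sq_reprP.
apply/val_inj => /=; case: asboolP => // _; case: asboolP => // _.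
exact: sq_repr_eq.
Qed.

Lemma sq_class_val x : P x -> Z (x - sq_val (sq_class x)).
Proof.
by move=> Px; apply/sq_class_eq => //; [exact: sq_valP | rewrite sq_valK].
Qed.

Definition sq_zero := sq_class 0.
Definition sq_add p q := sq_class (sq_val p + sq_val q).
Definition sq_opp p := sq_class (- sq_val p).
Definition sq_scale a p := sq_class (a *: sq_val p).

Let PD x y : P x -> P y -> P (x + y). Proof. by case: (sqP_sub D) => _ h _; exact: h. Qed.
Let PZ a x : P x -> P (a *: x). Proof. by case: (sqP_sub D) => _ _ h; exact: h. Qed.
Let PN x : P x -> P (- x). Proof. exact: submodN (sqP_sub D). Qed.
Let ZD x y : Z x -> Z y -> Z (x + y). Proof. by case: (sqZ_sub D) => _ h _; exact: h. Qed.
Let ZZ a x : Z x -> Z (a *: x). Proof. by case: (sqZ_sub D) => _ _ h; exact: h. Qed.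
Let ZN x : Z x -> Z (- x). Proof. exact: submodN (sqZ_sub D). Qed.

Lemma sq_addE x y : P x -> P y -> sq_add (sq_class x) (sq_class y) = sq_class (x + y).
Proof.
move=> Px Py; apply/sq_class_eq; [by apply: PD; exact: sq_valP | exact: PD |].
rewrite opprD addrACA -opprB -[sq_val (sq_class y) - y]opprB -opprD.
by apply: ZN; apply: ZD; exact: sq_class_val.
Qed.

Lemma sq_oppE x : P x -> sq_opp (sq_class x) = sq_class (- x).
Proof.
move=> Px; apply/sq_class_eq; [by apply: PN; exact: sq_valP | exact: PN |].
by rewrite opprK addrC; exact: sq_class_val.
Qed.

Lemma sq_scaleE a x : P x -> sq_scale a (sq_class x) = sq_class (a *: x).
Proof.
move=> Px; apply/sq_class_eq; [by apply: PZ; exact: sq_valP | exact: PZ |].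
by rewrite -scalerBr; apply: ZZ; rewrite -opprB; apply: ZN; exact: sq_class_val.
Qed.

Lemma sq_elim (Q : subquotient -> Prop) :
  (forall x, P x -> Q (sq_class x)) -> forall q, Q q.
Proof. by move=> h q; rewrite -[q]sq_valK; apply: h; exact: sq_valP. Qed.

Lemma sq_addA : associative sq_add.
Proof.
elim/sq_elim => x Px; elim/sq_elim => y Py; elim/sq_elim => z Pz.
by rewrite !sq_addE ?addrA //; apply: PD.
Qed.

Lemma sq_addC : commutative sq_add.
Proof. by move=> p q; rewrite /sq_add addrC. Qed.

Let P0 : P 0. Proof. by case: (sqP_sub D). Qed.

Lemma sq_add0 : left_id sq_zero sq_add.
Proof. by elim/sq_elim => x Px; rewrite sq_addE // add0r. Qed.

Lemma sq_addN : left_inverse sq_zero sq_opp sq_add.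
Proof. by elim/sq_elim => x Px; rewrite sq_oppE // sq_addE ?addNr //; exact: PN. Qed.

HB.instance Definition _ := GRing.isZmodule.Build subquotient
  sq_addA sq_addC sq_add0 sq_addN.

Lemma sq_scaleA a b p : sq_scale a (sq_scale b p) = sq_scale (a * b) p.
Proof.
by elim/sq_elim: p => x Px; rewrite !sq_scaleE ?scalerA //; exact: PZ.
Qed.

Lemma sq_scale1 : left_id 1 sq_scale.
Proof. by elim/sq_elim => x Px; rewrite sq_scaleE // scale1r. Qed.

Lemma sq_scaleDr : right_distributive sq_scale +%R.
Proof.
move=> a; elim/sq_elim => x Px; elim/sq_elim => y Py.
by rewrite [_ + _]sq_addE // !sq_scaleE ?[RHS]sq_addE ?scalerDr //; auto.
Qed.

Lemma sq_scaleDl p : {morph sq_scale^~ p : a b / a + b}.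
Proof.
elim/sq_elim: p => x Px a b.
by rewrite !sq_scaleE // [RHS]sq_addE ?scalerDl //; exact: PZ.
Qed.

HB.instance Definition _ := GRing.Zmodule_isLmodule.Build R subquotient
  sq_scaleA sq_scale1 sq_scaleDr sq_scaleDl.

End Subquotient.

Lemma subquotient_ex (R : pzRingType) (M : lmodType R) (P Z : set M) :
  submodule P -> submodule Z -> Z `<=` P ->
  exists (Q : lmodType R) (cl : M -> Q),
  [/\ forall x y, P x -> P y -> cl (x + y) = cl x + cl y,
      forall a x, P x -> cl (a *: x) = a *: cl x,
      forall x, P x -> (cl x = 0 <-> Z x)
    & forall q, exists2 x, P x & cl x = q].
Proof.
move=> sP sZ ZP; pose D := SubquotientData sP sZ ZP.
exists (subquotient D : lmodType R), (@sq_class _ _ D); split.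
- by move=> x y Px Py; rewrite [RHS](@sq_addE _ _ D).
- by move=> a x Px; rewrite [RHS](@sq_scaleE _ _ D).
- by move=> x Px; rewrite [0](_ : _ = sq_class D 0) // sq_class_eq ?subr0 //; case: (sP).
- by move=> q; exists (sq_val q); [exact: (@sq_valP _ _ D) | exact: sq_valK].
Qed.

(** * Graded modules *)

Record grading := Grading {
  gR : comPzRingType;
  gG : zmodType;
  rc : gG -> set gR;
  rc_sum : internal_direct_sum rc;
  rc_one : rc 0 1;
  rc_mul : forall d e a b, rc d a -> rc e b -> rc (d + e) (a * b)
}.

Record gmod (g : grading) := GMod {
  gcar :> lmodType (gR g);
  gcmp : gG g -> set gcar;
  gsum : internal_direct_sum gcmp;
  gscal : forall e d a x, rc e a -> gcmp d x -> gcmp (e + d) (a *: x)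
}.

Notation "''pr_' d" := (gpr (gsum _) d)
  (at level 8, d at level 2, format "''pr_' d") : ring_scope.

Section GradedModules.
Variable g : grading.
Local Notation R := (gR g).
Local Notation G := (gG g).
Local Notation rc := (@rc g).

Local Notation gmod := (gmod g).

Lemma gcmp0 (M : gmod) d : gcmp d (0 : M).
Proof. exact: (ids0 (gsum M) d). Qed.

Lemma gcmpB (M : gmod) d (x y : M) : gcmp d x -> gcmp d y -> gcmp d (x - y).
Proof. exact: (idsB (gsum M)). Qed.

Lemma gcmpD (M : gmod) d (x y : M) : gcmp d x -> gcmp d y -> gcmp d (x + y).
Proof. exact: (idsD (gsum M)). Qed.

Lemma prZ (M : gmod) e a d (x : M) : rc e a -> 'pr_(e + d) (a *: x) = a *: 'pr_d x.
Proof.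
move=> ea; apply: (@gpr_morph _ _ _ _ _ _ _ _ (fun x : M => a *: x) (fun d => e + d)).
- exact: scaler0.
- by move=> *; rewrite scalerDr.
- exact: addrI.
- by move=> d' y; apply: gscal.
Qed.

Definition hom_elt (a : R) : Prop := exists e, rc e a.

Definition homsub (M : gmod) (N : set M) : Prop :=
  submodule N /\ forall d x, N x -> N ('pr_d x).

Definition deg0 (M N : gmod) (f : M -> N) : Prop :=
  forall d x, gcmp d x -> gcmp d (f x).

Lemma pr_deg0 (M N : gmod) (f : {linear M -> N}) : deg0 f ->
  forall d x, 'pr_d (f x) = f ('pr_d x).
Proof.
move=> hf; apply: (@gpr_morph _ _ _ _ _ _ _ _ f id) => //; first exact: linear0.
by move=> x y; rewrite linearD.
Qed.

Lemma lin_ex (R' : pzRingType) (M N : lmodType R') (f : M -> N) :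
  (forall x y, f (x + y) = f x + f y) -> (forall a x, f (a *: x) = a *: f x) ->
  exists h : {linear M -> N}, h =1 f.
Proof.
move=> fD fZ.
have lf : linear f by move=> a x y; rewrite fD fZ.
pose h : {linear M -> N} := HB.pack f (GRing.isLinear.Build _ _ _ _ f lf).
by exists h.
Qed.

Lemma lin_comp_ex (R' : pzRingType) (M N L : lmodType R') (h : {linear N -> L})
    (f : {linear M -> N}) : exists k : {linear M -> L}, k =1 h \o f.
Proof. by apply: lin_ex => [x y|a x] /=; rewrite ?linearD ?linearZ. Qed.

Section GradedSubquotient.
Variables (M : lmodType R) (C : G -> set M) (Z : set M).
Hypothesis C0 : forall d, C d 0.
Hypothesis CB : forall d x y, C d x -> C d y -> C d (x - y).
Hypothesis CZ : forall e d a x, rc e a -> C d x -> C (e + d) (a *: x).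
Hypothesis Zsub : submodule Z.
Hypothesis indep : forall s a, uniq s -> (forall d, C d (a d)) ->
  Z (\sum_(d <- s) a d) -> forall d, d \in s -> Z (a d).

Let CN d x : C d x -> C d (- x).
Proof. by move=> h; rewrite -sub0r; apply: CB. Qed.

Let CD d x y : C d x -> C d y -> C d (x + y).
Proof. by move=> hx hy; rewrite -[y]opprK; apply: CB => //; exact: CN. Qed.

(** One term in each degree, with [f] total and zero off the list, so that two
    such sums add up termwise. *)
Definition gspan : set M := [set x | exists f : G -> M, (forall d, C d (f d)) /\
  exists s, [/\ uniq s, forall d, d \notin s -> f d = 0 & x = \sum_(d <- s) f d]].

Lemma gspan_homog d x : C d x -> gspan x.
Proof.
move=> Cx; exists (fun e => if e == d then x else 0); split.
  by move=> e; case: eqP => [->|_].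
exists [:: d]; split=> //; last by rewrite big_seq1 eqxx.
by move=> e; rewrite inE => /negbTE ->.
Qed.

Lemma gspanD x y : gspan x -> gspan y -> gspan (x + y).
Proof.
case=> f [Cf [s [us f0 ->]]] [h [Ch [t [ut h0 ->]]]].
exists (fun d => f d + h d); split; first by move=> d; exact: CD.
have [u [uu su tu nu]] := seq_cover s t; exists u; split=> //.
  by move=> j /nu[/f0-> /h0->]; rewrite addr0.
by rewrite big_split /= (@sum_widen _ _ s u) // (@sum_widen _ _ t u).
Qed.

Lemma gspan_sub : submodule gspan.
Proof.
split; first exact: (gspan_homog (C0 0)).
  exact: gspanD.
apply: (gpr_ind (rc_sum g)).
- by move=> x _; rewrite scale0r; exact: (gspan_homog (C0 0)).
- by move=> a b ha hb x Px; rewrite scalerDl; apply: gspanD; auto.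
- move=> e a ea x [f [Cf [s [_ _ ->]]]]; rewrite scaler_sumr.
  elim/big_ind: _ => [||d _]; [exact: (gspan_homog (C0 0))|exact: gspanD|].
  by apply: (@gspan_homog (e + d)); apply: CZ.
Qed.

(** The one constructor of graded modules behind submodules, quotients,
    products, direct sums, envelopes and tensor products: the span of
    homogeneous pieces [C d] modulo relations [Z]. The class map [cl] is only
    meaningful on the span. *)
Lemma graded_subquotient_ex : exists (Q : gmod) (cl : M -> Q),
  [/\ forall x y, gspan x -> gspan y -> cl (x + y) = cl x + cl y,
      forall a x, gspan x -> cl (a *: x) = a *: cl x,
      forall x, gspan x -> (cl x = 0 <-> Z x),
      forall q, exists2 x, gspan x & cl x = q
    & forall d q, gcmp d q <-> exists2 x, C d x & cl x = q].
Proof.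
have [_ PD PZ] := gspan_sub.
have [Z0 ZD ZZ] := Zsub.
have [|//||Q [cl [clD clZ cl0 clS]]] := @subquotient_ex _ M gspan (gspan `&` Z).
- exact: gspan_sub.
- split; first by split => //; exact: (gspan_homog (C0 0)).
    by move=> x y [? ?] [? ?]; split; auto.
  by move=> a x [? ?]; split; auto.
- by move=> x [].
have cl00 : cl 0 = 0 by apply/cl0; [|split=> //]; exact: (gspan_homog (C0 0)).
have clN x : gspan x -> cl (- x) = - cl x.
  by move=> Px; rewrite -[in LHS]scaleN1r clZ // scaleN1r.
have clsum (s : seq G) (f : G -> M) : (forall d, C d (f d)) ->
    cl (\sum_(d <- s) f d) = \sum_(d <- s) cl (f d).
  move=> Cf; elim: s => [|d s IH]; first by rewrite !big_nil.
  rewrite !big_cons clD ?IH //; first exact: (gspan_homog (Cf d)).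
  by apply: submod_sum gspan_sub _ => j; exact: (gspan_homog (Cf j)).
pose B (d : G) : set Q := [set q | exists2 x, C d x & cl x = q].
have dsB : internal_direct_sum B.
  split.
  - move=> d; split; first by exists 0.
    move=> _ _ [x Cx <-] [y Cy <-]; exists (x - y); first exact: CB.
    by rewrite clD ?clN //; apply: (@gspan_homog d) => //; exact: CN.
  - move=> q; have [x [f [Cf [s [us _ ->]]]] <-] := clS q.
    exists s, (fun d => cl (f d)); split=> //; last exact: clsum.
    by move=> d; exists (f d).
  - move=> s b us Bb; have /choice[f hf] d : exists x, C d x /\ cl x = b d.
      by have [x ? ?] := Bb d; exists x.
    have Cf d : C d (f d) by case: (hf d).
    have -> : \sum_(d <- s) b d = cl (\sum_(d <- s) f d).
      by rewrite clsum //; apply: eq_bigr => d _; case: (hf d).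
    move=> /cl0[]; first by apply: submod_sum gspan_sub _ => j; exact: (gspan_homog (Cf j)).
    move=> _ Zs d ds; have [_ <-] := hf d; apply/cl0; first exact: (gspan_homog (Cf d)).
    by split; [exact: (gspan_homog (Cf d)) | exact: (indep us Cf Zs)].
have scB e d a q : rc e a -> B d q -> B (e + d) (a *: q).
  move=> ea [x Cx <-]; exists (a *: x); first exact: CZ.
  by rewrite clZ //; exact: (gspan_homog Cx).
exists (GMod dsB scB), cl; split=> //.
by move=> x Px; split=> [/cl0[]//|Zx]; apply/cl0.
Qed.

End GradedSubquotient.

Lemma gpr_gspan (M : gmod) (x : M) : gspan (@gcmp g M) x.
Proof.
exists (fun d => 'pr_d x); split; first by move=> d; exact: gprP.
exact: gpr_supp.
Qed.

Lemma homsub_pr_sum (M : gmod) (N : set M) s a d : homsub N -> uniq s ->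
  (forall d, gcmp d (a d)) -> N (\sum_(d <- s) a d) -> d \in s -> N (a d).
Proof.
move=> [sN hN] us Ca Ns ds; suff <- : 'pr_d (\sum_(d <- s) a d) = a d by exact: hN.
rewrite gpr_sum (bigD1_seq d) //= gpr_id // big1 ?addr0 // => e ed.
by rewrite (gpr_neq _ (Ca e)) // eq_sym.
Qed.

Lemma gquo_ex (M : gmod) (N : set M) : homsub N ->
  exists (Q : gmod) (p : {linear M -> Q}),
    [/\ deg0 p, forall x, p x = 0 <-> N x & forall q, exists x, p x = q].
Proof.
move=> hN; have [sN _] := hN.
have [||||s a us Ca Ns d ds|Q [cl [clD clZ cl0 clS clC]]] :=
    @graded_subquotient_ex M (@gcmp g M) N.
- exact: gcmp0.
- exact: gcmpB.
- exact: gscal.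
- by [].
- exact: (homsub_pr_sum hN us Ca Ns).
have [p pE] := lin_ex (fun x y => clD _ _ (gpr_gspan x) (gpr_gspan y))
  (fun a x => clZ a _ (gpr_gspan x)).
exists Q, p; split.
- by move=> d x Cx; rewrite pE; apply/clC; exists x.
- by move=> x; rewrite pE; apply: cl0; exact: gpr_gspan.
- by move=> q; have [x _ <-] := clS q; exists x; rewrite pE.
Qed.

(** Without relations the class map can be inverted; submodules, products and
    direct sums arise in this way. *)
Lemma graded_span_ex (M : lmodType R) (C : G -> set M) :
  (forall d, C d 0) -> (forall d x y, C d x -> C d y -> C d (x - y)) ->
  (forall e d a x, rc e a -> C d x -> C (e + d) (a *: x)) ->
  (forall s a, uniq s -> (forall d, C d (a d)) -> \sum_(d <- s) a d = 0 ->
    forall d, d \in s -> a d = 0) ->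
  exists (K : gmod) (i : {linear K -> M}),
    [/\ injective i, range i = gspan C & forall d x, gcmp d x <-> C d (i x)].
Proof.
move=> C0 CB CZ indep.
have [_ ND NZ] := gspan_sub C0 CB CZ.
have [|s a us Ca Ns d ds|K [cl [clD clZ cl0 clS clC]]] :=
    @graded_subquotient_ex M C [set 0] C0 CB CZ.
- split=> //= [x y -> ->|a x ->]; by rewrite ?addr0 ?scaler0.
- exact: (indep s a).
have /choice[i hi] q : exists x, gspan C x /\ cl x = q.
  by have [x Nx e] := clS q; exists x.
have Ni q : gspan C (i q) by case: (hi q).
have cli q : cl (i q) = q by case: (hi q).
have sN := gspan_sub C0 CB CZ.
have clinj x y : gspan C x -> gspan C y -> cl x = cl y -> x = y.
  move=> Nx Ny e; apply/eqP; rewrite -subr_eq0; apply/eqP.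
  apply/(cl0 (x - y)); first exact: submodB.
  have Nny : gspan C (- y) by apply: submodN.
  by rewrite clD // -[- y]scaleN1r clZ // scaleN1r e subrr.
have icl x : gspan C x -> i (cl x) = x by move=> Nx; apply: clinj.
have [h hE] : exists h : {linear K -> M}, h =1 i.
  apply: lin_ex.
    move=> p q; apply: clinj => //; first exact: ND.
    by rewrite clD ?cli.
  move=> a q; apply: clinj => //; first exact: NZ.
  by rewrite clZ ?cli.
exists K, h; split.
- by move=> p q; rewrite !hE => e; rewrite -[p]cli -[q]cli e.
- apply/seteqP; split=> [_ [q _ <-]|x Nx]; first by rewrite hE.
  by exists (cl x) => //; rewrite hE icl.
- move=> d x; rewrite hE clC; split=> [[y Cy <-]|Cx].
    by rewrite icl //; exact: gspan_homog Cy.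
  by exists (i x).
Qed.

Lemma gsub_ex (M : gmod) (N : set M) : homsub N ->
  exists (K : gmod) (i : {linear K -> M}),
    [/\ deg0 i, injective i & range i = N].
Proof.
move=> hN; have [sN hNpr] := hN; have [N0 ND NZ] := sN.
have [||||K [i [ii ri iC]]] := @graded_span_ex M (fun d => N `&` gcmp d).
- by move=> d; split=> //; exact: gcmp0.
- move=> d x y [? ?] [? ?]; split; first exact: submodB.
  exact: gcmpB.
- by move=> e d a x ea [? ?]; split; [exact: NZ | exact: gscal].
- move=> s a us Ca s0 d ds; case: (gsum M) => _ _ h; apply: (h s a) => //.
  by move=> e; case: (Ca e).
exists K, i; split=> //; first by move=> d x /iC[].
rewrite ri; apply/seteqP; split=> [x [f [Cf [s [_ _ ->]]]]|x Nx].
  by apply: submod_sum => // j; case: (Cf j).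
exists (fun d => 'pr_d x); split; last exact: gpr_supp.
by move=> d; split; [exact: hNpr | exact: gprP].
Qed.

Lemma inj_reflect_deg (M N : gmod) (i : {linear M -> N}) d x :
  deg0 i -> injective i -> gcmp d (i x) -> gcmp d x.
Proof.
move=> di ii Cix; apply: (@gpr_homog _ _ _ (gsum M)) => e ed; apply: ii.
by rewrite -(pr_deg0 di) linear0 (gpr_neq (gsum N) Cix).
Qed.

End GradedModules.

(** * Gabriel filters and closed modules *)

Section GabrielFilters.
Variable g : grading.
Local Notation R := (gR g).
Local Notation G := (gG g).
Local Notation rc := (@rc g).
Local Notation gmod := (gmod g).

Definition hideal (I : set R) : Prop :=
  ideal I /\ forall d x, I x -> I (gpr (rc_sum g) d x).

(** As I is contained in (I : a) over a commutative ring, colon ideals only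
    enter through locality. Membership of an ideal does not depend on degrees,
    so the torsion theory is shift invariant. *)
Record gabriel (F : set (set R)) : Prop := Gabriel {
  gab_ideal : forall I, F I -> hideal I;
  gab_full : F setT;
  gab_up : forall I J, F I -> hideal J -> I `<=` J -> F J;
  gab_local : forall I J, F I -> hideal J ->
    (forall e a, rc e a -> I a -> F [set b | J (b * a)]) -> F J
}.

Lemma hideal_ind I (Q : R -> Prop) : hideal I -> Q 0 ->
  (forall x y, Q x -> Q y -> Q (x + y)) ->
  (forall e a, rc e a -> I a -> Q a) -> forall a, I a -> Q a.
Proof.
move=> [_ hI] Q0 QD Qh a Ia; apply: (gpr_ind_in (dsB := rc_sum g)) => // e.
by apply: (Qh e); [exact: (gprP (rc_sum g)) | exact: hI].
Qed.

Lemma hideal_full : hideal setT.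
Proof. by split. Qed.

Lemma hideal_cap I J : hideal I -> hideal J -> hideal (I `&` J).
Proof.
move=> [[I0 ID IM] hI] [[J0 JD JM] hJ]; split; last by move=> d x [? ?]; split; auto.
by split=> // [x y [? ?] [? ?]|a x [? ?]]; split; auto.
Qed.

Lemma pr_mul e a d x : rc e a ->
  gpr (rc_sum g) (d + e) (x * a) = gpr (rc_sum g) d x * a.
Proof.
move=> ea; apply: (@gpr_morph _ _ _ _ _ _ _ _ (fun x : R => x * a) (fun d => d + e)).
- exact: mul0r.
- by move=> *; rewrite mulrDl.
- exact: addIr.
- by move=> i y yi; exact: rc_mul.
Qed.

Lemma hideal_colon J e a : hideal J -> rc e a -> hideal [set b | J (b * a)].
Proof.
move=> [[J0 JD JM] hJ] ea; split; last first.
  by move=> d x /= Jx; rewrite -(pr_mul _ _ ea); exact: hJ.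
split=> /= [|x y Jx Jy|b x Jx]; first by rewrite mul0r.
  by rewrite mulrDl; exact: JD.
by rewrite -mulrA; exact: JM.
Qed.

(** (I `&` J : a) contains J for a in I, so this is an instance of
    locality. *)
Lemma gab_cap F I J : gabriel F -> F I -> F J -> F (I `&` J).
Proof.
move=> gF FI FJ; apply: (gab_local gF FI).
  by apply: hideal_cap; apply: gab_ideal gF _ _.
move=> e a ea Ia; apply: (gab_up gF FJ).
  by apply: hideal_colon ea; apply: hideal_cap; apply: gab_ideal gF _ _.
have [[_ _ IM] _] := gab_ideal gF FI; have [[_ _ JM] _] := gab_ideal gF FJ.
by move=> b Jb; split; [exact: IM | rewrite mulrC; exact: JM].
Qed.

Definition annihilator (M : gmod) (x : M) : set R := [set a | a *: x = 0].

Lemma pr_scale (M : gmod) a e d (x : M) : gcmp d x ->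
  'pr_(e + d) (a *: x) = gpr (rc_sum g) e a *: x.
Proof.
move=> dx; apply: (@gpr_morph _ _ _ _ _ _ _ _ (fun a : R => a *: x) (fun e => e + d)).
- exact: scale0r.
- by move=> *; rewrite scalerDl.
- exact: addIr.
- by move=> i y yi; exact: gscal.
Qed.

Lemma hideal_transporter (M : gmod) (N : set M) d x : homsub N -> gcmp d x ->
  hideal [set a | N (a *: x)].
Proof.
move=> [[N0 ND NZ] hN] dx; split; last first.
  by move=> e a /= Na; rewrite -(pr_scale _ _ dx); exact: hN.
split=> /= [|a b Na Nb|a b Nb]; first by rewrite scale0r.
  by rewrite scalerDl; exact: ND.
by rewrite -scalerA; exact: NZ.
Qed.

Lemma homsub0 (M : gmod) : homsub [set (0 : M)].
Proof.
split; last by move=> d x /= ->; rewrite gpr0.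
by split=> //= [x y -> ->|a x ->]; rewrite ?addr0 ?scaler0.
Qed.

Lemma homsub_pr_in (M : gmod) (N : set M) x : homsub N -> (forall d, N ('pr_d x)) -> N x.
Proof. by move=> [[N0 ND _] _]; apply: (gpr_ind_in (dsB := gsum M)). Qed.

Lemma hideal_annihilator (M : gmod) d (x : M) : gcmp d x -> hideal (annihilator x).
Proof. exact: hideal_transporter (homsub0 M). Qed.

(** Preimage in M of the F-torsion of M / N. *)
Definition sat (F : set (set R)) (M : gmod) (N : set M) : set M :=
  [set x | exists2 I, F I & forall a, I a -> N (a *: x)].

Notation tors F := (sat F [set 0]).

Section Saturation.
Variables (F : set (set R)) (gF : gabriel F) (M : gmod).
Implicit Type N : set M.

Lemma sat_homsub N : homsub N -> homsub (sat F N).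
Proof.
move=> hN; have [[N0 ND NZ] hpr] := hN; split; last first.
  move=> d x [I FI Ix]; exists I => //.
  apply: (hideal_ind (gab_ideal gF FI)); rewrite ?scale0r //.
    by move=> a b; rewrite scalerDl; exact: ND.
  by move=> e a ea Ia; rewrite -(prZ d x ea); apply/hpr/Ix.
split.
- by exists setT; [exact: gab_full | move=> a _; rewrite scaler0].
- move=> x y [I FI Ix] [J FJ Jy]; exists (I `&` J); first exact: gab_cap.
  by move=> a [Ia Ja]; rewrite scalerDr; apply: ND; auto.
- move=> a x [I FI Ix]; exists I => // b Ib.
  by rewrite scalerA mulrC -scalerA; apply/NZ/Ix.
Qed.

Lemma sat_in N : homsub N -> N `<=` sat F N.
Proof.
by move=> [[_ _ NZ] _] x Nx; exists setT; [exact: gab_full | move=> a _; exact: NZ].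
Qed.

(** After reduction to homogeneous x, the ideal of the a with a x in N is
    homogeneous and locality applies to it. *)
Lemma sat_sat N : homsub N -> sat F (sat F N) `<=` sat F N.
Proof.
move=> hN x sx; apply: homsub_pr_in; first exact: sat_homsub.
move=> d.
have [I FI Ix] : sat F (sat F N) ('pr_d x).
  by have [_] := sat_homsub (sat_homsub hN); apply.
have dx := gprP (gsum M) d x.
exists [set a | N (a *: 'pr_d x)] => //; apply: (gab_local gF FI).
  exact: hideal_transporter dx.
move=> e a ea Ia; have [J FJ Jax] := Ix a Ia; apply: (gab_up gF FJ).
  by apply: (hideal_colon _ ea); exact: hideal_transporter dx.
by move=> b Jb /=; rewrite -scalerA; exact: Jax.
Qed.

Lemma sat_mono F' N N' : F `<=` F' -> N `<=` N' -> sat F N `<=` sat F' N'.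
Proof. by move=> sF sN x [I /sF FI Ix]; exists I => // a /Ix/sN. Qed.

Lemma tors_homsub : homsub (tors F : set M).
Proof. exact: sat_homsub (homsub0 M). Qed.

End Saturation.

Section Morphisms.
Variables (M N : gmod) (f : {linear M -> N}).
Hypothesis df : deg0 f.

Lemma range_homsub : homsub (range f).
Proof.
split; last first.
  by move=> d _ [x _ <-]; exists ('pr_d x) => //; rewrite pr_deg0.
split; first by exists 0 => //; rewrite linear0.
  by move=> _ _ [x _ <-] [y _ <-]; exists (x + y) => //; rewrite linearD.
by move=> a _ [x _ <-]; exists (a *: x) => //; rewrite linearZ.
Qed.

Lemma preim_homsub (L : set N) : homsub L -> homsub (f @^-1` L).
Proof.
move=> [[L0 LD LZ] hL]; split; last by move=> d x /= Lx; rewrite -pr_deg0 //; exact: hL.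
split=> /= [|x y Lx Ly|a x Lx]; first by rewrite linear0.
  by rewrite linearD; exact: LD.
by rewrite linearZ; exact: LZ.
Qed.

Lemma sat_preim F (L : set N) x : sat F L (f x) <-> sat F (f @^-1` L) x.
Proof.
split=> -[I FI h]; exists I => // a Ia; have := h a Ia.
  by rewrite -linearZ.
by rewrite /= linearZ.
Qed.

Lemma ker_homsub : homsub [set x | f x = 0].
Proof. exact: (preim_homsub (homsub0 N)). Qed.

End Morphisms.

Definition torsfree (F : set (set R)) (M : gmod) : Prop :=
  forall x : M, tors F x -> x = 0.

Definition glinear (W : gmod) (I : set R) (d : G) (phi : R -> W) : Prop :=
  [/\ forall a b, I a -> I b -> phi (a + b) = phi a + phi b,
      forall r a, I a -> phi (r * a) = r *: phi a
    & forall e a, I a -> rc e a -> gcmp (e + d) (phi a)].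

(** The elementwise form of Hom(T, W) = 0 = Ext(T, W) for all torsion T; see
    [closed_objectE]. *)
Definition gclosed (F : set (set R)) (W : gmod) : Prop :=
  torsfree F W /\ forall I d phi, F I -> @glinear W I d phi ->
    exists2 y, gcmp d y & forall a, I a -> phi a = a *: y.

Lemma torsfree_hom F (M : gmod) : gabriel F ->
  (forall d x, gcmp d x -> tors F x -> x = 0 :> M) -> torsfree F M.
Proof.
move=> gF h x tx; apply: (gpr_eq0 (dsB := gsum M)) => d; apply: (h d).
  exact: (gprP (gsum M)).
by case: (tors_homsub gF M) => _; apply.
Qed.

Lemma torsfree_sub F F' (M : gmod) : F' `<=` F -> torsfree F M -> torsfree F' M.
Proof. by move=> sF h x tx; apply: h; apply: sat_mono tx. Qed.

Lemma gclosed_sub F F' (M : gmod) : F' `<=` F -> gclosed F M -> gclosed F' M.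
Proof.
by move=> sF [h1 h2]; split; [exact: torsfree_sub h1 | move=> I d phi /sF; exact: h2].
Qed.

Lemma tors_eq F (M : gmod) (x y : M) I : torsfree F M -> F I ->
  (forall a, I a -> a *: x = a *: y) -> x = y.
Proof.
move=> tM FI h; apply/eqP; rewrite -subr_eq0; apply/eqP/tM; exists I => // a Ia /=.
by rewrite scalerBr h // subrr.
Qed.

(** The universal property of closed modules: a partial map with dense domain
    extends. Partial maps are graded relations, which covers maps given on a
    submodule, on the image of another module, or on the multiples of one
    element. *)
Lemma closed_extend F (Z W : gmod) (Gam : Z -> W -> Prop) :
  gabriel F -> gclosed F W ->
  (forall z w z' w', Gam z w -> Gam z' w' -> Gam (z + z') (w + w')) ->
  (forall a z w, Gam z w -> Gam (a *: z) (a *: w)) ->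
  (forall d z w, Gam z w -> Gam ('pr_d z) ('pr_d w)) ->
  (forall w, Gam 0 w -> w = 0) ->
  (forall z, exists2 I, F I & forall a, I a -> exists w, Gam (a *: z) w) ->
  exists h : {linear Z -> W}, deg0 h /\ forall z w, Gam z w -> h z = w.
Proof.
move=> gF [tW cW] GD GZ Gpr G0 dense.
have Gfun z w w' : Gam z w -> Gam z w' -> w = w'.
  move=> h1 h2; apply/eqP; rewrite -subr_eq0; apply/eqP/G0.
  by rewrite -(subrr z) -[- z]scaleN1r -[- w']scaleN1r; apply: GD => //; exact: GZ.
pose G' z w := exists2 I, F I & forall a, I a -> Gam (a *: z) (a *: w).
have G'fun z w w' : G' z w -> G' z w' -> w = w'.
  move=> [I FI Iz] [J FJ Jz]; apply: (tors_eq tW (gab_cap gF FI FJ)).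
  by move=> a [Ia Ja]; apply: Gfun; [exact: Iz | exact: Jz].
have G'D z w z' w' : G' z w -> G' z' w' -> G' (z + z') (w + w').
  move=> [I FI Iz] [J FJ Jz]; exists (I `&` J); first exact: gab_cap.
  by move=> a [Ia Ja]; rewrite !scalerDr; apply: GD; auto.
have G'Z a z w : G' z w -> G' (a *: z) (a *: w).
  move=> [I FI Iz]; exists I => // b Ib.
  by rewrite !scalerA ![b * a]mulrC -!scalerA; apply/GZ/Iz.
have GG' z w : Gam z w -> G' z w.
  by move=> h; exists setT; [exact: gab_full | move=> a _; exact: GZ].
have hom d z : gcmp d z -> exists2 y, gcmp d y & G' z y.
  move=> dz; have [I FI Iz] := dense z.
  have /choice[phi hphi] a : exists w, I a -> Gam (a *: z) w.
    have [Ia|nIa] := pselect (I a); last by exists 0.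
    by have [w hw] := Iz a Ia; exists w.
  have [[I0 ID IM] _] := gab_ideal gF FI.
  have [|y dy yE] := cW I d phi FI.
    split.
    - move=> a b Ia Ib; apply: Gfun; first by apply: hphi; exact: ID.
      by rewrite scalerDl; apply: GD; exact: hphi.
    - move=> r a Ia; apply: Gfun; first by apply: hphi; exact: IM.
      by rewrite -scalerA; apply: GZ; exact: hphi.
    - move=> e a Ia ea; suff -> : phi a = 'pr_(e + d) (phi a) by exact: (gprP (gsum W)).
      apply: (Gfun (a *: z)); first exact: hphi.
      have {1}<- : 'pr_(e + d) (a *: z) = a *: z.
        by rewrite gpr_id //; exact: gscal.
      by apply: Gpr; exact: hphi.
  by exists y => //; exists I => // a Ia; rewrite -yE //; exact: hphi.
have tot z : exists w, G' z w.
  move: z; apply: (gpr_ind (gsum Z)).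
  - exists 0; exists setT; first exact: gab_full.
    move=> a _; rewrite !scaler0.
    have [I FI Iz] := dense 0; have [[I0 _ _] _] := gab_ideal gF FI.
    by have [w hw] := Iz 0 I0; have := GZ 0 _ _ hw; rewrite !scale0r.
  - by move=> x y [w hw] [w' hw']; exists (w + w'); exact: G'D.
  - by move=> d x dx; have [y _ hy] := hom d x dx; exists y.
have /choice[h hh] := tot.
have [k kE] : exists k : {linear Z -> W}, k =1 h.
  apply: lin_ex => [x y|a x]; apply: G'fun (hh _) _; first exact: G'D.
  exact: G'Z.
exists k; split.
  move=> d z dz; have [y dy hy] := hom d z dz; rewrite kE.
  by rewrite (G'fun _ _ _ (hh z) hy).
by move=> z w hw; rewrite kE; apply: G'fun (hh z) _; exact: GG'.
Qed.

(** The element that W provides lies in the saturation of K. *)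
Lemma closed_sub F (K W : gmod) (i : {linear K -> W}) : gabriel F ->
  deg0 i -> injective i -> sat F (range i) `<=` range i -> gclosed F W -> gclosed F K.
Proof.
move=> gF di ii si [tW cW]; split.
  move=> x [I FI Ix]; apply: ii; rewrite linear0; apply: tW; exists I => // a Ia.
  by rewrite /= -linearZ (Ix a Ia) linear0.
move=> I d phi FI [phiD phiZ phid].
have [|y dy yE] := cW I d (i \o phi) FI.
  split=> /= [a b Ia Ib|r a Ia|e a Ia ea].
  - by rewrite phiD // linearD.
  - by rewrite phiZ // linearZ.
  - by apply: di; exact: phid.
have [z _ zE] : range i y.
  by apply: si; exists I => // a Ia; exists (phi a) => //; exact: yE.
exists z; first by apply: (inj_reflect_deg di ii); rewrite zE.
by move=> a Ia; apply: ii; rewrite linearZ /= zE; exact: yE.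
Qed.

(** If I x lies in K, then a |-> a x on I is the multiplication by some y in
    K, and x - y is torsion. *)
Lemma closed_saturated F (K W : gmod) (i : {linear K -> W}) : gabriel F ->
  deg0 i -> injective i -> torsfree F W -> gclosed F K ->
  sat F (range i) `<=` range i.
Proof.
move=> gF di ii tW [tK cK] x sx; apply: homsub_pr_in; first exact: range_homsub.
move=> d; have [I FI Ix] : sat F (range i) ('pr_d x).
  by case: (sat_homsub gF (range_homsub di)) => _; apply.
have dx := gprP (gsum W) d x.
have /choice[phi hphi] a : exists w, I a -> i w = a *: 'pr_d x.
  have [Ia|nIa] := pselect (I a); last by exists 0.
  by have [w _ hw] := Ix a Ia; exists w.
have [[I0 ID IM] _] := gab_ideal gF FI.
have [|y dy yE] := cK I d phi FI.
  split.
  - move=> a b Ia Ib; apply: ii; rewrite linearD !hphi ?scalerDl //.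
    exact: ID.
  - move=> r a Ia; apply: ii; rewrite linearZ /= !hphi ?scalerA //.
    exact: IM.
  - move=> e a Ia ea; apply: (inj_reflect_deg di ii); rewrite hphi //.
    exact: gscal.
exists y => //; apply: (tors_eq tW FI) => a Ia.
by rewrite -linearZ -yE // hphi.
Qed.

End GabrielFilters.
Notation tors F := (sat F [set 0]).

(** * Products, direct sums and shifts *)

Lemma choice_dep (A : Type) (B : A -> Type) (P : forall x, B x -> Prop) :
  (forall x, exists y, P x y) -> exists f : forall x, B x, forall x, P x (f x).
Proof. by move=> h; exists (fun x => projT1 (cid (h x))) => x; case: cid. Qed.

Section DependentProduct.
Variables (A : Type) (R : pzRingType) (X : A -> lmodType R).

Definition dprod : Type := forall i, X i.
HB.instance Definition _ := gen_eqMixin dprod.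
HB.instance Definition _ := gen_choiceMixin dprod.

Lemma dprod_ext (x y : dprod) : (forall i, x i = y i) -> x = y.
Proof. exact: functional_extensionality_dep. Qed.

Definition dprod_zero : dprod := fun i => 0.
Definition dprod_add (x y : dprod) : dprod := fun i => x i + y i.
Definition dprod_opp (x : dprod) : dprod := fun i => - x i.
Definition dprod_scale (a : R) (x : dprod) : dprod := fun i => a *: x i.

Lemma dprod_addA : associative dprod_add.
Proof. by move=> x y z; apply: dprod_ext => i; apply: addrA. Qed.
Lemma dprod_addC : commutative dprod_add.
Proof. by move=> x y; apply: dprod_ext => i; apply: addrC. Qed.
Lemma dprod_add0 : left_id dprod_zero dprod_add.
Proof. by move=> x; apply: dprod_ext => i; apply: add0r. Qed.
Lemma dprod_addN : left_inverse dprod_zero dprod_opp dprod_add.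
Proof. by move=> x; apply: dprod_ext => i; apply: addNr. Qed.
HB.instance Definition _ := GRing.isZmodule.Build dprod
  dprod_addA dprod_addC dprod_add0 dprod_addN.

Lemma dprod_scaleA a b x : dprod_scale a (dprod_scale b x) = dprod_scale (a * b) x.
Proof. by apply: dprod_ext => i; apply: scalerA. Qed.
Lemma dprod_scale1 : left_id 1 dprod_scale.
Proof. by move=> x; apply: dprod_ext => i; apply: scale1r. Qed.
Lemma dprod_scaleDr : right_distributive dprod_scale +%R.
Proof. by move=> a x y; apply: dprod_ext => i; apply: scalerDr. Qed.
Lemma dprod_scaleDl x : {morph dprod_scale^~ x : a b / a + b}.
Proof. by move=> a b; apply: dprod_ext => i; apply: scalerDl. Qed.
HB.instance Definition _ := GRing.Zmodule_isLmodule.Build R dprod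
  dprod_scaleA dprod_scale1 dprod_scaleDr dprod_scaleDl.

Lemma dprodDE (x y : dprod) i : (x + y) i = x i + y i.
Proof. by []. Qed.

Lemma dprodZE a (x : dprod) i : (a *: x) i = a *: x i.
Proof. by []. Qed.

Lemma dprod_sumE (J : Type) (s : seq J) (f : J -> dprod) i :
  (\sum_(j <- s) f j) i = \sum_(j <- s) f j i.
Proof. by elim/big_rec2: _ => // j _ x _ <-. Qed.

End DependentProduct.

Definition dunit (A : eqType) (R : pzRingType) (X : A -> lmodType R) i (z : X i) :
  dprod X := dfwith (0 : dprod X) z.

Lemma dunit_in (A : eqType) (R : pzRingType) (X : A -> lmodType R) i (z : X i) :
  dunit z i = z.
Proof. exact: dfwith_in. Qed.

Lemma dunit_out (A : eqType) (R : pzRingType) (X : A -> lmodType R) i j (z : X i) :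
  i != j -> dunit z j = 0.
Proof. exact: dfwith_out. Qed.

Lemma dunitD (A : eqType) (R : pzRingType) (X : A -> lmodType R) i (x y : X i) :
  dunit (x + y) = dunit x + dunit y.
Proof.
apply: dprod_ext => l; rewrite dprodDE.
have [<-|il] := eqVneq i l; first by rewrite !dunit_in.
by rewrite !dunit_out // addr0.
Qed.

Lemma dunitZ (A : eqType) (R : pzRingType) (X : A -> lmodType R) i a (x : X i) :
  dunit (a *: x) = a *: dunit x.
Proof.
apply: dprod_ext => l; rewrite dprodZE.
have [<-|il] := eqVneq i l; first by rewrite !dunit_in.
by rewrite !dunit_out // scaler0.
Qed.

Lemma dunit0 (A : eqType) (R : pzRingType) (X : A -> lmodType R) i :
  dunit (0 : X i) = 0.
Proof. by rewrite -(scale0r (0 : X i)) dunitZ scale0r. Qed.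

Section FiniteSupport.
Variables (A : eqType) (R : pzRingType) (X : A -> lmodType R) (T : zmodType).
Local Notation D := (dprod X).

Definition finsupp (x : D) : Prop :=
  exists s : seq A, uniq s /\ forall i, i \notin s -> x i = 0.

Lemma finsupp0 : finsupp 0.
Proof. by exists [::]. Qed.

Lemma finsuppD x y : finsupp x -> finsupp y -> finsupp (x + y).
Proof.
move=> [s [_ x0]] [t [_ y0]]; have [u [uu _ _ nu]] := seq_cover s t.
by exists u; split=> // i /nu[/x0 xi /y0 yi]; rewrite dprodDE xi yi addr0.
Qed.

Lemma finsuppZ a x : finsupp x -> finsupp (a *: x).
Proof.
move=> [s [us x0]]; exists s; split=> // i /x0 xi.
by rewrite dprodZE xi scaler0.
Qed.

Lemma finsupp_dunit i (z : X i) : finsupp (dunit z).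
Proof.
by exists [:: i]; split=> // j; rewrite inE eq_sym => ji; rewrite dunit_out.
Qed.

Lemma dunit_sum (x : D) s : uniq s -> (forall i, i \notin s -> x i = 0) ->
  x = \sum_(i <- s) dunit (x i).
Proof.
move=> us x0; apply: dprod_ext => i; rewrite dprod_sumE.
have [si|nsi] := boolP (i \in s); last first.
  rewrite x0 // big_seq big1 // => j js; rewrite dunit_out //.
  by apply: contraNneq nsi => <-.
rewrite (bigD1_seq i) //= dunit_in big1 ?addr0 // => j ji.
by rewrite dunit_out.
Qed.

Variable f : forall i, X i -> T.
Hypothesis f0 : forall i, f (0 : X i) = 0.
Hypothesis fD : forall i (x y : X i), f (x + y) = f x + f y.

(** Default value 0 when the support of [x] is infinite. *)
Definition fsum (x : D) : T :=
  if pselect (finsupp x) is left h then \sum_(i <- projT1 (cid h)) f (x i) else 0.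

Lemma fsumE x s : uniq s -> (forall i, i \notin s -> x i = 0) ->
  fsum x = \sum_(i <- s) f (x i).
Proof.
move=> us x0; rewrite /fsum; case: pselect => [h|[]]; last by exists s.
case: (cid h) => t /= [ut y0].
have [u [uu su tu _]] := seq_cover s t.
rewrite -(@sum_widen _ _ s u) //; last by move=> i /x0 ->.
by rewrite -(@sum_widen _ _ t u) // => i /y0 ->.
Qed.

Lemma fsumD x y : finsupp x -> finsupp y -> fsum (x + y) = fsum x + fsum y.
Proof.
move=> [s [us x0]] [t [ut y0]]; have [u [uu _ _ nu]] := seq_cover s t.
have hu i : i \notin u -> x i = 0 /\ y i = 0 by move=> /nu[/x0 -> /y0 ->].
rewrite (@fsumE x u) // => [|i /hu[] //].
rewrite (@fsumE y u) // => [|i /hu[] //].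
rewrite (@fsumE (x + y) u) // => [|i /hu[xi yi]].
  by rewrite -big_split /=; apply: eq_bigr => i _; rewrite -fD.
by rewrite dprodDE xi yi addr0.
Qed.

Lemma fsum_dunit i (z : X i) : fsum (dunit z) = f z.
Proof.
rewrite (@fsumE _ [:: i]) // => [|j]; first by rewrite big_seq1 dunit_in.
by rewrite inE eq_sym => ji; rewrite dunit_out.
Qed.

End FiniteSupport.

Section Constructions.
Variable g : grading.
Local Notation R := (gR g).
Local Notation G := (gG g).
Local Notation rc := (@rc g).
Local Notation gmod := (gmod g).

Lemma gmod_sum_eq0 (M : gmod) (s : seq G) (a : G -> M) : uniq s ->
  (forall d, gcmp d (a d)) -> \sum_(d <- s) a d = 0 -> forall d, d \in s -> a d = 0.
Proof. by move=> us Ca s0; case: (gsum M) => _ _ h; apply: h. Qed.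

(** The graded product: finite sums of families that are homogeneous of one
    degree. *)
Lemma gprod_ex (A : Type) (X : A -> gmod) :
  exists (P : gmod) (p : forall i, {linear P -> X i}),
  [/\ forall i, deg0 (p i), forall x y, (forall i, p i x = p i y) -> x = y
    & forall d (y : forall i, X i), (forall i, gcmp d (y i)) ->
        exists2 x, gcmp d x & forall i, p i x = y i].
Proof.
pose C (d : G) : set (dprod X) := [set x | forall i, gcmp d (x i)].
have [|||s a us Ca s0 d ds|P [j [jinj rj jC]]] := @graded_span_ex g (dprod X) C.
- by move=> d i; exact: gcmp0.
- by move=> d x y Cx Cy i; exact: (gcmpB (Cx i) (Cy i)).
- by move=> e d a x ea Cx i; exact: gscal.
- apply: dprod_ext => i.
  apply: (@gmod_sum_eq0 (X i) s (fun d => a d i)) => // [e|]; first exact: Ca.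
  by rewrite -dprod_sumE s0.
have pex i : exists p : {linear P -> X i}, forall x, p x = j x i.
  by apply: lin_ex => [x y|b x]; rewrite ?linearD ?linearZ.
exists P, (fun i => projT1 (cid (pex i))); split.
- by move=> i d x /jC Cx; case: (cid (pex i)) => p /= ->; exact: Cx.
- move=> x y e; apply: jinj; apply: dprod_ext => i; move: (e i).
  by case: (cid (pex i)) => p /= hp; rewrite !hp.
- move=> d y Cy; have [x _ jx] : range j y.
    by rewrite rj; apply: (@gspan_homog g _ C _ d) => // e i; exact: gcmp0.
  exists x; first by apply/jC; rewrite jx.
  by move=> i; case: (cid (pex i)) => p /= ->; rewrite jx.
Qed.

Lemma gprod_closed F (A : Type) (X : A -> gmod) (P : gmod)
    (p : forall i, {linear P -> X i}) :
  (forall i, deg0 (p i)) -> (forall x y, (forall i, p i x = p i y) -> x = y) ->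
  (forall d (y : forall i, X i), (forall i, gcmp d (y i)) ->
        exists2 x, gcmp d x & forall i, p i x = y i) ->
  (forall i, gclosed F (X i)) -> gclosed F P.
Proof.
move=> dp pinj plift cX; split.
  move=> x [I FI Ix]; apply: pinj => i; rewrite linear0.
  by have [tX _] := cX i; apply: tX; exists I => // a Ia /=; rewrite -linearZ Ix // linear0.
move=> I d phi FI [phiD phiZ phid].
have /choice_dep[y hy] i : exists y, gcmp d y /\ forall a, I a -> p i (phi a) = a *: y.
  have [_ hc] := cX i; have [|y dy yE] := hc I d (p i \o phi) FI; last by exists y.
  split=> /= [a b Ia Ib|r a Ia|e a Ia ea].
  - by rewrite phiD // linearD.
  - by rewrite phiZ // linearZ.
  - by apply: dp; exact: phid.
have [|x dx xE] := plift d y; first by move=> i; case: (hy i).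
exists x => // a Ia; apply: pinj => i; rewrite linearZ /= xE.
by case: (hy i) => _; apply.
Qed.

Lemma gdsum_ex (A : eqType) (X : A -> gmod) :
  exists (D : gmod) (j : forall i, {linear X i -> D}),
  [/\ forall i, deg0 (j i),
      forall Q : D -> Prop, Q 0 -> (forall x y, Q x -> Q y -> Q (x + y)) ->
        (forall i x, Q (j i x)) -> forall z, Q z
    & forall (W : gmod) (f : forall i, {linear X i -> W}), (forall i, deg0 (f i)) ->
        exists h : {linear D -> W}, deg0 h /\ forall i x, h (j i x) = f i x].
Proof.
pose C (d : G) : set (dprod X) := [set x | (forall i, gcmp d (x i)) /\ finsupp x].
have C0 d : C d 0 by split; [move=> i; exact: gcmp0 | exact: finsupp0].
have CB d x y : C d x -> C d y -> C d (x - y).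
  move=> [Cx sx] [Cy sy]; split; first by move=> i; exact: (gcmpB (Cx i) (Cy i)).
  by apply: finsuppD => //; rewrite -scaleN1r; exact: finsuppZ.
have CZ e d a x : rc e a -> C d x -> C (e + d) (a *: x).
  by move=> ea [Cx sx]; split; [move=> i; exact: gscal | exact: finsuppZ].
have [s a us Ca s0 d ds|D [k [kinj rk kC]]] := @graded_span_ex g (dprod X) C C0 CB CZ.
  apply: dprod_ext => i.
  apply: (@gmod_sum_eq0 (X i) s (fun d => a d i)) => // [e|]; first by case: (Ca e).
  by rewrite -dprod_sumE s0.
have jex0 i (x : X i) : exists z, k z = dunit x.
  suff [z _ <-] : range k (dunit x) by exists z.
  rewrite rk; have [P0 PD _] := gspan_sub C0 CB CZ.
  move: x; apply: (gpr_ind (gsum (X i))).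
  - by rewrite dunit0.
  - by move=> x y Px Py; rewrite dunitD; exact: PD.
  - move=> d x dx; apply: (@gspan_homog g _ C _ d) => //; split; last exact: finsupp_dunit.
    by move=> l; rewrite /dunit; case: dfwithP => // l' _; exact: gcmp0.
have jex i : exists j : {linear X i -> D}, forall x, k (j x) = dunit x.
  have /choice[h hh] := jex0 i.
  have [j jE] : exists j : {linear X i -> D}, j =1 h.
    apply: lin_ex => [x y|b x]; apply: kinj; rewrite ?linearD ?linearZ /= !hh.
      exact: dunitD.
    exact: dunitZ.
  by exists j => x; rewrite jE hh.
have /choice_dep[j jE] := jex.
have fsk z : finsupp (k z).
  move: z; apply: (gpr_ind (gsum D)).
  - by rewrite linear0; exact: finsupp0.
  - by move=> x y sx sy; rewrite linearD; exact: finsuppD.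
  - by move=> d x /kC[].
have kE z s : uniq s -> (forall i, i \notin s -> k z i = 0) ->
    z = \sum_(i <- s) j i (k z i).
  move=> us z0; apply: kinj; rewrite linear_sum [LHS](dunit_sum us z0).
  by apply: eq_bigr => i _; rewrite jE.
exists D, j; split.
- move=> i d x dx; apply/kC; rewrite jE; split; last exact: finsupp_dunit.
  by move=> l; rewrite /dunit; case: dfwithP => // l' _; exact: gcmp0.
- move=> Q Q0 QD Qj z; have [s [us z0]] := fsk z.
  by rewrite (kE z s us z0); elim/big_ind: _.
- move=> W f df; pose S (x : dprod X) := fsum (fun i (x : X i) => f i x) x.
  have f0 i : f i 0 = 0 by exact: linear0.
  have fD i x y : f i (x + y) = f i x + f i y by exact: linearD.
  have [h hE] : exists h : {linear D -> W}, h =1 S \o k.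
    apply: lin_ex => /= [x y|b x]; first by rewrite linearD /S fsumD.
    have [s [us z0]] := fsk x; rewrite /S (fsumE f0 us z0) (@fsumE _ _ _ _ _ f0 _ s us).
      rewrite scaler_sumr; apply: eq_bigr => i _; rewrite -linearZ; congr (f i _).
      by rewrite linearZ.
    by move=> i /z0 xi; rewrite linearZ /= dprodZE xi scaler0.
  exists h; split.
    move=> d x /kC[dx _]; rewrite hE /= /S; have [s [us z0]] := fsk x.
    rewrite (fsumE f0 us z0); elim/big_ind: _ => [||i _]; [exact: gcmp0|exact: gcmpD|].
    by apply: df.
  by move=> i x; rewrite hE /= jE /S fsum_dunit.
Qed.

Lemma gshift_ex (M : gmod) (t : G) : exists (M' : gmod)
  (f : {linear M -> M'}) (h : {linear M' -> M}),
  [/\ cancel f h, cancel h f & forall d x, gcmp d x <-> gcmp (d + t) (f x)].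
Proof.
have hk : pcancel (fun d : G => d + t) (fun d => Some (d - t)).
  by move=> d; rewrite addrK.
have kh : ocancel (fun d => Some (d - t)) (fun d : G => d + t).
  by move=> d /=; rewrite subrK.
have ds := internal_direct_sum_reindex hk kh (gsum M).
have sc (e d : G) (a : R) (x : M) : rc e a -> gcmp (d - t) x -> gcmp (e + d - t) (a *: x).
  by move=> ea dx; rewrite -addrA; exact: gscal.
exists (GMod ds sc).
have [f fE] : exists f : {linear M -> (GMod ds sc)}, f =1 id by exact: lin_ex.
have [h hE] : exists h : {linear (GMod ds sc) -> M}, h =1 id by exact: lin_ex.
exists f, h; split.
- by move=> x; rewrite hE fE.
- by move=> x; rewrite fE hE.
- by move=> d x; rewrite fE /= addrK.
Qed.

Lemma gclosed_shift F (M M' : gmod) (f : {linear M -> M'}) (h : {linear M' -> M}) t :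
  cancel f h -> cancel h f -> (forall d x, gcmp d x <-> gcmp (d + t) (f x)) ->
  gclosed F M -> gclosed F M'.
Proof.
move=> fh hf fd [tM cM]; split.
  move=> x [I FI Ix]; rewrite -[x]hf (tM (h x)) ?linear0 //.
  by exists I => // a Ia /=; rewrite -linearZ Ix // linear0.
move=> I d phi FI [phiD phiZ phid].
have [|y dy yE] := cM I (d - t) (h \o phi) FI.
  split=> /= [a b Ia Ib|r a Ia|e a Ia ea].
  - by rewrite phiD // linearD.
  - by rewrite phiZ // linearZ.
  - by apply/fd; rewrite hf addrA subrK; exact: phid.
exists (f y); first by rewrite -[d](subrK t); apply/fd.
by move=> a Ia; rewrite -linearZ -yE //= hf.
Qed.

Definition regular_gmod : gmod :=
  @GMod g R^o rc (rc_sum g) (fun e d a x ea dx => rc_mul ea dx).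

End Constructions.

(** * Reflection onto closed modules *)

Section Envelope.
Variable g : grading.
Local Notation R := (gR g).
Local Notation G := (gG g).
Local Notation rc := (@rc g).
Local Notation gmod := (gmod g).

Lemma glinear0 (W : gmod) I d (phi : R -> W) : ideal I -> glinear I d phi -> phi 0 = 0.
Proof. by move=> [I0 _ _] [_ h _]; rewrite -[X in phi X](mul0r 0) h // scale0r. Qed.

Lemma glinear_pr (W : gmod) I d (phi : R -> W) : hideal I -> glinear I d phi ->
  forall e a, I a -> 'pr_(e + d) (phi a) = phi (gpr (rc_sum g) e a).
Proof.
move=> hI gl e a Ia; have [[I0 ID IM] hpr] := hI; have [phiD phiZ phid] := gl.
have phi0 := glinear0 hI.1 gl.
suff [] : I a /\ 'pr_(e + d) (phi a) = phi (gpr (rc_sum g) e a) by [].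
move: a Ia; apply: (hideal_ind hI).
- by split=> //; rewrite phi0 !gpr0.
- move=> x y [Ix hx] [Iy hy]; split; first exact: ID.
  by rewrite phiD // !gprD phiD ?hx ?hy //; exact: hpr.
- move=> e' a ea Ia; split=> //; have [->|ne] := eqVneq e e'.
    by rewrite !gpr_id //; exact: phid.
  rewrite (gpr_neq (rc_sum g) ea) // phi0 (gpr_neq (gsum W) (phid _ _ Ia ea)) //.
  by rewrite (inj_eq (addIr d)).
Qed.

Variables (F : set (set R)) (gF : gabriel F) (N : gmod).
Hypothesis tN : torsfree F N.

(** The degree [d] part of the colimit of Hom(I, N) over the filter: functions
    that are linear of degree [d] on some ideal of the filter, modulo those
    that vanish on some ideal of the filter. *)
Lemma envelope_ex : exists (E : gmod) (i : {linear N -> E}),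
  [/\ gclosed F E, deg0 i, injective i & forall z, sat F (range i) z].
Proof.
have hF I : F I -> hideal I by exact: gab_ideal.
have fctB (f h : R -> N) a : (f - h) a = f a - h a by [].
have fctD (f h : R -> N) a : (f + h) a = f a + h a by [].
have fctZ b (f : R -> N) a : (b *: f) a = b *: f a by [].
pose C (d : G) : set (R -> N) := [set f | exists2 I, F I & glinear I d f].
pose Z : set (R -> N) := [set f | exists2 I, F I & forall a, I a -> f a = 0].
have C0 d : C d 0.
  exists setT; first exact: gab_full.
  by split=> [a b _ _|r a _|e a _ _]; rewrite /= ?addr0 ?scaler0 //; exact: gcmp0.
have CB d f h : C d f -> C d h -> C d (f - h).
  move=> [I FI glf] [J FJ glh]; exists (I `&` J); first exact: gab_cap.
  have [fD fZ fd] := glf; have [hD hZ hd] := glh.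
  split=> [a b [Ia Ja] [Ib Jb]|r a [Ia Ja]|e a [Ia Ja] ea].
  - by rewrite !fctB fD // hD // opprD addrACA.
  - by rewrite !fctB fZ // hZ // scalerBr.
  - by apply: gcmpB; auto.
have CZ e d a f : rc e a -> C d f -> C (e + d) (a *: f).
  move=> ea [I FI [fD fZ fd]]; exists I => //; split=> [b c Ib Ic|r b Ib|e' b Ib e'b].
  - by rewrite !fctZ fD // scalerDr.
  - by rewrite !fctZ fZ // !scalerA mulrC.
  - by rewrite fctZ addrCA; apply: gscal => //; exact: fd.
have Zsub : submodule Z.
  split.
  - by exists setT => //; exact: gab_full.
  - move=> f h [I FI f0] [J FJ h0]; exists (I `&` J); first exact: gab_cap.
    by move=> a [Ia Ja]; rewrite fctD f0 // h0 // addr0.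
  - by move=> a f [I FI f0]; exists I => // b Ib; rewrite fctZ f0 // scaler0.
have indep s f : uniq s -> (forall d, C d (f d)) -> Z (\sum_(d <- s) f d) ->
    forall d, d \in s -> Z (f d).
  move=> us Cf [I0 FI0 sum0] d ds.
  have /choice[I hI] e : exists I, F I /\ glinear I e (f e).
    by have [I ? ?] := Cf e; exists I.
  have [J [FJ sJ]] : exists J, F J /\ forall e, e \in s -> J `<=` I e.
    elim: s {us sum0 ds} => [|e s [J [FJ sJ]]]; first by exists setT; split=> //; exact: gab_full.
    exists (I e `&` J); split; first by apply: gab_cap => //; case: (hI e).
    by move=> e'; rewrite inE => /orP[/eqP->|/sJ h] a [] // _ /h.
  have FK := gab_cap gF FI0 FJ; exists (I0 `&` J) => // a Ka.
  have [_ gld] := hI d; have [fD fZ fd] := gld.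
  have sKI : I0 `&` J `<=` I d by move=> x [_ /sJ]; apply.
  have [[_ KD _] _] := hF _ FK.
  suff [] : (I0 `&` J) a /\ f d a = 0 by [].
  move: a Ka; apply: (hideal_ind (hF _ FK)).
  - split; first by have [[]] := hF _ FK.
    by apply: (@glinear0 _ (I d) d) => //; have [FId _] := hI d; have [] := hF _ FId.
  - move=> x y [Kx fx] [Ky fy]; split; first exact: KD.
    by rewrite fD ?fx ?fy ?addr0 //; exact: sKI.
  - move=> e a ea Ka; split=> //; have [I0a Ja] := Ka.
    have := sum0 a I0a; rewrite fct_sumE => /(congr1 ('pr_(e + d))).
    rewrite gpr0 gpr_sum (bigD1_seq d) //= gpr_id; last by apply: fd => //; exact: sKI.
    rewrite big_seq_cond big1 ?addr0 // => d' /andP[d's d'd].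
    have [_ [_ _ fd']] := hI d'.
    rewrite (gpr_neq (gsum N) (fd' _ _ (sJ _ d's _ Ja) ea)) //.
    by rewrite (inj_eq (addrI e)) eq_sym.
have [PN PD PZ] := gspan_sub C0 CB CZ.
have [E [cl [clD clZ cl0 clS clC]]] := graded_subquotient_ex C0 CB CZ Zsub indep.
have CP d f : C d f -> gspan C f by exact: gspan_homog.
have cl_eq f h : gspan C f -> gspan C h -> Z (f - h) -> cl f = cl h.
  move=> Pf Ph Zfh; apply/eqP; rewrite -subr_eq0; apply/eqP.
  have Pnh : gspan C (- h) by rewrite -scaleN1r; exact: PZ.
  by rewrite -[- cl h]scaleN1r -clZ // scaleN1r -clD //; apply/cl0 => //; exact: PD.
pose lam (n : N) : R -> N := fun a => a *: n.
have Clam d n : gcmp d n -> C d (lam n).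
  move=> dn; exists setT; first exact: gab_full.
  split=> [a b _ _|r a _|e a _ ea]; rewrite /lam ?scalerDl ?scalerA //.
  exact: gscal.
have lamD x y : lam (x + y) = lam x + lam y.
  by apply/funext => a; rewrite fctD /lam scalerDr.
have lamZ b x : lam (b *: x) = b *: lam x.
  by apply/funext => a; rewrite fctZ /lam !scalerA mulrC.
have Plam n : gspan C (lam n).
  move: n; apply: (gpr_ind (gsum N)).
  - rewrite (_ : lam 0 = 0) //; apply/funext => a; exact: scaler0.
  - by move=> x y; rewrite lamD; exact: PD.
  - by move=> d x dx; apply: (CP d); exact: Clam.
have [i iE] : exists i : {linear N -> E}, i =1 cl \o lam.
  apply: lin_ex => /= [x y|b x]; first by rewrite lamD clD.
  by rewrite lamZ clZ.
have di : deg0 i.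
  by move=> d x dx; apply/clC; exists (lam x); [exact: Clam | rewrite iE].
have ii : injective i.
  move=> x y e; apply/eqP; rewrite -subr_eq0; apply/eqP/tN.
  have : i (x - y) = 0 by rewrite linearB /= e subrr.
  by rewrite iE /= => /cl0 -[] // I FI h; exists I.
have key d f I : F I -> glinear I d f -> forall a, I a -> a *: cl f = i (f a).
  move=> FI gl a Ia; have [fD fZ fd] := gl; have Cf : C d f by exists I.
  have Pf := CP _ _ Cf.
  rewrite iE /= -clZ //; apply: cl_eq => //; first exact: PZ.
  exists I => // r Ir; rewrite fctB fctZ /lam; apply/eqP; rewrite subr_eq0; apply/eqP.
  by rewrite -fZ // -fZ // mulrC.
have cE z : sat F (range i) z.
  apply: homsub_pr_in => [|d].
    by apply: sat_homsub => //; exact: range_homsub.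
  have /clC[f [I FI gl] <-] := gprP (gsum E) d z.
  exists I => // a Ia; rewrite (key d f I) //; by exists (f a).
have tE : torsfree F E.
  apply: torsfree_hom => // d z /clC[f [I FI gl] <-] [J FJ Jf].
  apply/cl0; first by apply: (CP d); exists I.
  exists (I `&` J); first exact: gab_cap.
  move=> a [Ia Ja]; apply: ii; rewrite linear0 -(key d f I) //.
  exact: Jf.
exists E, i; split=> //; split=> // I d phi FI gl; have [phiD phiZ phid] := gl.
have hI := hF I FI; have [[I0 ID IM] hIpr] := hI.
(* phi has values in N on an ideal J of the filter; its restriction to J
   represents the element sought. *)
pose J : set R := [set a | I a /\ range i (phi a)].
have hJ : hideal J.
  have [[r0 rD rZ] hr] := range_homsub di.
  split.
    split=> [|x y [Ix rx] [Iy ry]|a x [Ix rx]].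
    - by split=> //; rewrite (glinear0 hI.1 gl).
    - by split; [exact: ID | rewrite phiD //; exact: rD].
    - by split; [exact: IM | rewrite phiZ //; exact: rZ].
  by move=> e x [Ix rx]; split; [exact: hIpr | rewrite -(glinear_pr hI gl) //; exact: hr].
have FJ : F J.
  apply: (gab_local gF FI) => // e a ea Ia; have [I' FI' h] := cE (phi a).
  apply: (gab_up gF FI'); first exact: hideal_colon ea.
  by move=> b I'b; split; [exact: IM | rewrite phiZ //; exact: h].
have /choice[f hf] a : exists n, J a -> i n = phi a.
  have [Ja|nJa] := pselect (J a); last by exists 0.
  by have [_ [n _ e]] := Ja; exists n.
have [[J0 JD JM] _] := hJ.
have glf : glinear J d f.
  split.
  - move=> a b Ja Jb; apply: ii; rewrite linearD !hf //; last exact: JD.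
    by rewrite phiD //; [case: Ja | case: Jb].
  - move=> r a Ja; apply: ii; rewrite linearZ /= !hf //; last exact: JM.
    by rewrite phiZ //; case: Ja.
  - move=> e a Ja ea; apply: (inj_reflect_deg di ii); rewrite hf //.
    by apply: phid => //; case: Ja.
exists (cl f); first by apply/clC; exists f => //; exists J.
move=> a Ia; apply: (tors_eq tE FJ) => b Jb.
rewrite scalerA mulrC -scalerA (key d f J) // hf //.
by rewrite -!phiZ ?[a * b]mulrC //; case: Jb.
Qed.

End Envelope.

Lemma quotient_tors_ex (g : grading) F (M : gmod g) : gabriel F ->
  exists (Q : gmod g) (p : {linear M -> Q}),
    [/\ deg0 p, torsfree F Q, forall x, p x = 0 <-> tors F x
      & forall q, exists x, p x = q].
Proof.
move=> gF; have [Q [p [dp pK pS]]] := gquo_ex (tors_homsub gF M).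
exists Q, p; split=> // q; have [x <-] := pS q => -[I FI h].
apply/pK; apply: sat_sat => //; first exact: homsub0.
by exists I => // a Ia; apply/pK; rewrite linearZ; exact: h.
Qed.

(** The envelope of the quotient by the torsion. *)
Lemma reflection_ex (g : grading) F (M : gmod g) : gabriel F ->
  exists (Z : gmod g) (eta : {linear M -> Z}),
    [/\ gclosed F Z, deg0 eta, forall x, eta x = 0 <-> tors F x
      & forall z, sat F (range eta) z].
Proof.
move=> gF; have [Q [p [dp tQ pK pS]]] := quotient_tors_ex M gF.
have [E [i [cE di ii sE]]] := envelope_ex gF tQ.
have [eta etaE] := lin_comp_ex (i) (p).
exists E, eta; split=> //.
- by move=> d x dx; rewrite etaE; apply/di/dp.
- move=> x; rewrite etaE /= -pK; split=> [e|->]; last exact: linear0.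
  by apply: ii; rewrite e linear0.
- move=> z; have [I FI h] := sE z; exists I => // a /h[q _ <-].
  by have [x <-] := pS q; exists x => //; rewrite etaE.
Qed.

(** * Categories of closed modules *)

(** A category of graded modules closed for a Gabriel filter, presented
    abstractly: [und] is fully faithful, and its image is, up to isomorphism,
    the class of [mcF]-closed modules. *)
Record modcat (g : grading) := ModCat {
  mc :> category;
  mcF : set (set (gR g));
  mcF_gab : gabriel mcF;
  und : mc -> gmod g;
  act : forall X Y : mc, hom X Y -> {linear und X -> und Y};
  act_deg : forall (X Y : mc) (f : hom X Y), deg0 (act f);
  act_inj : forall (X Y : mc) (f h : hom X Y), act f =1 act h -> f = h;
  act_full : forall (X Y : mc) (f : {linear und X -> und Y}), deg0 f ->
    exists h : hom X Y, act h =1 f;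
  act1 : forall (X : mc) (x : und X), act (idm X) x = x;
  actM : forall (X Y Z : mc) (h : hom Y Z) (f : hom X Y) (x : und X),
    act (h \oc f) x = act h (act f x);
  und_closed : forall X, gclosed mcF (und X);
  und_surj : forall N, gclosed mcF N -> exists (X : mc) (f : {linear und X -> N})
    (h : {linear N -> und X}), [/\ deg0 f, cancel f h & cancel h f]
}.
Arguments und {g m} X : rename.
Arguments act {g m X Y} f : rename.

Section ModcatTheory.
Variables (g : grading) (C : modcat g).
Local Notation R := (gR g).
Local Notation G := (gG g).
Local Notation gmod := (gmod g).
Local Notation F := (mcF C).
Implicit Types X Y Z W K : C.

Let gF : gabriel F := mcF_gab C.

Lemma und_tors X : torsfree F (und X).
Proof. by case: (und_closed X). Qed.

Lemma zero_hom_ex X Y : exists h : hom X Y, forall x, act h x = 0.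
Proof.
have [f fE] : exists f : {linear und X -> und Y}, f =1 fun=> 0.
  by apply: lin_ex => [x y|a x]; rewrite ?addr0 ?scaler0.
have [h hE] : exists h : hom X Y, act h =1 f.
  by apply: act_full => d x _; rewrite fE; exact: gcmp0.
by exists h => x; rewrite hE fE.
Qed.

Lemma zero_und X : zero_object X <-> forall x : und X, x = 0.
Proof.
split=> [h x|h Y].
  have [[i [_ iu]] _] := h X; have [z z0] := zero_hom_ex X X.
  have e : idm X = z by rewrite -(iu z) // (iu (idm X)).
  by rewrite -(act1 x) e z0.
split.
  have [z z0] := zero_hom_ex Y X; exists z; split=> // f _.
  by apply: act_inj => x; rewrite z0 [RHS]h.
have [z z0] := zero_hom_ex X Y; exists z; split=> // f _.
by apply: act_inj => x; rewrite z0 (h x) linear0.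
Qed.

Lemma zero_obj_ex : exists Z : C, forall x : und Z, x = 0.
Proof.
have [P [p [dp pinj plift]]] := @gprod_ex g void (fun v => match v with end).
have cP : gclosed F P by apply: gprod_closed dp pinj plift _; case.
have [Z [f [h [df fh hf]]]] := und_surj cP.
by exists Z => x; apply: (can_inj fh); apply: pinj; case.
Qed.

Lemma zero_mor X Y (f : hom X Y) : zero_morphism f <-> forall x, act f x = 0.
Proof.
split=> [[Z [a [b [/zero_und Z0 ->]]]] x|h].
  by rewrite actM /= (Z0 (act b x)) linear0.
have [Z Z0] := zero_obj_ex.
have [a a0] := zero_hom_ex Z Y; have [b b0] := zero_hom_ex X Z.
exists Z, a, b; split; first exact/zero_und.
by apply: act_inj => x; rewrite actM /= h a0.
Qed.

Lemma sub_obj X (N : set (und X)) : homsub N -> sat F N `<=` N ->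
  exists (K : C) (i : hom K X), injective (act i) /\ range (act i) = N.
Proof.
move=> hN sN; have [M [j [dj jinj jN]]] := gsub_ex hN.
have cM : gclosed F M.
  by apply: (closed_sub (i := j) gF) => //; [rewrite jN | exact: und_closed].
have [K [f [h [df fh hf]]]] := und_surj cM.
have [i0 i0E] := lin_comp_ex (j) (f).
have [i iE] : exists i : hom K X, act i =1 i0.
  by apply: act_full => d x dx; rewrite i0E; apply/dj/df.
exists K, i; split.
  by move=> x y; rewrite !iE !i0E => /jinj /(can_inj fh).
rewrite -jN; apply/seteqP; split=> [_ [x _ <-]|_ [m _ <-]].
  by exists (f x) => //; rewrite iE i0E.
by exists (h m) => //; rewrite iE i0E /= hf.
Qed.

Lemma factor_inj K X Y (i : hom K X) (f : hom Y X) : injective (act i) ->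
  range (act f) `<=` range (act i) -> exists v : hom Y K, i \oc v = f.
Proof.
move=> ii sub; have /choice[v0 hv] y : exists k, act i k = act f y.
  by have [|k _ e] := sub (act f y); [exists y | exists k].
have [v1 v1E] : exists v : {linear und Y -> und K}, v =1 v0.
  by apply: lin_ex => [x y|a x]; apply: ii; rewrite ?linearD ?linearZ /= !hv ?linearD ?linearZ.
have [v vE] : exists v : hom Y K, act v =1 v1.
  apply: act_full => d x dx; apply: (inj_reflect_deg (@act_deg _ _ _ _ i) ii).
  by rewrite v1E hv; exact: act_deg.
by exists v; apply: act_inj => y; rewrite actM /= vE v1E hv.
Qed.

Lemma extend_dense (M : gmod) Z W (eta : {linear M -> und Z})
    (f : {linear M -> und W}) : deg0 eta -> deg0 f ->
  (forall z, sat F (range eta) z) -> (forall m, eta m = 0 -> f m = 0) ->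
  exists h : hom Z W, forall m, act h (eta m) = f m.
Proof.
move=> de df dense ker.
have [|||||h [dh hE]] := @closed_extend g F (und Z) (und W)
    (fun z w => exists2 m, eta m = z & f m = w) gF (und_closed W).
- move=> _ _ _ _ [m <- <-] [n <- <-]; exists (m + n); by rewrite linearD.
- move=> a _ _ [m <- <-]; exists (a *: m); by rewrite linearZ.
- by move=> d _ _ [m <- <-]; exists ('pr_d m); rewrite pr_deg0.
- by move=> w [m /ker e <-].
- by move=> z; have [I FI h] := dense z; exists I => // a /h[m _ e]; exists (f m), m.
have [k kE] := act_full dh.
by exists k => m; rewrite kE; apply: hE; exists m.
Qed.

Lemma dense_epi (M : gmod) Z W (eta : M -> und Z) (h k : hom Z W) :
  (forall z, sat F (range eta) z) -> (forall m, act h (eta m) = act k (eta m)) ->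
  h = k.
Proof.
move=> dense e; apply: act_inj => z; have [I FI hI] := dense z.
apply: (tors_eq (@und_tors W) FI) => a /hI[m _ mE].
by rewrite -!linearZ -mE.
Qed.

Lemma ker_sat X Y (f : hom X Y) :
  sat F [set x | act f x = 0] `<=` [set x | act f x = 0].
Proof.
by move=> x sx; apply: (@und_tors Y); apply/sat_preim.
Qed.

(** The kernel of f is saturated, the target being torsion-free, so it is an
    object of C. *)
Lemma monicE X Y (f : hom X Y) : monic f <-> injective (act f).
Proof.
split=> [mf|ii W u v e]; last first.
  by apply: act_inj => x; apply: ii; rewrite -[LHS](actM f u) e actM.
have [K [i [ii iE]]] := sub_obj (ker_homsub (@act_deg _ _ _ _ f)) (@ker_sat _ _ f).
have [z z0] := zero_hom_ex K X.
have iz : i = z.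
  apply: mf; apply: act_inj => x; rewrite !actM /= z0 linear0.
  suff : [set x | act f x = 0] (act i x) by [].
  by rewrite -iE; exists x.
move=> x y e; apply/eqP; rewrite -subr_eq0; apply/eqP.
have [k _ <-] : range (act i) (x - y) by rewrite iE /= linearB /= e subrr.
by rewrite iz z0.
Qed.

Lemma is_kernelE K X Y (k : hom K X) (f : hom X Y) : is_kernel k f <->
  injective (act k) /\ range (act k) = [set x | act f x = 0].
Proof.
split=> [[k0 ku]|[ki kr]].
  have ki : injective (act k).
    apply/monicE => W u v e; have [|w [_ wu]] := ku W (k \oc u).
      apply/zero_mor => x; rewrite cmpA actM /=; move: (act u x).
      exact/zero_mor.
    by rewrite -(wu u) // (wu v).
  split=> //; have [L [i [ii iE]]] := sub_obj (ker_homsub (@act_deg _ _ _ _ f)) (@ker_sat _ _ f).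
  apply/seteqP; split=> [_ [x _ <-]|x /= fx].
    by have /zero_mor := k0; move=> /(_ x); rewrite actM.
  have [|u [uE _]] := ku L i.
    apply/zero_mor => y; rewrite actM /=; suff : [set x | act f x = 0] (act i y) by [].
    by rewrite -iE; exists y.
  have [y _ <-] : range (act i) x by rewrite iE.
  by rewrite -uE; exists (act u y) => //; rewrite actM.
have fk x : act f (act k x) = 0.
  by suff : [set x | act f x = 0] (act k x) by []; rewrite -kr; exists x.
split; first by apply/zero_mor => x; rewrite actM /= fk.
move=> W t /zero_mor t0; have [|u uE] := @factor_inj _ _ _ k t ki.
  by move=> _ [x _ <-]; rewrite kr /= -[act f _]actM.
exists u; split=> // v vE; have /monicE mk := ki.
by apply: mk; rewrite uE vE.
Qed.

(** The saturated image of q is an object K through which q factors; by the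
    uniqueness in the universal property its inclusion is split epi. *)
Lemma is_cokernel_dense X Y Q (f : hom X Y) (q : hom Y Q) : is_cokernel f q ->
  forall z, sat F (range (act q)) z.
Proof.
move=> [q0 qu]; have hq := range_homsub (@act_deg _ _ _ _ q).
have [K [i [ii iE]]] := sub_obj (sat_homsub gF hq) (sat_sat gF hq).
have [|q' q'E] := @factor_inj _ _ _ i q ii.
  by rewrite iE; exact: sat_in.
have [|u [uE _]] := qu _ q'.
  apply/zero_mor => x; apply: ii; rewrite linear0 -[LHS](actM i) cmpA q'E.
  by move: x; apply/zero_mor.
have iu : i \oc u = idm Q.
  have [w [_ wu]] := qu _ q q0.
  by rewrite -(wu (i \oc u)) ?(wu (idm Q)) ?cmp1m // -cmpA uE.
move=> z; rewrite -iE; exists (act u z) => //.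
by rewrite -[LHS](actM i) iu act1.
Qed.

Lemma is_cokernelI X Y Q (f : hom X Y) (q : hom Y Q) :
  range (act f) = [set y | act q y = 0] -> (forall z, sat F (range (act q)) z) ->
  is_cokernel f q.
Proof.
move=> fE dense; split.
  apply/zero_mor => x; rewrite actM /=; suff : [set y | act q y = 0] (act f x) by [].
  by rewrite -fE; exists x.
move=> W t /zero_mor t0.
have [m qm|u uE] := @extend_dense (und Y) Q W (act q) (act t)
    (@act_deg _ _ _ _ q) (@act_deg _ _ _ _ t) dense.
  have [x _ <-] : range (act f) m by rewrite fE.
  by rewrite -[LHS](actM t).
exists u; split; first by apply: act_inj => x; rewrite actM /= uE.
move=> v vE; apply: (@dense_epi (und Y) _ _ (act q)) => // m.
by rewrite uE -vE actM.
Qed.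

(** Cokernels are reflections of quotients, so the last map is only onto up to
    torsion. *)
Lemma short_exactE X' X X'' (f : hom X' X) (h : hom X X'') : short_exact f h <->
  [/\ injective (act f), range (act f) = [set x | act h x = 0]
    & forall z, sat F (range (act h)) z].
Proof.
split=> [[/is_kernelE[fi fr] /is_cokernel_dense d] //|[fi fr d]].
by split; [exact/is_kernelE | exact: is_cokernelI].
Qed.

Lemma refl_obj (M : gmod) : exists (Z : C) (eta : {linear M -> und Z}),
  [/\ deg0 eta, forall x, eta x = 0 <-> tors F x & forall z, sat F (range eta) z].
Proof.
have [Z0 [eta0 [cZ de ke dense]]] := reflection_ex M gF.
have [Z [f [h [df fh hf]]]] := und_surj cZ.
have [eta etaE] := lin_comp_ex (h) (eta0).
exists Z, eta; split.
- move=> d x dx; rewrite etaE; apply: (inj_reflect_deg df (can_inj fh)).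
  by rewrite /= hf; exact: de.
- move=> x; rewrite etaE -ke /=; split=> [e|->]; last exact: linear0.
  by apply: (can_inj hf); rewrite e linear0.
- move=> z; have [I FI hI] := dense (f z); exists I => // a /hI[m _ mE].
  by exists m => //; rewrite etaE /= mE linearZ /= fh.
Qed.

(** The reflection of the direct sum. *)
Lemma coproduct_ex (A : eqType) (X : A -> C) : exists (Y : C)
  (j : forall i, hom (X i) Y), is_coproduct j.
Proof.
have [D [j [dj Dgen Dup]]] := gdsum_ex (fun i => und (X i)).
have [Y [eta [de ke dense]]] := refl_obj D.
have kex i : exists k : hom (X i) Y, forall x, act k x = eta (j i x).
  have [f fE] := lin_comp_ex (eta) (j i).
  have [k kE] : exists k : hom (X i) Y, act k =1 f.
    by apply: act_full => d x dx; rewrite fE; apply/de/dj.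
  by exists k => x; rewrite kE fE.
have /choice_dep[k kE] := kex.
exists Y, k => W f.
have [h [dh hE]] := Dup (und W) (fun i => act (f i)) (fun i => @act_deg _ _ _ _ (f i)).
have [|h' h'E] := @extend_dense D Y W eta h de dh dense.
  move=> m /ke tm; apply: (@und_tors W); apply/sat_preim.
  by apply: sat_mono tm => // x /= ->; rewrite linear0.
exists h'; split; first by move=> i; apply: act_inj => x; rewrite actM /= kE h'E hE.
move=> h'' hh; apply: (dense_epi dense) => m; move: m; apply: Dgen.
- by rewrite !linear0.
- by move=> x y e1 e2; rewrite !linearD e1 e2.
- by move=> i x; rewrite h'E hE -kE -[RHS](actM h'') hh.
Qed.

Lemma shift_obj X (t : G) : exists (X' : C) (f : {linear und X -> und X'}),
  bijective f /\ forall d x, gcmp d x <-> gcmp (d + t) (f x).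
Proof.
have [M [f [h [fh hf fd]]]] := gshift_ex (und X) t.
have cM := gclosed_shift fh hf fd (und_closed X).
have [X' [k [l [dk kl lk]]]] := und_surj cM.
have [f' f'E] : exists f' : {linear und X -> und X'}, f' =1 l \o f.
  by apply: lin_ex => /= [x y|a x]; rewrite ?linearD ?linearZ.
exists X', f'; split.
  by exists (h \o k) => x; rewrite ?f'E /= ?lk ?fh ?hf ?kl //= hf kl.
move=> d x; rewrite fd f'E /=; split=> [dx|/dk]; last by rewrite lk.
by apply: (inj_reflect_deg dk (can_inj kl)); rewrite lk.
Qed.

End ModcatTheory.

(** * Torsion classes and Gabriel filters *)

Section TorsionClasses.
Variables (g : grading) (C : modcat g).
Local Notation R := (gR g).
Local Notation G := (gG g).
Local Notation gmod := (gmod g).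
Local Notation rc := (@rc g).
Local Notation F := (mcF C).

Let gF : gabriel F := mcF_gab C.
Let dact (X Y : C) (f : hom X Y) : deg0 (act f) := @act_deg _ _ _ _ f.

(** The reflection of X / N. *)
Lemma quot_obj (X : C) (N : set (und X)) : homsub N -> sat F N `<=` N ->
  exists (Q : C) (q : hom X Q), (forall x, act q x = 0 <-> N x) /\
    forall z, sat F (range (act q)) z.
Proof.
move=> hN sN; have [M [p [dp pK pS]]] := gquo_ex hN.
have [Q [eta [de ke dense]]] := refl_obj C M.
have [f fE] := lin_comp_ex (eta) (p).
have [q qE] : exists q : hom X Q, act q =1 f.
  by apply: act_full => d x dx; rewrite fE; apply/de/dp.
exists Q, q; split=> [x|z]; last first.
  have [I FI h] := dense z; exists I => // a /h[m _ <-].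
  by have [x <-] := pS m; exists x => //; rewrite qE fE.
rewrite qE fE /= ke; split=> [[I FI h]|Nx].
  by apply: sN; exists I => // a Ia; apply/pK; rewrite linearZ; exact: h.
by move/pK: Nx => ->; have [[]] := tors_homsub gF M.
Qed.

(** The reflection of R / J and its generator, whose annihilator is the
    saturation of J. *)
Lemma cyclic_obj (J : set R) : hideal J -> exists (Z : C) (x : und Z),
  gcmp 0 x /\ forall a, a *: x = 0 <-> exists2 I, F I & forall b, I b -> J (b * a).
Proof.
move=> [[J0 JD JM] hJ].
have hN : homsub (J : set (regular_gmod g)) by split.
have [M [p [dp pK pS]]] := gquo_ex hN.
have [Z [eta [de ke dense]]] := refl_obj C M.
exists Z, (eta (p (1 : R^o))); split; first by apply/de/dp; exact: rc_one.
move=> a; rewrite -!linearZ ke; split=> -[I FI h]; exists I => // b Ib.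
  by have := h b Ib; rewrite /= -linearZ pK /GRing.scale /= mulr1.
by rewrite /= -linearZ pK /GRing.scale /= mulr1; exact: h.
Qed.

Definition shift_invariant (S : C -> Prop) : Prop :=
  forall (X X' : C) (t : G) (f : {linear und X -> und X'}), bijective f ->
    (forall d x, gcmp d x <-> gcmp (d + t) (f x)) -> S X -> S X'.

(** The reflection of R / I lies in S, expressed without that reflection: a
    cyclic module that is a shifted submodule of a member of S maps onto the
    quotient of R / I by its torsion. *)
Definition filter_of (S : C -> Prop) : set (set R) := [set I | hideal I /\
  exists T, S T /\ exists d (t : und T), gcmp d t /\
    forall a, a *: t = 0 -> exists2 J, F J & forall b, J b -> I (b * a)].

Section TorsionClass.
Variable S : C -> Prop.
Hypotheses (hS : torsion_class S) (shS : shift_invariant S).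

Lemma S_exact (X' X X'' : C) (f : hom X' X) (h : hom X X'') :
  injective (act f) -> range (act f) = [set x | act h x = 0] ->
  (forall z, sat F (range (act h)) z) -> S X <-> S X' /\ S X''.
Proof. by move=> fi fr d; apply: (hS.1 _ _ _ f h); apply/short_exactE; split. Qed.

Lemma S_zero (Z : C) : (forall x : und Z, x = 0) -> S Z.
Proof.
move=> Z0; have [_ cop] := hS.
apply: (cop void (fun v => match v with end) Z (fun v => match v with end)).
  by case.
move=> W f; have [k k0] := zero_hom_ex Z W; exists k; split; first by case.
by move=> k' _; apply: act_inj => x; rewrite (Z0 x) !linear0.
Qed.

Lemma S_sub (K X : C) (i : hom K X) : injective (act i) -> S X -> S K.
Proof.
move=> ii; have hr := range_homsub (dact i).
have [|Q [q [qK qd]]] := quot_obj hr.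
  by apply: closed_saturated => //; [exact: und_tors | exact: und_closed].
have /(S_exact ii)/(_ qd) h : range (act i) = [set x | act q x = 0].
  by apply/seteqP; split=> x /qK.
by move/h => [].
Qed.

Lemma S_dense (X Y : C) (f : hom X Y) : (forall z, sat F (range (act f)) z) ->
  S X -> S Y.
Proof.
move=> fd; have [K [i [ii ir]]] := sub_obj (ker_homsub (dact f)) (@ker_sat _ _ _ _ f).
by move/(S_exact ii ir fd) => [].
Qed.

(** The largest subobject in S: the saturated image of a coproduct of objects
    of S, one for each element of X that can be reached from S. *)
Lemma radical_ex (X : C) : exists N : set (und X),
  [/\ homsub N, sat F N `<=` N,
      exists (K : C) (i : hom K X), [/\ S K, injective (act i) & range (act i) = N]
    & forall (T : C) (f : hom T X), S T -> range (act f) `<=` N].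
Proof.
pose t : set (und X) := [set x | exists (T : C) (f : hom T X), S T /\ range (act f) x].
pose A : eqType := {x : und X | `[< t x >]}.
have Tex (x : A) : exists Tf : {T : C & hom T X},
    S (projT1 Tf) /\ range (act (projT2 Tf)) (sval x).
  by have /asboolP[T [f [ST fx]]] := svalP x; exists (existT _ T f).
have /choice[T hT] := Tex.
have [Y [j jY]] := coproduct_ex (fun x : A => projT1 (T x)).
have SY : S Y.
  by apply: (hS.2 A _ Y j) => // x; case: (hT x).
have [h [hE _]] := jY X (fun x => projT2 (T x)).
have hr := range_homsub (dact h).
have th x : t x -> range (act h) x.
  move=> tx; pose a : A := exist _ x (asboolT tx).
  have [_ [y _ /= <-]] := hT a; rewrite -(hE a); exists (act (j a) y) => //.
  by rewrite actM.
have [K [i [ii ir]]] := sub_obj (sat_homsub gF hr) (sat_sat gF hr).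
have hN := sat_homsub gF hr.
exists (sat F (range (act h))); split=> //.
- exact: sat_sat.
- exists K, i; split=> //.
  have [|v vE] := @factor_inj _ _ _ _ _ i h ii; first by rewrite ir; exact: sat_in.
  apply: (S_dense (f := v)) SY => k.
  have [I FI hI] : sat F (range (act h)) (act i k) by rewrite -ir; exists k.
  exists I => // a /hI[y _ e]; exists y => //; apply: ii.
  by rewrite -[LHS](actM i) vE e linearZ.
- move=> T' f ST _ [y _ <-]; apply: homsub_pr_in => // d.
  rewrite (pr_deg0 (dact f)); apply: sat_in => //; apply: th.
  by exists T', f; split=> //; exists ('pr_d y).
Qed.

(** The preimage in X of the saturated image of a map from S is an extension
    of objects of S, so it lies in the radical. *)
Lemma radical_quot (X Q : C) (N : set (und X)) (q : hom X Q) :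
  homsub N -> sat F N `<=` N ->
  (exists (K : C) (i : hom K X), [/\ S K, injective (act i) & range (act i) = N]) ->
  (forall (T : C) (f : hom T X), S T -> range (act f) `<=` N) ->
  (forall x, act q x = 0 <-> N x) -> (forall z, sat F (range (act q)) z) ->
  forall (T : C) (f : hom T Q), S T -> forall y, act f y = 0.
Proof.
move=> hN sN [K [i [SK ii ir]]] Nmax qK qd T f ST.
have hf := range_homsub (dact f).
pose L := sat F (range (act f)).
have hL : homsub L by exact: sat_homsub.
have [T' [l [li lr]]] := sub_obj hL (sat_sat gF hf).
have [|v vE] := @factor_inj _ _ _ _ _ l f li; first by rewrite lr; exact: sat_in.
have ST' : S T'.
  apply: (S_dense (f := v)) ST => k.
  have [I FI hI] : L (act l k) by rewrite -lr; exists k.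
  exists I => // a /hI[y _ e]; exists y => //; apply: li.
  by rewrite -[LHS](actM l) vE e linearZ.
have hX1 : homsub (act q @^-1` L) by exact: preim_homsub (dact q) _ hL.
have [|K1 [i1 [i1i i1r]]] := sub_obj hX1.
  move=> x sx; have {}sx : sat F L (act q x) by apply/sat_preim.
  exact: (sat_sat gF hf sx).
have [|u uE] := @factor_inj _ _ _ _ _ l (q \oc i1) li.
  move=> _ [k _ <-]; rewrite lr actM.
  by have : (act q @^-1` L) (act i1 k) by rewrite -i1r; exists k.
have [|w wE] := @factor_inj _ _ _ _ _ i1 i i1i.
  move=> x; rewrite ir i1r => /qK qx; rewrite /= qx.
  by have [[L0 _ _] _] := hL.
have SK1 : S K1.
  apply/(S_exact (f := w) (h := u)); last by split.
  - by move=> x y e; apply: ii; rewrite -wE !actM e.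
  - apply/seteqP; split=> [_ [x _ <-]|k /= uk].
      apply: li; rewrite linear0 -[LHS](actM l) uE actM -[act i1 _]actM wE.
      by apply/qK; rewrite -ir; exists x.
    have /qK : act q (act i1 k) = 0 by rewrite -actM -uE actM uk linear0.
    rewrite -ir => -[x _ e]; exists x => //; apply: i1i.
    by rewrite -[LHS](actM i1) wE.
  - move=> z; have [I FI hI] := qd (act l z); exists I => // a /hI[x _ e].
    have [k _ kx] : range (act i1) x.
      rewrite i1r /= e -linearZ /=; rewrite -/(range _) -lr; by exists (a *: z).
    by exists k => //; apply: li; rewrite -[LHS](actM l) uE actM kx e linearZ.
have sX1 : act q @^-1` L `<=` N by rewrite -i1r; exact: Nmax.
move=> y; apply: (@und_tors _ C Q); have [I FI hI] := qd (act f y).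
exists I => // a /hI[x _ e] /=; rewrite -e; apply/qK/sX1 => /=.
rewrite e; apply: sat_in => //; exists (a *: y) => //; exact: linearZ.
Qed.

(** A shift brings t to the degree of x. The saturated cyclic subobject on t
    is in S because T is, and it maps to X with t going to x because X is
    closed. *)
Lemma cyclic_cover (T X : C) d e (t : und T) (x : und X) : S T -> gcmp d t ->
  gcmp e x -> (forall a, a *: t = 0 -> a *: x = 0) ->
  exists (T1 : C) (f : hom T1 X), S T1 /\ range (act f) x.
Proof.
move=> ST dt ex ann; have [T' [k [kb kd]]] := shift_obj T (e - d).
have ST' : S T' by apply: shS kb kd ST.
have ki : injective k by exact: bij_inj.
pose t' := k t.
have et' : gcmp e t' by rewrite -[e](subrK d) addrC; apply/kd.
have ann' a : a *: t' = 0 -> a *: x = 0.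
  by move=> at0; apply: ann; apply: ki; rewrite linear0 linearZ.
pose N0 : set (und T') := [set y | exists a, y = a *: t'].
have hN0 : homsub N0.
  split; last first.
    move=> d' _ [a ->]; exists (gpr (rc_sum g) (d' - e) a).
    by rewrite -(pr_scale _ _ et') subrK.
  split; first by exists 0; rewrite scale0r.
    by move=> _ _ [a ->] [b ->]; exists (a + b); rewrite scalerDl.
  by move=> b _ [a ->]; exists (b * a); rewrite scalerA.
have [T1 [i [ii ir]]] := sub_obj (sat_homsub gF hN0) (sat_sat gF hN0).
have [|||||h [dh hE]] := @closed_extend g F (und T1) (und X)
    (fun z w => exists2 a, act i z = a *: t' & w = a *: x) gF (und_closed X).
- move=> z _ z' _ [a e1 ->] [b e2 ->]; exists (a + b); last by rewrite scalerDl.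
  by rewrite linearD e1 e2 scalerDl.
- move=> b z _ [a e1 ->]; exists (b * a); last by rewrite scalerA.
  by rewrite linearZ /= e1 scalerA.
- move=> d' z _ [a e1 ->]; exists (gpr (rc_sum g) (d' - e) a).
    by rewrite -(pr_deg0 (dact i)) e1 -(pr_scale _ _ et') subrK.
  by rewrite -(pr_scale _ _ ex) subrK.
- by move=> w [a]; rewrite linear0 => /esym/ann' e1 ->.
- move=> z; have [I FI hI] : sat F N0 (act i z) by rewrite -ir; exists z.
  by exists I => // a /hI[b e1]; exists (b *: x), b => //; rewrite linearZ.
have [f fE] := act_full dh.
have [z _ zt] : range (act i) t'.
  by rewrite ir; apply: sat_in => //; exists 1; rewrite scale1r.
exists T1, f; split; first exact: (S_sub ii).
by exists z => //; rewrite fE; apply: hE; exists 1; rewrite scale1r.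
Qed.

Lemma sub_filter_of : F `<=` filter_of S.
Proof.
move=> I FI; split; first exact: (gab_ideal gF FI).
have [Z Z0] := zero_obj_ex C; exists Z; split; first exact: S_zero.
exists 0, 0; split; first exact: gcmp0.
have [[_ _ IM] _] := gab_ideal gF FI.
by move=> a _; exists I => // b Ib; rewrite mulrC; exact: IM.
Qed.

Lemma filter_cover (X : C) I d (x : und X) : filter_of S I -> gcmp d x ->
  (forall a, I a -> a *: x = 0) ->
  exists (T1 : C) (f : hom T1 X), S T1 /\ range (act f) x.
Proof.
move=> [_ [T [ST [e [t [et h]]]]]] dx Ix; apply: (cyclic_cover ST et dx) => a /h[J FJ hJ].
by apply: (@und_tors _ C X); exists J => // b /hJ/Ix; rewrite /= scalerA.
Qed.

(** Locality: let x generate the reflection Z of R / J and let N be the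
    radical of Z. The hypothesis puts I x inside N, so I kills the image of x
    in the reflection of Z / N. That image is therefore reached from S, hence
    zero. So x lies in N, which is in S, and its annihilator is the saturation
    of J. *)
Lemma filter_of_gabriel : gabriel (filter_of S).
Proof.
split.
- by move=> I [].
- by apply: sub_filter_of; exact: gab_full.
- move=> I J [hI [T [ST [d [t [dt h]]]]]] hJ sIJ; split=> //; exists T; split=> //.
  by exists d, t; split=> // a /h[L FL hL]; exists L => // b /hL/sIJ.
move=> I J FI hJ loc; split=> //.
have [Z [x [dx xJ]]] := cyclic_obj hJ.
have [N [hN sN NK Nmax]] := radical_ex Z.
have [Q [q [qK qd]]] := quot_obj hN sN.
have Ix a : I a -> N (a *: x).
  have [[N0 ND _] _] := hN.
  move: a; apply: (hideal_ind FI.1); first by rewrite scale0r.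
    by move=> a b; rewrite scalerDl; exact: ND.
  move=> e a ea Ia.
  have eax : gcmp (e + 0) (a *: x) by exact: gscal.
  have [b Jba|T1 [f [ST1 fx]]] := filter_cover (loc e a ea Ia) eax.
    rewrite scalerA; apply/xJ; exists setT; first exact: gab_full.
    by move=> c _; have [[_ _ JM] _] := hJ; exact: JM.
  exact: Nmax ST1 _ fx.
have [a Ia|T1 [f [ST1 [y _ fy]]]] := filter_cover FI (dact q dx).
  by rewrite -linearZ; apply/qK; exact: Ix.
have /qK : act q x = 0.
  by rewrite -fy; exact: (radical_quot hN sN NK Nmax qK qd).
have [K [i [SK ii <-]]] := NK; move=> [k _ kx].
exists K; split=> //; exists 0, k; split.
  by apply: (inj_reflect_deg (dact i) ii); rewrite kx.
by move=> a ak; apply/xJ; rewrite -kx -linearZ ak linear0.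
Qed.

(** If every element of X is torsion, every element is reached from S, and the
    radical is everything. *)
Lemma S_char (X : C) : S X <-> forall x : und X, sat (filter_of S) [set 0] x.
Proof.
have gS := filter_of_gabriel; split=> [SX x|tX].
  apply: homsub_pr_in; first exact: (tors_homsub gS).
  move=> d; have dx := gprP (gsum (und X)) d x.
  exists (annihilator ('pr_d x)) => //; split; first exact: hideal_annihilator dx.
  exists X; split=> //; exists d, ('pr_d x); split=> // a ax.
  exists setT; first exact: gab_full.
  by move=> b _; rewrite /annihilator /= -scalerA ax scaler0.
have [N [hN sN [K [i [SK ii ir]]] Nmax]] := radical_ex X.
apply: (S_dense (f := i)) SK => x; apply: (sat_in gF); first exact: (range_homsub (dact i)).
rewrite ir; apply: homsub_pr_in => // d.
have [I FI Ix] := tX ('pr_d x).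
have [T1 [f [ST1 fx]]] := filter_cover FI (gprP (gsum (und X)) d x) Ix.
exact: Nmax ST1 _ fx.
Qed.

(** From left to right, the envelope of X is an extension of X by an object of
    S; it splits, and the envelope is torsion-free, so it is X. From right to
    left, the identity of X extends to any extension of X by a member of S,
    and this splits the extension. *)
Lemma closed_objectE (X : C) : closed_object S X <-> gclosed (filter_of S) (und X).
Proof.
have gS := filter_of_gabriel; split=> [cX|[tX cX] T ST]; last first.
  have zT (W : C) (h : hom T W) : torsfree (filter_of S) (und W) -> forall z, act h z = 0.
    move=> tW z; apply: tW; apply/sat_preim; have /S_char/(_ z) := ST.
    by apply: sat_mono => // x /= ->; rewrite linear0.
  split=> [h|E f q se]; first by apply/zero_mor; exact: zT.
  have [fi fr qd] := (short_exactE f q).1 se.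
  have [|||||r [dr rE]] := @closed_extend g _ (und E) (und X) (fun z w => act f w = z)
      gS (conj tX cX).
  - by move=> z w z' w' <- <-; rewrite linearD.
  - by move=> a z w <-; rewrite linearZ.
  - by move=> d z w <-; rewrite pr_deg0.
  - by move=> w fw; apply: fi; rewrite fw linear0.
  - move=> z; have [I FI hI] := (S_char T).1 ST (act q z); exists I => // a Ia.
    have [w _ wE] : range (act f) (a *: z).
      by rewrite fr /= linearZ; exact: hI.
    by exists w.
  have [p0 p0E] : exists p : {linear und E -> und E}, forall z, p z = z - act f (r z).
    apply: lin_ex => [x y|a x]; first by rewrite !linearD /= ?opprD addrACA.
    by rewrite !linearZ /= scalerDr scalerN.
  have [p pE] : exists p : hom E E, act p =1 p0.
    by apply: act_full => d z dz; rewrite p0E; apply: gcmpB => //; apply/dact/dr.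
  have [|u [uE _]] := se.2.2 E p.
    by apply/zero_mor => x; rewrite actM pE p0E (rE _ x) // subrr.
  exists u; apply: (dense_epi qd) => z.
  rewrite act1 actM -[act u _]actM uE pE p0E linearB /=.
  suff -> : act q (act f (r z)) = 0 by rewrite subr0.
  by suff : [set x | act q x = 0] (act f (r z)) by []; rewrite -fr; exists (r z).
have tX : torsfree (filter_of S) (und X).
  have hN := tors_homsub gS (und X).
  have [|K [i [ii ir]]] := sub_obj hN.
    move=> x sx; apply: (sat_sat gS (homsub0 _)).
    by apply: sat_mono sx => //; exact: sub_filter_of.
  have SK : S K.
    apply/S_char => k; have [I FI hI] : (tors (filter_of S) : set (und X)) (act i k).
      by rewrite -ir; exists k.
    by exists I => // a Ia; apply: ii; rewrite linear0 linearZ; exact: hI.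
  have [/(_ i) /zero_mor i0 _] := cX K SK.
  by move=> x; rewrite -ir => -[k _ <-].
have [E0 [j [cE0 dj ji jd]]] := envelope_ex gS tX.
have [E [k [l [dk kl lk]]]] := und_surj (gclosed_sub sub_filter_of cE0).
have cE : gclosed (filter_of S) (und E).
  apply: (closed_sub (i := k) gS) => //; first exact: can_inj kl.
  by move=> x _; exists (l x).
have [f0 f0E] := lin_comp_ex (l) (j).
have [f fE] : exists f : hom X E, act f =1 f0.
  apply: act_full => d x dx; apply: (inj_reflect_deg dk (can_inj kl)).
  by rewrite f0E /= lk; exact: dj.
have fi : injective (act f).
  by move=> x y; rewrite !fE !f0E /= => /(can_inj lk)/ji.
have [|T [q [qK qd]]] := quot_obj (range_homsub (dact f)).
  by apply: closed_saturated => //; [exact: und_tors | exact: und_closed].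
have ST : S T.
  apply/S_char => z; apply: (sat_sat gS (homsub0 _)).
  have [I FI hI] := qd z; exists I; first exact: sub_filter_of.
  move=> a /hI[e _ <-]; apply/sat_preim.
  have [J FJ hJ] := jd (k e); exists J => // b /hJ[x _ e1].
  by apply/qK; exists x => //; rewrite fE f0E /= e1 linearZ /= kl.
have [_ /(_ E f q)] := cX T ST; case.
  by apply/short_exactE; split=> //; apply/seteqP; split=> x /qK.
move=> s sE; apply: (closed_sub gS (dact f) fi) => // e _; apply/qK.
rewrite -[act q e](act1 (m := C)) -sE actM.
suff -> : act s (act q e) = 0 by rewrite linear0.
have [tE _] := cE; apply: tE; apply/sat_preim.
by apply: sat_mono ((S_char T).1 ST _) => // x /= ->; rewrite linear0.
Qed.

End TorsionClass.
End TorsionClasses.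

(** * Finite type and finitely generated filters *)

(** [s] lists generators of a member of the filter that is contained in
    [I]. *)
Definition fg_based (g : grading) (F : set (set (gR g))) : Prop :=
  forall I, F I -> exists s : seq (gR g),
    (forall a, a \in s -> hom_elt a /\ I a) /\
    forall J, hideal J -> (forall a, a \in s -> J a) -> F J.

Lemma directed_seq (A B : Type) (E : eqType) (N : A -> set B) (f : E -> B) (s : seq E) :
  (exists i : A, True) -> (forall i j, exists k, N i `<=` N k /\ N j `<=` N k) ->
  (forall b, b \in s -> (\bigcup_i N i) (f b)) ->
  exists k, forall b, b \in s -> N k (f b).
Proof.
move=> [i0 _] dir; elim: s => [|b s IH] h; first by exists i0.
have [k hk] : exists k, forall b, b \in s -> N k (f b).
  by apply: IH => c cs; apply: h; rewrite inE cs orbT.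
have [j _ hj] := h b (mem_head _ _).
have [l [sj sk]] := dir j k; exists l => c; rewrite inE => /orP[/eqP->|/hk/sk //].
exact: sj.
Qed.

Section DirectedSums.
Variables (g : grading) (C : modcat g).
Local Notation F := (mcF C).

Let gF : gabriel F := mcF_gab C.
Let dact (X Y : C) (f : hom X Y) : deg0 (act f) := @act_deg _ _ _ _ f.

Lemma directed_homsub (M : gmod g) (I : Type) (N : I -> set M) :
  (exists i : I, True) -> (forall i j, exists k, N i `<=` N k /\ N j `<=` N k) ->
  (forall i, homsub (N i)) -> homsub (\bigcup_i N i).
Proof.
move=> [i0 _] dir hN; split; last first.
  by move=> d x [i _ Nx]; exists i => //; case: (hN i) => _; apply.
split; first by exists i0 => //; case: (hN i0) => [[]].
  move=> x y [i _ Nx] [j _ Ny]; have [k [si sj]] := dir i j; exists k => //.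
  by case: (hN k) => [[_ ND _] _]; apply: ND; auto.
by move=> a x [i _ Nx]; exists i => //; case: (hN i) => [[_ _ NZ] _]; exact: NZ.
Qed.

Lemma directed_range (I : Type) (X : C) (U : I -> C) (u : forall i, hom (U i) X) :
  directed_subobjects u ->
  forall i j, exists k, range (act (u i)) `<=` range (act (u k)) /\
    range (act (u j)) `<=` range (act (u k)).
Proof.
move=> [_ _ dir] i j; have [k [[v vE] [w wE]]] := dir i j; exists k; split.
  by move=> _ [x _ <-]; exists (act v x) => //; rewrite -actM vE.
by move=> _ [x _ <-]; exists (act w x) => //; rewrite -actM wE.
Qed.

(** Subobjects are saturated submodules; directedness makes the union a
    submodule. *)
Lemma sum_of_subobjectsE (I : Type) (X : C) (U : I -> C) (u : forall i, hom (U i) X)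
    (Y : C) (y : hom Y X) : directed_subobjects u ->
  is_sum_of_subobjects u y <-> injective (act y) /\
    range (act y) = sat F (\bigcup_i range (act (u i))).
Proof.
move=> du; have [um ne _] := du; have dr := directed_range du.
have hU : homsub (\bigcup_i range (act (u i))).
  by apply: directed_homsub => // i; exact: range_homsub (dact (u i)).
split=> [[my yu ymin]|[yi yr]]; last first.
  split; first exact/monicE.
    move=> i; apply: factor_inj => // z uz; rewrite yr; apply: sat_in => //.
    by exists i.
  move=> W w /monicE wi wu; apply: factor_inj => // z; rewrite yr => sz.
  apply: (closed_saturated gF (dact w) wi (@und_tors _ C X) (und_closed W)).
  apply: sat_mono sz => // x [i _ [t _ <-]].
  by have [v <-] := wu i; exists (act v t) => //; rewrite actM.
have yi : injective (act y) by exact/monicE.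
split=> //; apply/seteqP; split; last first.
  move=> x sx.
  apply: (closed_saturated gF (dact y) yi (@und_tors _ C X) (und_closed Y)).
  apply: sat_mono sx => // z [i _ [t _ <-]].
  by have [v <-] := yu i; exists (act v t) => //; rewrite actM.
have [K [k [ki kr]]] := sub_obj (sat_homsub gF hU) (sat_sat gF hU).
have [||v vE] := ymin K k; first exact/monicE.
  move=> i; apply: factor_inj => // z uz; rewrite kr; apply: sat_in => //.
  by exists i.
by move=> _ [t _ <-]; rewrite -vE actM -kr; exists (act v t).
Qed.

End DirectedSums.

Section QuotientModcat.
Variables (g : grading) (C : modcat g) (S : C -> Prop).
Hypotheses (hS : torsion_class S) (shS : shift_invariant S).
Local Notation F := (mcF C).

Lemma quot_modcat_closed (X : quotient_category S) :
  gclosed (filter_of S) (und (sval X)).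
Proof. by apply/closed_objectE => //; exact: (svalP X). Qed.

Lemma quot_modcat_surj (N : gmod g) : gclosed (filter_of S) N ->
  exists (X : quotient_category S) (f : {linear und (sval X) -> N})
    (h : {linear N -> und (sval X)}), [/\ deg0 f, cancel f h & cancel h f].
Proof.
move=> cN; have [X [f [h [df fh hf]]]] := und_surj (gclosed_sub (sub_filter_of hS) cN).
have cX : closed_object S X.
  apply/closed_objectE => //.
  apply: (closed_sub (i := f) (filter_of_gabriel hS shS)) => //.
    exact: can_inj fh.
  by move=> x _; exists (h x).
by exists (exist _ X cX), f, h.
Qed.

(** The description of monomorphisms and of joins thus applies to C / S
    too. *)
Definition quot_modcat : modcat g :=
  @ModCat g (quotient_category S) (filter_of S) (filter_of_gabriel hS shS)
    (fun X => und (sval X)) (fun X Y f => act (f : hom (sval X) (sval Y)))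
    (fun X Y f => @act_deg g C _ _ f) (fun X Y f h => @act_inj g C _ _ f h)
    (fun X Y f => @act_full g C _ _ f) (fun X => @act1 g C (sval X))
    (fun X Y Z h f => @actM g C _ _ _ h f) quot_modcat_closed quot_modcat_surj.

Local Notation D := quot_modcat.

Lemma directed_incl (I : Type) (X : D) (U : I -> D) (u : forall i, hom (U i) X) :
  directed_subobjects u ->
  directed_subobjects (fun i => Defs.fmap (inclusion (closed_object S)) (u i)).
Proof.
move=> [um ne dir]; split=> // i; apply/(@monicE g C).
exact: ((@monicE g D _ _ (u i)).1 (um i)).
Qed.

(** With finitely generated ideals cofinal in the filter, a directed union of
    saturated submodules is saturated, hence is already the sum in the quotient. *)
Lemma fg_based_finite_type : fg_based (filter_of S) -> finite_type S.
Proof.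
move=> fg I X U u du Y y sy.
have [yi yr] := (@sum_of_subobjectsE g D I X U u Y y du).1 sy.
apply/(@sum_of_subobjectsE g C I _ _ _ _ _ (directed_incl du)); split; first exact: yi.
have gS := filter_of_gabriel hS shS.
rewrite [LHS]yr /=.
have dr := @directed_range g D _ _ _ u du; have [_ ne _] := du.
have hU : homsub (\bigcup_i range (act (m := D) (u i))).
  by apply: directed_homsub => // i; exact: range_homsub (@act_deg _ D _ _ (u i)).
apply/seteqP; split; last by apply: sat_mono => //; exact: sub_filter_of.
move=> x sx; apply: homsub_pr_in; first exact: (sat_homsub (mcF_gab C) hU).
move=> d; apply: (sat_in (mcF_gab C) hU).
have dx := gprP (gsum (und (sval X))) d x.
have [J FJ hJ] : sat (filter_of S) (\bigcup_i range (act (m := D) (u i)))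
    (gpr (gsum (und (sval X))) d x).
  by case: (sat_homsub gS hU) => _; apply.
have [s [sJ sF]] := fg J FJ.
have [k hk] := @directed_seq _ _ _ (fun i => range (act (m := D) (u i)))
  (fun b => b *: gpr (gsum (und (sval X))) d x) s ne dr (fun b bs => hJ b (sJ b bs).2).
exists k => //.
have hr := range_homsub (@act_deg _ D _ _ (u k)).
apply: (closed_saturated gS (@act_deg _ D _ _ (u k)) ((@monicE g D _ _ (u k)).1 _)).
- by case: du.
- exact: (@und_tors _ D X).
- exact: (@und_closed _ D (U k)).
- exists [set a | range (act (m := D) (u k)) (a *: gpr (gsum (und (sval X))) d x)] => //.
  by apply: sF => //; exact: hideal_transporter dx.
Qed.

(** Suppose that no finitely generated ideal inside I is in the filter. For
    each finite list s in I choose an ideal J s outside the filter that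
    contains s; the reflection of R / J s is nonzero, with generator x s. In
    the product of these reflections, I multiplies x into the directed union
    of the submodules N s of the families that vanish at all t containing s.
    By finite type a member of the filter of C, hence a finite list,
    multiplies x into this union, hence into one N s; so x s is torsion, a
    contradiction. *)
Lemma finite_type_fg_based : fg_based F -> finite_type S -> fg_based (filter_of S).
Proof.
move=> fgF ft I FI; apply: contrapT => nfg.
have gS := filter_of_gabriel hS shS.
pose A := {s : seq (gR g) | forall a, a \in s -> hom_elt a /\ I a}.
have Jex (s : A) : exists J, [/\ hideal J, forall a, a \in sval s -> J a & ~ filter_of S J].
  apply: contrapT => nJ; apply: nfg; exists (sval s); split; first exact: (svalP s).
  move=> J hJ sJ; apply: contrapT => nFJ; apply: nJ; by exists J.
have /choice[J hJ] := Jex.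
have Zex (s : A) : exists (Z : {Z : D & und Z}), gcmp 0 (projT2 Z) /\
    forall a, a *: projT2 Z = 0 <->
      exists2 I, filter_of S I & forall b, I b -> J s (b * a).
  have [h _ _] := hJ s; have [Z [x hx]] := @cyclic_obj g D _ h.
  by exists (existT _ Z x).
have /choice[Z hZ] := Zex.
have Znz s : projT2 (Z s) <> 0.
  move=> Z0; have [hJs _] := hJ s; apply; have [_ /(_ 1)] := hZ s.
  rewrite scale1r => -[/(_ Z0)[L FL hL] _].
  by apply: (gab_up gS FL hJs) => b /hL; rewrite mulr1.
have [P [p [dp pinj plift]]] := gprod_ex (fun s => und (projT1 (Z s))).
have cP : gclosed (filter_of S) P.
  by apply: gprod_closed dp pinj plift _ => s; exact: (und_closed (projT1 (Z s))).
have [X [f [h [df fh hf]]]] := @und_surj g D P cP.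
have [x0 dx0 x0E] := plift 0 (fun s => projT2 (Z s)) (fun s => (hZ s).1).
pose x := h x0.
pose N (s : A) : set (und X) :=
  [set z | forall t : A, {subset sval s <= sval t} -> p t (f z) = 0].
have hN s : homsub (N s).
  split; last first.
    by move=> d z Nz t st; rewrite -(pr_deg0 df) -(pr_deg0 (dp t)) Nz // gpr0.
  split; first by move=> t st; rewrite !linear0.
    by move=> z w Nz Nw t st; rewrite !linearD /= Nz // Nw // addr0.
  by move=> a z Nz t st; rewrite !linearZ /= Nz // scaler0.
have sN s : sat (filter_of S) (N s) `<=` N s.
  move=> z [L FL hL] t st; apply: (@und_tors _ D (projT1 (Z t))); exists L => // a La.
  by have := hL a La t st; rewrite /= !linearZ.
have Uex (s : A) : exists U : {U : D & hom U X},
    injective (act (projT2 U)) /\ range (act (projT2 U)) = N s.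
  have [U [u hu]] := @sub_obj g D X (N s) (hN s) (sN s).
  by exists (existT _ U u).
have /choice[U hU] := Uex.
have Nsub s t : {subset sval s <= sval t} -> N s `<=` N t.
  by move=> st z Nz r tr; apply: Nz => a /st/tr.
have nilA : A by exists [::].
have catA (s t : A) : exists r : A, {subset sval s <= sval r} /\ {subset sval t <= sval r}.
  have hr a : a \in sval s ++ sval t -> hom_elt a /\ I a.
    by rewrite mem_cat => /orP[/(svalP s)|/(svalP t)].
  by exists (exist _ _ hr); split=> a /=; rewrite mem_cat => ->; rewrite ?orbT.
have dirN s t : exists r, N s `<=` N r /\ N t `<=` N r.
  by have [r [? ?]] := catA s t; exists r; split; exact: Nsub.
have du : directed_subobjects (fun s => projT2 (U s)).
  split; first by move=> s; apply/(@monicE g D); case: (hU s).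
    by exists nilA.
  move=> s t; have [r [? ?]] := dirN s t; exists r.
  have [ri rr] := hU r; have [_ sr] := hU s; have [_ tr] := hU t.
  by split; apply: (@factor_inj g D) => //; rewrite rr ?sr ?tr.
have UE : \bigcup_s range (act (projT2 (U s))) = \bigcup_s N s.
  by apply/seteqP; split=> z [s _ hz]; exists s => //; move: hz; case: (hU s) => _ ->.
have hUN : homsub (\bigcup_s N s) by apply: directed_homsub => //; exists nilA.
have [Y [y [yi yr]]] := @sub_obj g D X _ (sat_homsub gS hUN) (sat_sat gS hUN).
have sy : is_sum_of_subobjects (fun s => projT2 (U s)) y.
  by apply/(@sum_of_subobjectsE g D _ _ _ _ _ _ du); rewrite UE.
have [_ yr'] := (@sum_of_subobjectsE g C _ _ _ _ _ _ (directed_incl du)).1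
  (ft _ _ _ _ du _ _ sy).
have dx : gcmp 0 x.
  by apply: (inj_reflect_deg df (can_inj fh)); rewrite /x hf.
have Ix : sat (filter_of S) (\bigcup_s N s) x.
  exists I => //; have [[U0 UD _] _] := hUN.
  apply: (hideal_ind FI.1); first by rewrite scale0r.
    by move=> a b; rewrite scalerDl; exact: UD.
  move=> e a ea Ia.
  have ha b : b \in [:: a] -> hom_elt b /\ I b.
    by rewrite inE => /eqP->; split=> //; exists e.
  exists (exist _ _ ha) => // t st; rewrite linearZ /= /x hf linearZ /= x0E.
  apply/(hZ t).2; have [hJt tJ _] := hJ t; exists setT; first exact: gab_full.
  move=> b _; have [[_ _ JM] _] := hJt; apply: JM; apply: tJ; apply: st.
  exact: mem_head.
have [L FL hL] : sat F (\bigcup_s N s) x.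
  by rewrite -UE -[sat F _]yr' [range _]yr.
have [s [sL sF]] := fgF L FL.
have [k hk] := @directed_seq _ _ _ N (fun b => b *: x) s (ex_intro _ nilA Logic.I) dirN
  (fun b bs => hL b (sL b bs).2).
apply: (Znz k); apply: (@und_tors _ D (projT1 (Z k))).
exists (annihilator (projT2 (Z k))) => //.
apply: sub_filter_of => //; apply: sF; first exact: (hideal_annihilator (hZ k).1).
move=> b bs; have := hk b bs k (fun _ => id).
by rewrite linearZ /= /x hf linearZ /= x0E.
Qed.

End QuotientModcat.

Section FilterTorsion.
Variables (g : grading) (C : modcat g) (Fl : set (set (gR g))).
Local Notation F := (mcF C).
Hypotheses (gFl : gabriel Fl) (sF : F `<=` Fl).
Let gF : gabriel F := mcF_gab C.
Let dact (X Y : C) (f : hom X Y) : deg0 (act f) := @act_deg _ _ _ _ f.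

Definition torsion_of (X : C) : Prop := forall x : und X, tors Fl x.

Lemma tors_map (M N : gmod g) (f : {linear M -> N}) x : tors Fl x -> tors Fl (f x).
Proof.
by move=> tx; apply/sat_preim; apply: sat_mono tx => // y /= ->; rewrite linear0.
Qed.

(** Applied when Y has a universal property: the maps that define Y factor
    through its torsion part, whose inclusion is then split epi. *)
Lemma torsion_retract (Y : C) :
  (forall (K : C) (i : hom K Y), injective (act i) ->
     range (act i) = (tors Fl : set (und Y)) ->
     exists r : hom Y K, i \oc r = idm Y) -> torsion_of Y.
Proof.
move=> h x; have ht := tors_homsub gFl (und Y).
have [|K [i [ii ir]]] := sub_obj ht.
  by move=> y sy; apply: (sat_sat gFl (homsub0 _)); apply: sat_mono sy.
have [r rE] := h K i ii ir.
rewrite -[sat _ _]ir; exists (act r x) => //.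
by rewrite -actM rE act1.
Qed.

Lemma torsion_of_class : torsion_class torsion_of.
Proof.
split.
  move=> X' X X'' f h /short_exactE[fi fr hd]; split=> [tX|[tX' tX''] x].
    split=> [x|z].
      have [I FI hI] := tX (act f x); exists I => // a Ia.
      by apply: fi; rewrite linear0 linearZ; exact: hI.
    apply: (sat_sat gFl (homsub0 _)); have [I FI hI] := hd z; exists I; first exact: sF.
    by move=> a /hI[x _ <-]; exact: tors_map.
  apply: (sat_sat gFl (homsub0 _)); have [I FI hI] := tX'' (act h x); exists I => // a Ia.
  have [y _ <-] : range (act f) (a *: x) by rewrite fr /= linearZ; exact: hI.
  exact: tors_map.
move=> I X Y inj tX cY; apply: torsion_retract => K i ii ir.
have /choice_dep[k kE] j : exists k : hom (X j) K, i \oc k = inj j.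
  apply: factor_inj => // _ [x _ <-]; rewrite ir; apply: tors_map; exact: tX.
have [r [rE _]] := cY K k; exists r.
have [w [_ wu]] := cY Y inj.
rewrite -(wu (i \oc r)); last by move=> j; rewrite -cmpA rE.
by rewrite (wu (idm Y)) // => j; rewrite cmp1m.
Qed.

Lemma torsion_of_shift : shift_invariant torsion_of.
Proof. by move=> X X' t f [h fh hf] _ tX x; rewrite -[x]hf; exact: tors_map. Qed.

Lemma filter_of_torsion : filter_of torsion_of = Fl.
Proof.
apply/seteqP; split=> I.
  move=> [hI [T [tT [d [t [dt h]]]]]]; have [J FJ hJ] := tT t.
  apply: (gab_local gFl FJ) => // e a ea Ja; have [L FL hL] := h a (hJ a Ja).
  by apply: (gab_up gFl (sF FL)) => //; exact: hideal_colon ea.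
move=> FI; have hI := gab_ideal gFl FI; split=> //.
have [Z [x [dx xI]]] := cyclic_obj C hI.
have [|T [i [ii ir]]] := sub_obj (tors_homsub gFl (und Z)).
  by move=> y sy; apply: (sat_sat gFl (homsub0 _)); apply: sat_mono sy.
have [t _ tx] : range (act i) x.
  rewrite ir; exists I => // a Ia; apply/xI; exists setT; first exact: gab_full.
  by move=> b _; have [[_ _ IM] _] := hI; exact: IM.
exists T; split.
  move=> y; have [J FJ hJ] : (tors Fl : set (und Z)) (act i y) by rewrite -ir; exists y.
  by exists J => // a Ja; apply: ii; rewrite linear0 linearZ; exact: hJ.
exists 0, t; split; first by apply: (inj_reflect_deg (dact i) ii); rewrite tx.
by move=> a at0; apply/xI; rewrite -tx -linearZ at0 linear0.
Qed.

End FilterTorsion.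

(** * Filters and sets of primes *)

Section PrimesAndFilters.
Variable g : grading.
Local Notation R := (gR g).
Local Notation rc := (@rc g).

Lemma hom_one : hom_elt (1 : R).
Proof. by exists 0; exact: rc_one. Qed.

Lemma hom_mul (a b : R) : hom_elt a -> hom_elt b -> hom_elt (a * b).
Proof. by move=> [d da] [e eb]; exists (d + e); exact: rc_mul. Qed.

Lemma hideal_colon_hom (J : set R) a : hideal J -> hom_elt a -> hideal [set b | J (b * a)].
Proof. by move=> hJ [e ea]; exact: hideal_colon ea. Qed.

Lemma hideal_hom_notin (I P : set R) : hideal I -> ideal P -> ~ I `<=` P ->
  exists a, [/\ hom_elt a, I a & ~ P a].
Proof.
move=> hI [P0 PD _] nIP; apply: contrapT => na; apply: nIP.
apply: (hideal_ind hI) => // e a ea Ia; apply: contrapT => nPa; apply: na.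
by exists a; split=> //; exists e.
Qed.

Lemma gab_local_hom (F : set (set R)) (I J : set R) : gabriel F -> F I -> hideal J ->
  (forall a, hom_elt a -> I a -> F [set b | J (b * a)]) -> F J.
Proof.
by move=> gF FI hJ h; apply: (gab_local gF FI) => // e a ea; apply: h; exists e.
Qed.

Hypothesis hom_prime : forall P : set R, hideal P -> ~ P 1 ->
  (forall a b, hom_elt a -> hom_elt b -> P (a * b) -> P a \/ P b) -> prime_ideal P.

(** Zorn: an ideal maximal outside a Gabriel filter is prime; the finite
    generation is what makes the complement of the filter inductive. *)
Lemma maximal_prime_ex (F : set (set R)) (I : set R) : gabriel F -> fg_based F ->
  hideal I -> ~ F I -> exists P, [/\ hideal P, prime_ideal P, I `<=` P & ~ F P].
Proof.
move=> gF fg hI nFI.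
(* The union with I makes the empty chain harmless. *)
pose Q := [set B : set R | hideal (I `|` B) /\ ~ F (I `|` B)].
have [ch chQ tot|A [[hA nA] maxA]] := @Zorn_bigcup R Q.
  have [[B0 chB0]|ch0] := pselect (exists B, ch B); last first.
    rewrite (_ : \bigcup_(X in ch) X = set0) /Q /= ?setU0 //.
    by apply/seteqP; split=> // x [B chB _]; case: ch0; exists B.
  set U := \bigcup_(X in ch) X.
  have UE x : (I `|` U) x <-> exists2 B, ch B & (I `|` B) x.
    split=> [[Ix|[B chB Bx]]|[B chB [Ix|Bx]]]; [by exists B0 => //; left| |by left|].
      by exists B => //; right.
    by right; exists B.
  have cmp2 B B' : ch B -> ch B' -> exists2 B'', ch B'' & B `<=` B'' /\ B' `<=` B''.
    by move=> h1 h2; have [s|s] := tot _ _ h1 h2; [exists B' => //; split | exists B => //; split].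
  have hU : hideal (I `|` U).
    split; last first.
      move=> d x /UE[B chB Bx]; apply/UE; exists B => //.
      by have [[_ h] _] := chQ _ chB; exact: h.
    split; first by left; have [[]] := hI.
      move=> x y /UE[B chB Bx] /UE[B' chB' By].
      have [B'' chB'' [s s']] := cmp2 _ _ chB chB'; apply/UE; exists B'' => //.
      have [[[_ h _] _] _] := chQ _ chB''; apply: h.
        by case: Bx; [left | right; exact: s].
      by case: By; [left | right; exact: s'].
    move=> a x /UE[B chB Bx]; apply/UE; exists B => //.
    by have [[[_ _ h] _] _] := chQ _ chB; exact: h.
  split=> // FU; have [s [sU sF]] := fg _ FU.
  have [B chB Bs] : exists2 B, ch B & forall a, a \in s -> (I `|` B) a.
    have {}sU a : a \in s -> (I `|` U) a by move=> /sU[].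
    elim: s {sF} sU => [|a s IH] sU; first by exists B0.
    have [b bs|B chB Bs] := IH; first by apply: sU; rewrite inE bs orbT.
    have /UE[B' chB' Ba] := sU a (mem_head _ _).
    have [B'' chB'' [s1 s2]] := cmp2 _ _ chB chB'; exists B'' => // b.
    rewrite inE => /orP[/eqP->|/Bs[]]; last by right; exact: s1.
      by case: Ba; [left | right; exact: s2].
    by left.
  by have [hB nB] := chQ _ chB; apply: nB; exact: sF.
pose P := I `|` A; have hP : hideal P := hA.
have [[P0 PD PM] Ppr] := hP.
have maxP J : hideal J -> P `<=` J -> ~ J `<=` P -> F J.
  move=> hJ sPJ nJP; apply: contrapT => nFJ; apply: (maxA J).
    split; first by move=> x Ax; apply: sPJ; right.
    by move=> sJA; apply: nJP => x /sJA; right.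
  have -> : Q J = (hideal J /\ ~ F J).
    by rewrite /Q /= (_ : I `|` J = J) //; apply: setUidr => x Ix; apply: sPJ; left.
  by [].
have nFP : ~ F P by [].
exists P; split=> //; last by left.
apply: hom_prime => //.
  move=> P1; apply: nFP; rewrite (_ : P = setT); first exact: gab_full.
  by apply/seteqP; split=> // x _; rewrite -[x]mulr1; exact: PM.
move=> a b ha hb Pab; apply: contrapT => nab; apply: nFP.
have colon c : hom_elt c -> hideal [set x | P (x * c)] by exact: hideal_colon_hom.
have sub c : P `<=` [set x | P (x * c)] by move=> x Px /=; rewrite mulrC; exact: PM.
apply: (@gab_local_hom _ [set x | P (x * b)]) => //.
  apply: maxP => //; first exact: colon.
  by move=> h; apply: nab; left; exact: h.
move=> c hc Pcb; apply: maxP => //; first exact: colon.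
move=> h; apply: nab; right; apply: h.
by rewrite /= mulrC.
Qed.

(** A finitely generated Gabriel filter is determined by the primes in it. *)
Lemma filter_primeP (F : set (set R)) (I : set R) : gabriel F -> fg_based F ->
  F I <-> hideal I /\ forall P, hideal P -> prime_ideal P -> I `<=` P -> F P.
Proof.
move=> gF fg; split=> [FI|[hI h]].
  by split; [exact: (gab_ideal gF FI) | move=> P hP _; exact: gab_up].
apply: contrapT => nFI; have [P [hP pP IP nFP]] := maximal_prime_ex gF fg hI nFI.
by apply: nFP; exact: h.
Qed.

Fixpoint prodseq (l : seq (seq R)) : seq R :=
  if l is s :: l' then [seq a * b | a <- s, b <- prodseq l'] else [:: 1].

(** The Gabriel filter generated by a family of finitely generated ideals,
    given by lists of homogeneous generators: its members contain a finite
    product of members of the family. *)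
Definition gen_filter (Gen : set (seq R)) : set (set R) := [set I | hideal I /\
  exists l, (forall s, s \in l -> Gen s) /\ forall a, a \in prodseq l -> I a].

Lemma prodseq_cat l l' (I : set R) : (forall a, a \in prodseq (l ++ l') -> I a) <->
  (forall a b, a \in prodseq l -> b \in prodseq l' -> I (a * b)).
Proof.
elim: l I => [|s l IH] I /=.
  split=> [h a b|h a al]; last by rewrite -[a]mul1r; apply: h; rewrite ?mem_head.
  by rewrite inE => /eqP-> ?; rewrite mul1r; exact: h.
split=> h.
  move=> _ b /allpairsP[[x y] /= [xs yl ->]] bl; rewrite -mulrA.
  apply: ((IH [set c | I (x * c)]).1 _ y b yl bl) => c cl /=.
  by apply: h; apply: allpairs_f.
move=> _ /allpairsP[[x y] /= [xs yl ->]].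
apply: ((IH [set c | I (x * c)]).2 _ y yl) => a b al bl /=.
by rewrite mulrA; apply: h => //; apply: allpairs_f.
Qed.

Section GeneratedFilter.
Variable Gen : set (seq R).
Hypothesis Gen_hom : forall s, Gen s -> forall a, a \in s -> hom_elt a.

Lemma prodseq_hom l : (forall s, s \in l -> Gen s) ->
  forall a, a \in prodseq l -> hom_elt a.
Proof.
elim: l => [|s l IH] h a /=; first by rewrite inE => /eqP->; exact: hom_one.
move=> /allpairsP[[x y] /= [xs yl ->]]; apply: hom_mul.
  by apply: (Gen_hom (h s _)) => //; exact: mem_head.
by apply: IH => // t tl; apply: h; rewrite inE tl orbT.
Qed.

(** Locality: each of the finitely many c that generate the given member has a
    product of generating lists inside (J : c), and the product of all of
    these serves every c. *)
Lemma gen_filter_gabriel : gabriel (gen_filter Gen).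
Proof.
split.
- by move=> I [].
- by split; [exact: hideal_full | exists [::]].
- by move=> I J [_ [l [lG lI]]] hJ sIJ; split=> //; exists l; split=> // a /lI/sIJ.
move=> I J [_ [l [lG lI]]] hJ loc; split=> //.
have [r [rG rJ]] : exists r, (forall s, s \in r -> Gen s) /\
    forall a, a \in prodseq l -> forall b, b \in prodseq r -> J (b * a).
  have : forall a, a \in prodseq l -> hom_elt a /\ I a.
    by move=> a al; split; [exact: (prodseq_hom lG) | exact: lI].
  elim: (prodseq l) => [|a p IH] hp; first by exists [::].
  have [b bp|r [rG rJ]] := IH; first by apply: hp; rewrite inE bp orbT.
  have [[e ea] Ia] := hp a (mem_head _ _).
  have [hJa [q [qG qJ]]] := loc e a ea Ia; have [[_ _ JM] _] := hJ.
  exists (q ++ r); split.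
    by move=> s; rewrite mem_cat => /orP[/qG|/rG].
  move=> c; rewrite inE => cp.
  apply: ((prodseq_cat q r [set b | J (b * c)]).2 _) => x y xq yr /=.
  case/orP: cp => [/eqP->|cp]; last by rewrite -mulrA; apply/JM/rJ.
  by rewrite mulrAC mulrC; apply/JM/qJ.
exists (r ++ l); split; first by move=> s; rewrite mem_cat => /orP[/rG|/lG].
by apply/prodseq_cat => a b ar bl; exact: rJ.
Qed.

Lemma gen_filter_fg : fg_based (gen_filter Gen).
Proof.
move=> I [hI [l [lG lI]]]; exists (prodseq l); split.
  by move=> a al; split; [exact: (prodseq_hom lG) | exact: lI].
by move=> J hJ lJ; split=> //; exists l.
Qed.

Lemma gen_filter_gen (I : set R) s : Gen s -> hideal I -> (forall a, a \in s -> I a) ->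
  gen_filter Gen I.
Proof.
move=> Gs hI sI; split=> //; exists [:: s]; split.
  by move=> t; rewrite inE => /eqP->.
by move=> c /allpairsP[[x y] /= [xs]]; rewrite inE => /eqP-> ->; rewrite mulr1; exact: sI.
Qed.

Lemma gen_filter_prime (I P : set R) : gen_filter Gen I -> prime_ideal P -> I `<=` P ->
  exists2 s, Gen s & forall a, a \in s -> P a.
Proof.
move=> [_ [l [lG lI]]] pP sIP; have [[_ _ PM] P1 Ppr] := pP.
have : forall a, a \in prodseq l -> P a by move=> a /lI/sIP.
elim: l lG {lI} => [|s l IH] lG /= h; first by case: P1; apply: h; rewrite mem_head.
have [sP|/existsNP[a /not_implyP[as_ nPa]]] := pselect (forall a, a \in s -> P a).
  by exists s => //; apply: lG; exact: mem_head.
apply: IH => [t tl|b bl]; first by apply: lG; rewrite inE tl orbT.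
by have [] := Ppr a b (h _ (allpairs_f _ as_ bl)).
Qed.

End GeneratedFilter.

(** The ideal generated by a set of homogeneous elements is the directed union
    of those generated by its finite subsets. *)
Definition hideal_gen (X : set R) : set R := [set b | exists t : seq R,
  (forall a, a \in t -> X a) /\ forall J, hideal J -> (forall a, a \in t -> J a) -> J b].

Lemma hideal_gen_hideal X : hideal (hideal_gen X).
Proof.
split; last first.
  by move=> d x [t [tX h]]; exists t; split=> // J hJ tJ; apply: hJ.2; exact: h.
split; first by exists [::]; split=> // J [[]].
  move=> x y [t [tX hx]] [r [rX hy]]; exists (t ++ r); split.
    by move=> a; rewrite mem_cat => /orP[/tX|/rX].
  move=> J hJ J0; have [[_ JD _] _] := hJ; apply: JD.
    by apply: hx => // a at_; apply: J0; rewrite mem_cat at_.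
  by apply: hy => // a ar; apply: J0; rewrite mem_cat ar orbT.
move=> a x [t [tX hx]]; exists t; split=> // J hJ tJ.
by have [[_ _ JM] _] := hJ; apply: JM; exact: hx.
Qed.

Lemma hideal_gen_sub X : X `<=` hideal_gen X.
Proof.
move=> x Xx; exists [:: x]; split; first by move=> a; rewrite inE => /eqP->.
by move=> J _; apply; exact: mem_head.
Qed.

Lemma hideal_gen_le X J : hideal J -> X `<=` J -> hideal_gen X `<=` J.
Proof. by move=> hJ sX x [t [tX h]]; apply: h => // a /tX/sX. Qed.

Section Points.
Variables (X : topologicalType) (pt : X -> set R) (ms : seq R).
Hypothesis open_pt : forall U : set X, open U <-> zariski_open pt (@hideal g) U.
Hypothesis pt_prime : forall x, prime_ideal (pt x).
Hypothesis pt_hideal : forall x, hideal (pt x).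
Hypothesis ms_hom : forall a, a \in ms -> hom_elt a.
Hypothesis pt_relevant : forall x, ~ (forall a, a \in ms -> pt x a).
Hypothesis pt_surj : forall P, hideal P -> prime_ideal P ->
  ~ (forall a, a \in ms -> P a) -> exists x, pt x = P.

Definition homseq (s : seq R) : Prop := forall a, a \in s -> hom_elt a.
Definition Vseq (s : seq R) : set X := [set x | forall a, a \in s -> pt x a].
(** The homogeneous ideals that contain a power of the ideal generated by
    [ms]. *)
Definition base_filter : set (set R) := gen_filter [set ms].

Lemma base_gabriel : gabriel base_filter.
Proof. by apply: gen_filter_gabriel => s ->; exact: ms_hom. Qed.

Lemma base_fg : fg_based base_filter.
Proof. by apply: gen_filter_fg => s ->; exact: ms_hom. Qed.

Lemma base_notin x : ~ base_filter (pt x).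
Proof.
by move=> h; have [s -> sx] := gen_filter_prime h (pt_prime x) (@subset_refl _ _); apply: (@pt_relevant x).
Qed.

Lemma base_or_point P : hideal P -> prime_ideal P -> base_filter P \/ exists x, pt x = P.
Proof.
move=> hP pP; have [h|h] := pselect (forall a, a \in ms -> P a).
  by left; exact: (@gen_filter_gen [set ms] P ms).
by right; exact: pt_surj.
Qed.

Definition points_of (F : set (set R)) : set X := [set x | F (pt x)].
Definition filter_on (V : set X) : set (set R) :=
  [set I | hideal I /\ forall x, I `<=` pt x -> V x].

(** A prime that contains I either contains [ms], and then it is in F, or it
    is a point. *)
Lemma filter_on_points F : gabriel F -> fg_based F -> base_filter `<=` F ->
  filter_on (points_of F) = F.
Proof.
move=> gF fg sF; apply/seteqP; split=> [I [hI h]|I FI].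
  apply/(filter_primeP _ gF fg); split=> // P hP pP sIP.
  have [/sF //|[x xP]] := base_or_point hP pP.
  by rewrite -xP; apply: h; rewrite xP.
split; first exact: (gab_ideal gF FI).
by move=> x sIx; exact: (gab_up gF FI).
Qed.

Definition closed_seq_in (V : set X) : set (seq R) :=
  [set s | homseq s /\ Vseq s `<=` V].

(** A prime over I that is maximal outside the generated filter would be a
    point of V, hence would contain one of the generating lists. *)
Lemma filter_onE (V : set X) : (forall x, V x -> exists2 s, closed_seq_in V s & Vseq s x) ->
  filter_on V = gen_filter (closed_seq_in V).
Proof.
move=> hV.
have Gh s : closed_seq_in V s -> homseq s by case.
apply/seteqP; split=> I.
  move=> [hI h]; apply/(filter_primeP I (gen_filter_gabriel Gh) (gen_filter_fg Gh)).
  split=> // P hP pP sIP; have [Pms|[x xP]] := base_or_point hP pP.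
    have [s -> sP] := gen_filter_prime Pms pP (@subset_refl _ _).
    apply: (@gen_filter_gen _ _ ms) => //; split=> // x xms.
    by case: (@pt_relevant x).
  have /hV[s Gs sx] : V x by apply: h; rewrite xP.
  by apply: (@gen_filter_gen _ _ s) => //; rewrite -xP.
move=> FI; split; first by case: FI.
move=> x sIx; have [s [_ sV] sx] := gen_filter_prime FI (pt_prime x) sIx.
exact: sV.
Qed.

Lemma Vseq_open s : homseq s -> open (~` Vseq s).
Proof.
move=> hs; apply/open_pt; exists (hideal_gen [set` s]); first exact: hideal_gen_hideal.
congr (~` _); apply/seteqP; split=> x h; last by move=> a as_; apply: h; exact: hideal_gen_sub.
by apply: hideal_gen_le => // a; exact: h.
Qed.

Lemma principal_hideal a : hom_elt a -> hideal [set x : R | exists b : R, x = b * a].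
Proof.
move=> [e ea]; split; last first.
  move=> d _ [b ->]; exists (gpr (rc_sum g) (d - e) b).
  by rewrite -(pr_mul _ _ ea) subrK.
split; first by exists 0; rewrite mul0r.
  by move=> _ _ [b ->] [c ->]; exists (b + c); rewrite mulrDl.
by move=> b _ [c ->]; exists (b * c); rewrite mulrA.
Qed.

Lemma basic_nbhs a x : hom_elt a -> ~ pt x a -> nbhs x [set y | ~ pt y a].
Proof.
move=> ha nxa; apply: open_nbhs_nbhs; split=> //; apply/open_pt.
exists [set y : R | exists b : R, y = b * a]; first exact: principal_hideal.
congr (~` _); apply/seteqP; split=> y /=.
  by move=> ya _ [b ->]; have [[_ _ h] _] := pt_hideal y; exact: h.
by apply; exists 1; rewrite mul1r.
Qed.

Lemma nbhs_basic x (N : set X) : nbhs x N ->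
  exists a, [/\ hom_elt a, ~ pt x a & forall y, ~ pt y a -> N y].
Proof.
rewrite nbhsE => -[B [/open_pt[I hI ->] nIx] sBN].
have [a [ha Ia nxa]] := hideal_hom_notin hI (pt_hideal x).1 nIx.
by exists a; split=> // y nya; apply: sBN => h; apply: nya; exact: h.
Qed.

(** Quasi-compactness of the complement of V(s): if every point outside V(s)
    had a basic neighbourhood D(a) disjoint from a member of the filter, the
    ideal of these a would contain a product of powers of s and ms, and
    finitely many of them would do. *)
Lemma Vseq_compact s : homseq s -> compact (~` Vseq s).
Proof.
move=> hs F PF FU; apply: contrapT => nocl.
(* The a such that D(a) is disjoint from a member of F. *)
pose aa : set R := [set a | hom_elt a /\ F [set y | pt y a]].
have cov x : ~ Vseq s x -> exists2 a, aa a & ~ pt x a.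
  move=> nsx; apply: contrapT => na; apply: nocl; exists x; split=> // A N FA Nx.
  have [a [ha nxa sN]] := nbhs_basic Nx.
  apply: contrapT => nAN; apply: na; exists a => //; split=> //.
  apply: filterS FA => y Ay; apply: contrapT => nya; apply: nAN.
  by exists y; split=> //; exact: sN.
pose Gen : set (seq R) := [set t | t = s \/ t = ms].
have Gh t : Gen t -> homseq t by move=> [->|->].
have : gen_filter Gen (hideal_gen aa).
  apply/(filter_primeP _ (gen_filter_gabriel Gh) (gen_filter_fg Gh)).
  split=> [|P hP pP sP]; first exact: hideal_gen_hideal.
  have [Pms|[x xP]] := base_or_point hP pP.
    have [t -> tP] := gen_filter_prime Pms pP (@subset_refl _ _).
    by apply: (@gen_filter_gen _ _ ms) => //; right.
  have [sx|/cov[a ha nxa]] := pselect (Vseq s x).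
    by apply: (@gen_filter_gen _ _ s) => //; [left | rewrite -xP].
  by case: nxa; rewrite xP; apply: sP; exact: hideal_gen_sub.
move=> [_ [l [lG lI]]].
have [t [taa tJ]] : exists t : seq R, (forall a, a \in t -> aa a) /\
    forall J, hideal J -> (forall a, a \in t -> J a) -> forall b, b \in prodseq l -> J b.
  elim: (prodseq l) lI => [|b p IH] lI; first by exists [::].
  have [c cp|t [taa tJ]] := IH; first by apply: lI; rewrite inE cp orbT.
  have [r [raa rJ]] := lI b (mem_head _ _).
  exists (r ++ t); split; first by move=> a; rewrite mem_cat => /orP[/raa|/taa].
  move=> J hJ h c; rewrite inE => /orP[/eqP->|cp].
    by apply: rJ => // a ar; apply: h; rewrite mem_cat ar.
  by apply: tJ => // a at_; apply: h; rewrite mem_cat at_ orbT.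
have Ft : F (Vseq t).
  elim: t taa {tJ} => [|a t IH] taa; first by apply: filterS filterT => y _ a; rewrite in_nil.
  have Fa : F [set y | pt y a] by case: (taa a (mem_head _ _)).
  have {}IH : F (Vseq t) by apply: IH => b bt; apply: taa; rewrite inE bt orbT.
  by apply: filterS (filterI Fa IH) => y [/= ya yt] b; rewrite inE => /orP[/eqP->|/yt].
have [x [nsx xt]] := filter_ex (filterI FU Ft).
have xl : gen_filter Gen (pt x).
  by split=> //; exists l; split=> // b bl; exact: tJ bl.
have [r [->|->]] := gen_filter_prime xl (pt_prime x) (@subset_refl _ _).
  exact: nsx.
exact: (@pt_relevant x).
Qed.

(** If V(s) differed from Y for every finite part s of I, the sets V(s) minus
    Y would be a filter base on the complement of Y without a cluster point
    there. *)
Lemma qc_co_open_Vseq (Y : set X) : open (~` Y) -> compact (~` Y) ->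
  exists2 s, homseq s & Y = Vseq s.
Proof.
move=> /open_pt[I hI YE] cY.
have {}YE : Y = [set x | I `<=` pt x] by rewrite -[LHS]setCK YE setCK.
apply: contrapT => ns.
pose F : set_system X := [set A | exists2 s : seq R,
  (forall a, a \in s -> hom_elt a /\ I a) & Vseq s `&` ~` Y `<=` A].
have PF : ProperFilter F.
  split.
    move=> [s sI h]; apply: ns; exists s; first by move=> a /sI[].
    apply/seteqP; split=> x; first by rewrite YE => Ix a /sI[_ /Ix].
    by move=> sx; apply: contrapT => nYx; apply: (h x).
  split.
  - by exists [::].
  - move=> A B [s sI sA] [t tI tB]; exists (s ++ t).
      by move=> a; rewrite mem_cat => /orP[/sI|/tI].
    move=> x [stx nYx]; split; [apply: sA | apply: tB]; split=> // a ha; apply: stx;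
      by rewrite mem_cat ha ?orbT.
  - by move=> A B sAB [s sI sA]; exists s => //; exact: subset_trans sA sAB.
have [|x [nYx clx]] := cY F PF; first by exists [::] => // x [].
have nIx : ~ I `<=` pt x by move: nYx; rewrite YE.
have [a [ha Ia nxa]] := hideal_hom_notin hI (pt_hideal x).1 nIx.
have Fa : F (Vseq [:: a]).
  exists [:: a]; last by move=> y [].
  by move=> b; rewrite inE => /eqP->.
have [y [ay nya]] := clx _ _ Fa (basic_nbhs ha nxa).
by apply: nya; apply: ay; exact: mem_head.
Qed.

Lemma qc_union_covers (V : set X) : union_of_qc_co_open V ->
  forall x, V x -> exists2 s, closed_seq_in V s & Vseq s x.
Proof.
move=> [Om [Y [hY ->]]] x [i _ Yx]; have [oY cY] := hY i.
have [s hs YE] := qc_co_open_Vseq oY cY.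
exists s; last by rewrite -YE.
by split=> // y sy; exists i => //; rewrite YE.
Qed.

Lemma qc_union_points (F : set (set R)) : gabriel F -> fg_based F ->
  union_of_qc_co_open (points_of F).
Proof.
move=> gF fg; pose Om := {s : seq R | homseq s /\
  forall J, hideal J -> (forall a, a \in s -> J a) -> F J}.
exists Om, (fun s : Om => Vseq (sval s)); split.
  by move=> [s [hs sF]]; split; [exact: Vseq_open | exact: Vseq_compact].
apply/seteqP; split=> x /=.
  move=> /fg[s [sx sF]].
  have hs : homseq s /\ forall J, hideal J -> (forall a, a \in s -> J a) -> F J.
    by split=> // a /sx[].
  by exists (exist _ s hs) => // a /sx[].
by move=> [[s [hs sF]] _ sx]; exact: (sF (pt x)).
Qed.

Lemma filter_on_good (V : set X) : union_of_qc_co_open V ->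
  [/\ gabriel (filter_on V), fg_based (filter_on V), base_filter `<=` filter_on V
    & points_of (filter_on V) = V].
Proof.
move=> /qc_union_covers hV; have Gh s : closed_seq_in V s -> homseq s by case.
rewrite filter_onE //; split.
- exact: gen_filter_gabriel.
- exact: gen_filter_fg.
- rewrite -filter_onE // => I bI; split; first by case: bI.
  move=> x sIx; have [s -> sx] := gen_filter_prime bI (pt_prime x) sIx.
  by case: (@pt_relevant x).
- apply/seteqP; split=> x /=; rewrite /points_of /= -filter_onE //.
    by move=> [_]; apply.
  move=> Vx; split=> // y sxy; have [s [_ sV] sx] := hV x Vx.
  by apply: sV => a /sx/sxy.
Qed.

Section Correspondence.
Variable C : modcat g.
Hypothesis mcF_base : mcF C = base_filter.

Definition msupp (M : C) : set X := [set x | exists u : und M,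
  forall a, hom_elt a -> ~ pt x a -> a *: u <> 0].

Lemma msupp_sub (V : set X) (M : C) : gabriel (filter_on V) ->
  (msupp M `<=` V <-> torsion_of (filter_on V) M).
Proof.
move=> gV; split=> [sV u|tM x [u hu]]; last first.
  have [I [hI hIV] Iu] := tM u; apply: hIV; apply: contrapT => nIx.
  have [a [ha Ia nxa]] := hideal_hom_notin hI (pt_hideal x).1 nIx.
  exact: (hu a ha nxa (Iu a Ia)).
apply: homsub_pr_in; first exact: tors_homsub.
move=> d; have dv := gprP (gsum (und M)) d u; set v := gpr _ d u in dv *.
exists (annihilator v) => //; split; first exact: hideal_annihilator dv.
move=> x sx; apply: sV; exists v => a ha nxa av; apply: nxa; exact: sx.
Qed.

Lemma msupp_points (S : C -> Prop) : torsion_class S -> shift_invariant S ->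
  [set x | exists M, S M /\ msupp M x] = points_of (filter_of S).
Proof.
move=> hS shS; apply/seteqP; split=> x.
  move=> [M [SM [u hu]]]; have [I FI Iu] := (S_char hS shS M).1 SM u.
  have gS := filter_of_gabriel hS shS; apply: (gab_up gS FI) => //.
  apply: contrapT => nIx.
  have [a [ha Ia nxa]] := hideal_hom_notin (gab_ideal gS FI) (pt_hideal x).1 nIx.
  exact: (hu a ha nxa (Iu a Ia)).
move=> [_ [T [ST [d [t [dt h]]]]]]; exists T; split=> //; exists t => a ha nxa at0.
have [J FJ hJ] := h a at0; apply: (@base_notin x).
rewrite mcF_base in FJ; apply: (gab_up base_gabriel FJ) => // b /hJ.
by have [_ _ pr] := pt_prime x; move=> /pr[].
Qed.

(** The correspondence for any category of modules closed for the filter of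
    the powers of the ideal generated by [ms]. *)
Theorem torsion_correspondence : inverse_bijections
  (fun V : set X => union_of_qc_co_open V)
  (fun S : C -> Prop => (torsion_class S /\ shift_invariant S) /\ finite_type S)
  (fun V M => msupp M `<=` V)
  (fun S => [set x | exists M, S M /\ msupp M x]).
Proof.
have fSV (V : set X) : union_of_qc_co_open V ->
    (fun M : C => msupp M `<=` V) = torsion_of (filter_on V).
  by move=> /filter_on_good[gV _ _ _]; apply/funext => M; apply/propext; exact: msupp_sub.
have good V : union_of_qc_co_open V -> mcF C `<=` filter_on V.
  by move=> /filter_on_good[_ _ h _]; rewrite mcF_base.
split.
- move=> V gV; rewrite fSV //; have [gabV fgV _ _] := filter_on_good gV.
  have hS := torsion_of_class gabV (good _ gV).
  have shS := @torsion_of_shift _ C (filter_on V).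
  split; first by split. apply: (fg_based_finite_type hS shS).
  by rewrite filter_of_torsion //; exact: good.
- move=> S [[hS shS] fS]; rewrite msupp_points //.
  apply: qc_union_points; first exact: filter_of_gabriel.
  by apply: finite_type_fg_based => //; rewrite mcF_base; exact: base_fg.
- move=> V gV; have [gabV fgV _ VE] := filter_on_good gV.
  rewrite (@msupp_points (fun M => msupp M `<=` V)) fSV //; last 2 first.
  + by apply: torsion_of_class => //; exact: good.
  + exact: torsion_of_shift.
  by rewrite filter_of_torsion //; exact: good.
- move=> S [[hS shS] fS]; rewrite msupp_points //.
  have gS := filter_of_gabriel hS shS.
  have fgS : fg_based (filter_of S).
    by apply: finite_type_fg_based => //; rewrite mcF_base; exact: base_fg.
  have sS : base_filter `<=` filter_of S by rewrite -mcF_base; exact: sub_filter_of.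
  rewrite fSV; last exact: qc_union_points.
  rewrite filter_on_points //; apply/funext => M; apply/propext.
  exact: (iff_sym (S_char hS shS M)).
Qed.

End Correspondence.
End Points.
End PrimesAndFilters.

(** * The affine case *)

Lemma nonzero_localization (R : comPzRingType) (mS : mul_set R) (M : lmodType R) :
  nonzero_module (localization mS M) <-> exists m : M, forall u, mul_set_car mS u -> u *: m <> 0.
Proof.
have zE (m : M) s : mk_frac m s = 0 :> localization mS M <-> exists2 u, mul_set_car mS u & u *: m = 0.
  rewrite [0](_ : _ = mk_frac 0 (den1 mS)) // mk_fracP.
  by split=> -[u Su h]; exists u => //; move: h; rewrite /= scale1r !scaler0.
split=> [[x]|[m hm]].
  elim/loc_elim: x => m s h; exists m => u Su um; apply: h.
  by apply/zE; exists u.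
by exists (mk_frac m (den1 mS)) => /zE[u Su]; exact: hm.
Qed.

Lemma inverse_bijections_ext (T U : Type) (D : T -> Prop) (E E' : U -> Prop)
    (f f' : T -> U) (h h' : U -> T) : (forall y, E y <-> E' y) ->
  f = f' -> h = h' -> inverse_bijections D E f h -> inverse_bijections D E' f' h'.
Proof.
move=> hE <- <- [h1 h2 h3 h4]; split=> // [x Dx|y /hE Ey|y /hE Ey]; auto.
exact/hE/h1.
Qed.

Section UnitFilter.
Variable g : grading.

(** Its only member is the full ideal, so that every module is closed. *)
Definition unit_filter : set (set (gR g)) := gen_filter [set [:: 1 : gR g]].

Lemma unit_filter_gabriel : gabriel unit_filter.
Proof.
by apply: gen_filter_gabriel => s -> a; rewrite inE => /eqP->; exact: hom_one.
Qed.

Lemma unit_filter1 I : unit_filter I -> I 1.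
Proof.
move=> [_ [l [lG]]]; apply; elim: l lG => [|s l IH] lG /=; first exact: mem_head.
have -> : s = [:: 1] by apply: lG; exact: mem_head.
rewrite -[X in X \in _](mul1r 1); apply: allpairs_f; first exact: mem_head.
by apply: IH => t tl; apply: lG; rewrite inE tl orbT.
Qed.

Lemma unit_filter_closed (W : gmod g) : gclosed unit_filter W.
Proof.
split=> [x [I /unit_filter1 I1 h]|I d phi /unit_filter1 I1 [_ phiZ phid]].
  by rewrite -[x]scale1r; exact: h.
exists (phi 1); first by rewrite -[d]add0r; apply: phid => //; exact: rc_one.
by move=> a _; rewrite -[X in phi X = _]mulr1 phiZ.
Qed.

End UnitFilter.

Section Affine.
Variable R : comPzRingType.

Lemma trivial_sum (T : zmodType) : internal_direct_sum (fun _ : 'I_1 => [set: T]).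
Proof.
split=> // [x|s a us _ sum0 i si].
  by exists [:: 0], (fun=> x); split; rewrite ?big_seq1.
move: sum0; rewrite (bigD1_seq i) //= big1 ?addr0 // => j.
by rewrite (ord1 i) (ord1 j) eqxx.
Qed.

(** The grading by the group with one element. *)
Definition trivial_grading : grading :=
  @Grading R 'I_1 (fun=> setT) (trivial_sum _) I (fun _ _ _ _ _ _ => I).
Local Notation g := trivial_grading.

Definition trivial_gmod (M : lmodType R) : gmod g :=
  @GMod g M (fun=> setT) (trivial_sum _) (fun _ _ _ _ _ _ => I).

Lemma trivial_gcmp (N : gmod g) (d : 'I_1) (x : N) : gcmp (g := g) d x.
Proof.
rewrite (_ : x = gpr (gsum N) d x); first exact: (gprP (gsum N)).
have [s [us h0 {1}->]] := gpr_supp (gsum N) x.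
have [ds|nds] := boolP (d \in s); last first.
  rewrite h0 // big1_seq // => i _; apply: h0.
  by rewrite (ord1 i) -(ord1 d).
rewrite (bigD1_seq d) //= big1 ?addr0 // => j.
by rewrite (ord1 d) (ord1 j) eqxx.
Qed.

Lemma trivial_hideal (I : set R) : hideal (g := g) I <-> ideal I.
Proof.
split=> [[]//|iI]; split=> // d x Ix; rewrite gpr_id //.
Qed.

Lemma affine_surj (N : gmod g) : gclosed (@unit_filter g) N ->
  exists (X : Mod R) (f : {linear (trivial_gmod X) -> N})
    (h : {linear N -> (trivial_gmod X)}), [/\ deg0 f, cancel f h & cancel h f].
Proof.
move=> _; exists (gcar N).
have [f fE] : exists f : {linear (trivial_gmod N) -> N}, f =1 id by exact: lin_ex.
have [h hE] : exists h : {linear N -> (trivial_gmod N)}, h =1 id by exact: lin_ex.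
exists f, h; split.
- by move=> d x _; exact: trivial_gcmp.
- by move=> x; rewrite hE fE.
- by move=> x; rewrite fE hE.
Qed.

Definition affine_modcat : modcat g.
Proof.
refine (@ModCat g (Mod R) (@unit_filter g) (@unit_filter_gabriel g) trivial_gmod
  (fun X Y f => f) _ _ _ _ _ _ affine_surj).
- by [].
- by move=> X Y f h e; exact: linear_ext.
- by move=> X Y f _; exists f.
- by [].
- by [].
- by move=> X; exact: unit_filter_closed.
Defined.

(** Shifts are isomorphisms here. *)
Lemma affine_shift (S : affine_modcat -> Prop) : torsion_class S -> shift_invariant S.
Proof.
move=> hS X X' t f [h fh hf] _ SX.
apply: (@S_dense g affine_modcat S hS X X' f) => // z.
exists setT; first exact: gab_full (@unit_filter_gabriel g).
by move=> a _; exists (h (a *: z)).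
Qed.

Lemma affine_case : inverse_bijections
  (fun V : set (Spec R) => union_of_qc_co_open V)
  (fun S : Mod R -> Prop => torsion_class S /\ finite_type S)
  (fun (V : set (Spec R)) (M : Mod R) => supp M `<=` V)
  (fun S : Mod R -> Prop =>
    [set P : Spec R | exists M : Mod R, S M /\ supp M P]).
Proof.
have suppE (M : affine_modcat) : msupp (g := g) (@spec_ideal R) (C := affine_modcat) M = supp M.
  apply/seteqP; split=> P /=.
    move=> [u hu]; apply/nonzero_localization; exists u => a nPa.
    apply: hu; first by exists 0.
    by case: P nPa => P [].
  move=> /nonzero_localization[u hu]; exists u => a _ nPa; apply: hu.
  by case: P nPa => P [].
have := @torsion_correspondence g _ (Spec R) (@spec_ideal R) [:: 1] _ _ _ _ _ _
  affine_modcat erefl.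
move=> h; apply: inverse_bijections_ext (h _ _ _ _ _ _ _).
- move=> S; split=> [[[]]//|[hS fS]]; split=> //; split=> //; exact: affine_shift.
- by apply/funext => V; apply/funext => M; rewrite suppE.
- by apply/funext => S; apply/seteqP; split=> P [M [SM sM]]; exists M; split=> //;
    move: sM; rewrite suppE.
- move=> P hP P1 Ppr; split=> //; first by case: hP.
  by move=> a b Pab; apply: Ppr => //; exists 0.
- move=> U; rewrite (_ : @hideal g = @ideal R) //.
  by apply/funext => I; apply/propext; exact: trivial_hideal.
- exact: spec_prime.
- by move=> P; apply/trivial_hideal; case: (spec_prime P).
- by move=> a; rewrite inE => /eqP->; exact: hom_one.
- move=> P hP; case: (spec_prime P) => _ nP1 _; by apply: nP1; apply: hP; exact: mem_head.
- by move=> P hP pP _; exists (MkSpec pP).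
Qed.

End Affine.

(** * Graded rings, Gr and QGr *)

Section GradedInstance.
Variable A : graded_ring.

Definition nat_of_int_opt (n : int) : option nat := if n is Posz k then Some k else None.

Lemma posz_pcancel : pcancel Posz nat_of_int_opt. Proof. by []. Qed.
Lemma posz_ocancel : ocancel nat_of_int_opt Posz. Proof. by case. Qed.

(** The given grading, extended by zero to negative degrees. *)
Definition zcomp (n : int) : set A :=
  if nat_of_int_opt n is Some k then gr_comp k else [set 0].

Lemma zcomp_sum : internal_direct_sum zcomp.
Proof. exact: internal_direct_sum_reindex posz_pcancel posz_ocancel (@gr_sum A). Qed.

Lemma zcomp_mul d e (a b : A) : zcomp d a -> zcomp e b -> zcomp (d + e) (a * b).
Proof.
case: d => [i|i]; case: e => [j|j] //=.
- by move=> ia jb; exact: (gr_mul ia jb).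
- by move=> _ ->; rewrite mulr0; exact: (ids0 zcomp_sum).
- by move=> -> _; rewrite mul0r; exact: (ids0 zcomp_sum).
- by move=> -> _; rewrite mul0r; exact: (ids0 zcomp_sum).
Qed.

Definition zgrading : grading := @Grading A int zcomp zcomp_sum (@gr_one A) zcomp_mul.
Local Notation g := zgrading.

Lemma zgmod_scale (M : graded_module A) e d a (x : M) :
  zcomp e a -> gm_comp d x -> gm_comp (e + d) (a *: x).
Proof.
case: e => i /=; first exact: gm_scale.
by move=> -> _; rewrite scale0r; exact: (ids0 (@gm_sum A M)).
Qed.

Definition gmod_of (M : graded_module A) : gmod g :=
  @GMod g M (@gm_comp A M) (@gm_sum A M) (@zgmod_scale M).

Lemma of_gmod_scale (N : gmod g) (i : nat) (n : int) (a : A) (x : N) :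
  gr_comp i a -> gcmp (g := g) n x -> gcmp (g := g) (i%:Z + n) (a *: x).
Proof. exact: (@gscal g N (Posz i) n a x). Qed.

Definition of_gmod (N : gmod g) : graded_module A :=
  @GradedModule A (gcar N) (@gcmp g N) (gsum N) (@of_gmod_scale N).

Lemma of_gmod_iso (N : gmod g) : exists (f : {linear (gmod_of (of_gmod N)) -> N})
  (h : {linear N -> (gmod_of (of_gmod N))}),
  [/\ deg0 f, deg0 h, cancel f h & cancel h f].
Proof.
have [f fE] : exists f : {linear (gmod_of (of_gmod N)) -> N}, f =1 id by exact: lin_ex.
have [h hE] : exists h : {linear N -> (gmod_of (of_gmod N))}, h =1 id by exact: lin_ex.
exists f, h; split.
- by move=> d x dx; rewrite fE.
- by move=> d x dx; rewrite hE.
- by move=> x; rewrite hE fE.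
- by move=> x; rewrite fE hE.
Qed.

Lemma Gr_surj (N : gmod g) : gclosed (@unit_filter g) N ->
  exists (X : Gr A) (f : {linear (gmod_of X) -> N})
    (h : {linear N -> (gmod_of X)}), [/\ deg0 f, cancel f h & cancel h f].
Proof.
by move=> _; exists (of_gmod N); have [f [h [? ? ? ?]]] := of_gmod_iso N; exists f, h.
Qed.

Definition Gr_modcat : modcat g.
Proof.
refine (@ModCat g (Gr A) (@unit_filter g) (@unit_filter_gabriel g) gmod_of
  (fun X Y f => gh_lin f) _ _ _ _ _ _ Gr_surj).
- by move=> X Y f d x; exact: gh_degree.
- by move=> X Y f h; exact: graded_hom_ext.
- by move=> X Y f df; exists (GradedHom df).
- by [].
- by [].
- by move=> X; exact: unit_filter_closed.
Defined.

Lemma hom_elt_nat (a : A) : hom_elt (g := g) a -> exists n, gr_comp n a.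
Proof. by move=> [[n|n] /=]; [exists n | move=> ->; exists 0%N; exact: (ids0 (@gr_sum A))]. Qed.

Lemma homogeneous_idealE (I : set A) : homogeneous_ideal I <-> hideal (g := g) I.
Proof.
split=> -[iI hI]; split=> //.
  move=> d x Ix; have [I0 _ _] := iI.
  case: d => n /=; last first.
    have /= -> := gprP (rc_sum g) (Negz n) x; exact: I0.
  have [s [us xh xE]] := gpr_supp (rc_sum g) x.
  pose a (n : nat) : A := gpr (rc_sum g) (Posz n) x.
  have aP k : gr_comp k (a k) by exact: (gprP (rc_sum g) (Posz k) x).
  pose t := pmap nat_of_int_opt s.
  have ut : uniq t by apply: (pmap_uniq posz_ocancel).
  have xE' : x = \sum_(j <- t) a j.
    rewrite [LHS]xE /t; elim: s {us xh xE t ut} => [|j s IH] /=; first by rewrite !big_nil.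
    rewrite big_cons IH; case: j => k /=; first by rewrite big_cons.
    have /= -> := gprP (rc_sum g) (Negz k) x; exact: add0r.
  have [nt|nnt] := boolP (n \in t).
    by have := hI t a ut aP; rewrite -xE' => h; exact: (h Ix n nt).
  rewrite xh //; apply: contra nnt => ns.
  by rewrite mem_pmap; apply/mapP; exists (Posz n).
move=> s a us ha Is j js.
rewrite (_ : a j = gpr (rc_sum g) (Posz j) (\sum_(j <- s) a j)); first exact: hI.
rewrite gpr_sum (bigD1_seq j) //= gpr_id; last exact: ha.
rewrite big1 ?addr0 // => i ij.
by rewrite (@gpr_neq _ _ _ (rc_sum g) (Posz i)) //; [exact: ha | rewrite eq_sym].
Qed.

Lemma max_mem (s : seq int) : s != [::] -> exists2 m, m \in s & forall i, i \in s -> (i <= m)%R.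
Proof.
elim: s => [//|i s IH] _; have [->|/IH[m ms hm]] := eqVneq s [::].
  by exists i; rewrite ?mem_head // => j; rewrite inE => /eqP->.
have [im|mi] := Order.TotalTheory.leP i m.
  exists m; first by rewrite inE ms orbT.
  by move=> j; rewrite inE => /orP[/eqP->//|/hm].
exists i; first exact: mem_head.
move=> j; rewrite inE => /orP[/eqP->//|/hm jm].
by apply: Order.POrderTheory.ltW; exact: Order.POrderTheory.le_lt_trans jm mi.
Qed.

(** Primality may be tested on homogeneous elements, by comparing the
    components of highest degree that lie outside the ideal. *)
Lemma hom_prime_int (P : set A) : hideal (g := g) P -> ~ P 1 ->
  (forall a b, hom_elt (g := g) a -> hom_elt (g := g) b -> P (a * b) -> P a \/ P b) ->
  prime_ideal P.
Proof.
move=> hP P1 Ppr; have [[P0 PD PM] Pc] := hP; split; [by case: hP | by [] |].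
have PN x : P x -> P (- x) by move=> Px; rewrite -mulN1r; exact: PM.
have PB x y : P x -> P y -> P (x - y) by move=> Px Py; apply: PD => //; exact: PN.
have Psum (T : eqType) (s : seq T) (f : T -> A) :
    (forall i, i \in s -> P (f i)) -> P (\sum_(i <- s) f i).
  move=> h; rewrite big_seq; elim/big_ind: _ => //; exact: PD.
pose pr := gpr (rc_sum g).
have trim x : ~ P x -> exists s : seq int, [/\ s != [::], uniq s,
    forall i, i \in s -> ~ P (pr i x) & P (x - \sum_(i <- s) pr i x)].
  move=> nPx; have [s [us _ xE]] := gpr_supp (rc_sum g) x.
  pose t := [seq i <- s | ~~ `[< P (pr i x) >]].
  have hx : P (x - \sum_(i <- t) pr i x).
    rewrite {1}[x]xE /t big_filter (bigID (fun i => ~~ `[< P (pr i x) >])) /= [X in P X]addrC addKr.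
    rewrite -big_filter; apply: Psum => i; rewrite mem_filter negbK => /andP[/asboolP//].
  exists t; split=> //; last first.
  - by move=> i; rewrite mem_filter => /andP[/asboolP].
  - exact: filter_uniq.
  - by apply/eqP => t0; apply: nPx; move: hx; rewrite t0 big_nil subr0.
move=> a b Pab; apply: contrapT => /not_orP[nPa nPb].
have [s [s0 us sP as_]] := trim a nPa; have [t [t0 ut tP bt]] := trim b nPb.
set a' := \sum_(i <- s) pr i a in as_; set b' := \sum_(i <- t) pr i b in bt.
have Pab' : P (a' * b').
  rewrite (_ : a' * b' = a * b - (a * (b - b') + b' * (a - a'))).
    by apply: PB => //; apply: PD; exact: PM.
  by rewrite !mulrBr [b' * a]mulrC [b' * a']mulrC addrA subrK opprB addrC subrK.
have [d ds dmax] := max_mem s0; have [e et emax] := max_mem t0.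
have [] := Ppr (pr d a) (pr e b); last 2 first.
- exact: sP.
- exact: tP.
- by exists d; exact: (gprP (rc_sum g)).
- by exists e; exact: (gprP (rc_sum g)).
have -> : pr d a * pr e b = pr (d + e) (a' * b').
  rewrite /a' mulr_suml [RHS]gpr_sum (bigD1_seq d) //= [X in _ + X]big1_seq ?addr0.
    rewrite mulr_sumr gpr_sum (bigD1_seq e) //= gpr_id; last first.
      by apply: zcomp_mul; exact: (gprP (rc_sum g)).
    rewrite big1_seq ?addr0 // => j /andP[je jt].
    apply: (@gpr_neq _ _ _ (rc_sum g) (d + j)); last by rewrite (inj_eq (addrI d)) eq_sym.
    by apply: zcomp_mul; exact: (gprP (rc_sum g)).
  move=> i /andP[id_ is_]; rewrite mulr_sumr gpr_sum big1_seq // => j /andP[_ jt].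
  apply: (@gpr_neq _ _ _ (rc_sum g) (i + j)).
    by apply: zcomp_mul; exact: (gprP (rc_sum g)).
  rewrite eq_sym; apply/eqP => e1.
  have h1 := dmax i is_; have h2 := emax j jt.
  have : (i < d)%R by rewrite Order.POrderTheory.lt_neqAle id_.
  by move/(fun h => Num.Theory.ltr_leD h h2); rewrite e1 Order.POrderTheory.ltxx.
exact: Pc.
Qed.

Section FiniteGeneration.
Variable ms : seq A.
Hypothesis ms_pos : forall a, a \in ms -> exists2 j, (0 < j)%N & gr_comp j a.
Hypothesis ms_gen : forall J : set A, hideal (g := g) J -> (forall a, a \in ms -> J a) ->
  @irrelevant_ideal A `<=` J.

Lemma ms_hom_elt a : a \in ms -> hom_elt (g := g) a.
Proof. by move=> /ms_pos[j _ ja]; exists (Posz j). Qed.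

Lemma ms_irrelevant a : a \in ms -> @irrelevant_ideal A a.
Proof.
move=> /ms_pos[j j0 ja]; exists [:: j], (fun i => if i == j then a else 0); split.
- by move=> i; rewrite inE => /eqP->.
- by move=> i; case: eqP => [->//|_]; exact: (ids0 (@gr_sum A)).
- by rewrite big_seq1 eqxx.
Qed.

Definition power_filter : set (set A) := base_filter (g := g) ms.

Lemma power_gabriel : gabriel (g := g) power_filter.
Proof. exact: (@base_gabriel g ms ms_hom_elt). Qed.

(** A power of A+ is contained in any homogeneous ideal that contains the
    products of as many of its generators. The induction is on the number of
    factors, for all J at once. *)
Lemma prod_irrelevant k (J : set A) (a : 'I_k -> A) : hideal (g := g) J ->
  (forall b, b \in prodseq (g := g) (nseq k ms) -> J b) ->
  (forall i, @irrelevant_ideal A (a i)) -> J (\prod_i a i).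
Proof.
elim: k J a => [|k IH] J a hJ h ha.
  by rewrite big_ord0; apply: h; exact: mem_head.
rewrite big_ord_recl.
(* J2 is homogeneous because A+ is generated by homogeneous elements. *)
pose J2 : set A := [set b | forall x, @irrelevant_ideal A x -> J (x * b)].
suff h2 : J2 (\prod_i a (lift ord0 i)) by apply: h2; exact: ha.
have Jx x : @irrelevant_ideal A x -> forall b, hom_elt (g := g) b ->
    (forall c, c \in ms -> J (c * b)) -> J (x * b).
  move=> xA b hb hc.
  by apply: (@ms_gen [set y | J (y * b)]) => //; exact: hideal_colon_hom.
have [[J0 JD JM] Jpr] := hJ.
apply: IH => //; last first.
  move=> b bl x xA; apply: Jx => //.
    apply: (@prodseq_hom g [set ms]) bl => [s ->|s]; first exact: ms_hom_elt.
    by rewrite mem_nseq => /andP[_ /eqP].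
  by move=> c cm; apply: h; apply: allpairs_f.
split.
  split.
  - by move=> x _; rewrite mulr0.
  - by move=> b c hb hc x xA; rewrite mulrDr; apply: JD; auto.
  - by move=> b c hc x xA; rewrite mulrCA; apply: JM; exact: hc.
move=> d b hb x xA; apply: Jx => //; first by exists d; exact: (gprP (rc_sum g)).
move=> c cm; have [e ec] := ms_hom_elt cm.
rewrite mulrC -(pr_mul _ _ ec); apply: Jpr; rewrite mulrC; apply: hb.
exact: ms_irrelevant.
Qed.

Lemma power_filterP (I : set A) : power_filter I <-> hideal (g := g) I /\
  exists k, forall a, ideal_pow (@irrelevant_ideal A) k a -> I a.
Proof.
split=> [[hI [l [lG lI]]]|[hI [k hk]]]; split=> //.
  exists (size l) => a; apply; first by case: hI.
  move=> _ [b hb ->]; apply: prod_irrelevant => // c cl; apply: lI.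
  suff -> : l = nseq (size l) ms by [].
  by apply/all_pred1P/allP => s /lG ->; exact: eqxx.
exists (nseq k ms); split; first by move=> s; rewrite mem_nseq => /andP[_ /eqP].
move=> a al; apply: hk => J iJ; apply.
elim: k a al => [|k IH] a /=.
  rewrite inE => /eqP->; exists (fun i : 'I_0 => 0); first by case.
  by rewrite big_ord0.
move=> /allpairsP[[x y] /= [xm /IH[b hb ->] ->]].
exists (fun i : 'I_k.+1 => if unlift ord0 i is Some j then b j else x).
  by move=> i; case: unliftP => [j _|_]; [exact: hb | exact: ms_irrelevant].
rewrite big_ord_recl unlift_none; congr (_ * _).
by apply: eq_bigr => i _; rewrite liftK.
Qed.

Lemma TorsE (M : Gr A) : Tors M <-> @torsion_of g Gr_modcat power_filter M.
Proof.
split=> [tM x|tM n x nx].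
  apply: (@homsub_pr_in g (gmod_of M)); first exact: (tors_homsub power_gabriel).
  move=> d; have dx := gprP (gsum (gmod_of M)) d x.
  exists (annihilator (g := g) (M := gmod_of M) (gpr (gsum (gmod_of M)) d x)) => //.
  apply/power_filterP; split; first exact: hideal_annihilator dx.
  exact: tM dx.
have [I /power_filterP[_ [k hk]] Ix] := tM x.
by exists k => a /hk/Ix.
Qed.

Lemma unit_sub_power : mcF Gr_modcat `<=` power_filter.
Proof.
move=> I FI; have /= I1 := unit_filter1 FI; have hI : hideal (g := g) I by case: FI.
by split=> //; exists [::]; split=> // a; rewrite inE => /eqP->.
Qed.

Lemma TorsEq : @Tors A = @torsion_of g Gr_modcat power_filter.
Proof. by apply/funext => M; apply/propext; exact: TorsE. Qed.

Lemma Tors_class : @torsion_class Gr_modcat (@Tors A).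
Proof.
by rewrite TorsEq; apply: torsion_of_class; [exact: power_gabriel | exact: unit_sub_power].
Qed.

Lemma Tors_shift : shift_invariant (C := Gr_modcat) (@Tors A).
Proof. by rewrite TorsEq; exact: torsion_of_shift. Qed.

Definition QGr_modcat : modcat g := quot_modcat Tors_class Tors_shift.

Lemma QGr_filter : mcF QGr_modcat = power_filter.
Proof.
rewrite /= TorsEq filter_of_torsion //; first exact: power_gabriel.
exact: unit_sub_power.
Qed.

Lemma QGr_correspondence : inverse_bijections
  (fun V : set (Proj A) => union_of_qc_co_open V)
  (fun S : QGr A -> Prop => (torsion_class S /\ shift_invariant (C := QGr_modcat) S)
    /\ finite_type S)
  (fun (V : set (Proj A)) (M : QGr A) => gsupp (QGr_module M) `<=` V)
  (fun S : QGr A -> Prop =>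
    [set P : Proj A | exists M : QGr A, S M /\ gsupp (QGr_module M) P]).
Proof.
have suppE (M : QGr A) : msupp (g := g) (@proj_ideal A) (C := QGr_modcat) M =
    gsupp (QGr_module M).
  apply/seteqP; split=> P /=.
    move=> [u hu]; apply/nonzero_localization; exists u => a [[j ja] nPa].
    by apply: hu => //; exists (Posz j).
  move=> /nonzero_localization[u hu]; exists u => a ha nPa; apply: hu.
  by split=> //; exact: hom_elt_nat.
apply: inverse_bijections_ext (@torsion_correspondence g _ (Proj A) (@proj_ideal A) ms
  _ _ _ _ _ _ QGr_modcat QGr_filter).
- by [].
- by apply/funext => V; apply/funext => M; rewrite suppE.
- by apply/funext => S; apply/seteqP; split=> P [M [SM sM]]; exists M; split=> //;
    move: sM; rewrite suppE.
- exact: hom_prime_int.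
- move=> U; rewrite (_ : @hideal g = @homogeneous_ideal A) //.
  by apply/funext => I; apply/propext; exact: iff_sym (homogeneous_idealE I).
- exact: proj_prime.
- by move=> P; apply/homogeneous_idealE; exact: proj_homogeneous.
- exact: ms_hom_elt.
- move=> P h; apply: (@proj_relevant A P); apply: ms_gen h.
  by apply/homogeneous_idealE; exact: proj_homogeneous.
- move=> P hP pP nP; have hP' : homogeneous_ideal P by apply/homogeneous_idealE.
  have nr : ~ @irrelevant_ideal A `<=` P.
    by move=> h; apply: nP => a /ms_irrelevant/h.
  by exists (MkProj pP hP' nr).
Qed.

End FiniteGeneration.

(** For the homogeneous components [ms] of positive degree of the generators
    of A, the set A_0 + J is a subring that contains these generators, so it
    is A; a component of positive degree of an element then lies in J. *)
Lemma irrelevant_fg : fg_algebra A -> exists ms : seq A,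
  (forall a, a \in ms -> exists2 j, (0 < j)%N & gr_comp j a) /\
  forall J : set A, hideal (g := g) J -> (forall a, a \in ms -> J a) ->
    @irrelevant_ideal A `<=` J.
Proof.
move=> [gens hgens].
have [ms [mpos mgen]] : exists ms : seq A,
    (forall a, a \in ms -> exists2 j, (0 < j)%N & gr_comp j a) /\
    forall B : set A, (forall x y, B x -> B y -> B (x + y)) -> gr_comp 0 `<=` B ->
      (forall x, x \in ms -> B x) -> forall x, x \in gens -> B x.
  elim: gens {hgens} => [|x gens [ms [mpos mgen]]]; first by exists [::].
  have [_ /(_ x)[s [a [us ha xE]]] _] := @gr_sum A.
  exists ([seq a j | j <- s & (0 < j)%N] ++ ms); split.
    move=> y; rewrite mem_cat => /orP[/mapP[j]|/mpos//].
    by rewrite mem_filter => /andP[j0 _] ->; exists j.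
  move=> B BD B0 Bm y; rewrite inE => /orP[/eqP->|yg]; last first.
    by apply: (mgen B) yg => // z zm; apply: Bm; rewrite mem_cat zm orbT.
  rewrite xE big_seq; elim/big_ind: _ => [||j js].
  - by apply: B0; exact: (ids0 (@gr_sum A)).
  - exact: BD.
  - case: j js => [|j] js; first exact: B0.
    by apply: Bm; rewrite mem_cat map_f // mem_filter js.
exists ms; split=> // J hJ mJ; have [[J0 JD JM] Jpr] := hJ.
have JN x : J x -> J (- x) by move=> Jx; rewrite -mulN1r; exact: JM.
pose B : set A := [set x | exists2 a0, gr_comp 0 a0 & J (x - a0)].
have h0 := @gr_sum A.
have BT : B = setT.
  apply: hgens.
  - by move=> x x0; exists x => //; rewrite subrr.
  - apply: mgen.
    + move=> x y [a a0 Ja] [b b0 Jb]; exists (a + b); first exact: (idsD h0).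
      by rewrite opprD addrACA; exact: JD.
    + by move=> x x0; exists x => //; rewrite subrr.
    + by move=> x /mJ Jx; exists 0; [exact: (ids0 h0) | rewrite subr0].
  - move=> x y [a a0 Ja] [b b0 Jb]; exists (a - b); first exact: (idsB h0).
    rewrite (_ : x - y - (a - b) = (x - a) - (y - b)); last by ring.
    by apply: JD => //; exact: JN.
  - move=> x y [a a0 Ja] [b b0 Jb]; exists (a * b); first exact: (@gr_mul A 0 0).
    rewrite (_ : x * y - a * b = y * (x - a) + a * (y - b)); last by ring.
    by apply: JD; exact: JM.
move=> x [s [a [s0 ha ->]]]; rewrite big_seq; elim/big_ind: _ => //.
move=> j js; have [b b0 Jab] : B (a j) by rewrite BT.
have := Jpr (Posz j) _ Jab; rewrite gprB gpr_id; last exact: ha.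
rewrite (@gpr_neq _ _ _ (rc_sum g) 0) ?subr0 //.
by have := s0 j js; case: j {js Jab}.
Qed.

End GradedInstance.

(** * Tensor products of graded modules *)

Section TensorProduct.
Variable g : grading.
Local Notation R := (gR g).
Local Notation G := (gG g).
Local Notation rc := (@rc g).
Local Notation gmod := (gmod g).
Variables X Y : gmod.

(** The homogeneous components of an R-bilinear map are not R-linear, but they
    are balanced, so the tensor product is built from balanced maps to abelian
    groups. *)
Record balanced (V : zmodType) (c : X -> Y -> V) : Prop := Balanced {
  balDl : forall x x' y, c (x + x') y = c x y + c x' y;
  balDr : forall x y y', c x (y + y') = c x y + c x y';
  balZ : forall a x y, c (a *: x) y = c x (a *: y)
}.

Lemma bal0l (V : zmodType) (c : X -> Y -> V) y : balanced c -> c 0 y = 0.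
Proof. by move=> bc; apply: (addrI (c 0 y)); rewrite -(balDl bc) !addr0. Qed.

Lemma bal0r (V : zmodType) (c : X -> Y -> V) x : balanced c -> c x 0 = 0.
Proof. by move=> bc; apply: (addrI (c x 0)); rewrite -(balDr bc) !addr0. Qed.

Local Notation M := (dprod (fun _ : Y => X)).

(** A finitely supported m : Y -> X stands for the sum of the tensors of m y
    and y. *)
Definition bal_eval (V : zmodType) (c : X -> Y -> V) (m : M) : V :=
  fsum (fun (y : Y) (x : X) => c x y) m.

Section Evaluation.
Variables (V : zmodType) (c : X -> Y -> V).
Hypothesis bc : balanced c.

Lemma bal_eval_unit x y : bal_eval c (dunit (X := fun _ : Y => X) (i := y) x) = c x y.
Proof. by rewrite /bal_eval fsum_dunit // => i; exact: bal0l. Qed.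

Lemma bal_evalD m n : finsupp m -> finsupp n ->
  bal_eval c (m + n) = bal_eval c m + bal_eval c n.
Proof.
move=> fm fn; apply: fsumD => //; first by move=> i; exact: bal0l.
by move=> i x y; exact: balDl.
Qed.

Lemma bal_evalE m s : uniq s -> (forall y, y \notin s -> m y = 0) ->
  bal_eval c m = \sum_(y <- s) c (m y) y.
Proof. by move=> us m0; apply: fsumE => // i; exact: bal0l. Qed.

Lemma bal_eval0 : bal_eval c 0 = 0.
Proof. by rewrite (@bal_evalE _ [::]) ?big_nil. Qed.

Lemma balanced_scale a : balanced (fun x y => c (a *: x) y).
Proof.
split=> [x x' y|x y y'|b x y]; first by rewrite scalerDr balDl.
  by rewrite balDr.
by rewrite scalerA mulrC -scalerA (balZ bc).
Qed.
End Evaluation.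

Lemma bal_evalZ (V : zmodType) (c : X -> Y -> V) a m : balanced c -> finsupp m ->
  bal_eval c (a *: m) = bal_eval (fun x y => c (a *: x) y) m.
Proof.
move=> bc [s [us m0]]; rewrite (bal_evalE (balanced_scale bc a) us m0).
by rewrite (@bal_evalE _ _ bc _ s) // => y /m0 my; rewrite dprodZE my scaler0.
Qed.

(** The component of degree [d] of a balanced map: homogeneous x and y
    contribute when their degrees add up to [d]. *)
Definition bal_comp (V : zmodType) (c : X -> Y -> V) (d : G) (x : X) (y : Y) : V :=
  fsum (fun (e : G) (w : Y) => c ('pr_(d - e) x) w)
    ((fun e => 'pr_e y) : dprod (fun _ : G => Y)).

Lemma finsupp_pr (y : Y) : finsupp ((fun e => 'pr_e y) : dprod (fun _ : G => Y)).
Proof. by have [s [us s0 _]] := gpr_supp (gsum Y) y; exists s. Qed.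

Lemma bal_compDl (V : zmodType) (c : X -> Y -> V) d x x' y : balanced c ->
  bal_comp c d (x + x') y = bal_comp c d x y + bal_comp c d x' y.
Proof.
move=> bc; have [s [us s0]] := finsupp_pr y.
have f0 z e : c ('pr_(d - e) z) 0 = 0 by exact: bal0r.
rewrite /bal_comp !(@fsumE _ _ _ _ _ (f0 _) _ s us s0) -big_split /=.
by apply: eq_bigr => e _; rewrite gprD (balDl bc).
Qed.

Lemma bal_compDr (V : zmodType) (c : X -> Y -> V) d x y y' : balanced c ->
  bal_comp c d x (y + y') = bal_comp c d x y + bal_comp c d x y'.
Proof.
move=> bc; rewrite /bal_comp -fsumD.
- by congr fsum; apply: dprod_ext => e; rewrite dprodDE gprD.
- by move=> e; exact: bal0r.
- by move=> e w w'; exact: balDr.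
- exact: finsupp_pr.
- exact: finsupp_pr.
Qed.

Lemma bal_comp_hom (V : zmodType) (c : X -> Y -> V) d p q x y : balanced c ->
  gcmp p x -> gcmp q y -> bal_comp c d x y = if d == p + q then c x y else 0.
Proof.
move=> bc px qy; rewrite /bal_comp (@fsumE _ _ _ _ _ _ _ [:: q]) //.
- rewrite big_seq1 (gpr_id _ qy); case: eqP => [->|ne].
    by rewrite addrK (gpr_id _ px).
  rewrite (gpr_neq _ px) ?(bal0l _ bc) //; apply/eqP => e; apply: ne.
  by rewrite -e subrK.
- by move=> e; exact: bal0r.
- by move=> e; rewrite inE => eq; exact: (gpr_neq _ qy).
Qed.

Lemma bal_comp_balanced (V : zmodType) (c : X -> Y -> V) d : balanced c ->
  balanced (bal_comp c d).
Proof.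
move=> bc; split=> [x x' y|x y y'|]; [exact: bal_compDl|exact: bal_compDr|].
have z0l y : bal_comp c d 0 y = 0.
  by apply: (addrI (bal_comp c d 0 y)); rewrite -bal_compDl // !addr0.
have z0r x : bal_comp c d x 0 = 0.
  by apply: (addrI (bal_comp c d x 0)); rewrite -bal_compDr // !addr0.
apply: (gpr_ind (rc_sum g)).
- by move=> x y; rewrite !scale0r z0l z0r.
- by move=> a b ha hb x y; rewrite !scalerDl bal_compDl // bal_compDr // ha hb.
move=> e a ea; apply: (gpr_ind (gsum X)).
- by move=> y; rewrite scaler0 !z0l.
- by move=> x x' hx hx' y; rewrite scalerDr !bal_compDl // hx hx'.
move=> p x px; apply: (gpr_ind (gsum Y)).
- by rewrite scaler0 !z0r.
- by move=> y y' hy hy'; rewrite scalerDr !bal_compDr // hy hy'.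
move=> q y qy; rewrite (bal_comp_hom _ bc (gscal ea px) qy).
rewrite (bal_comp_hom _ bc px (gscal ea qy)) (balZ bc).
by rewrite addrCA addrA.
Qed.

(** The additive span of the homogeneous tensors of total degree [d]. *)
Definition tensor_piece (d : G) : set M := [set m | forall Q : set M, Q 0 ->
  (forall m n, Q m -> Q n -> Q (m + n)) ->
  (forall e x y, gcmp e y -> gcmp (d - e) x ->
    Q (dunit (X := fun _ : Y => X) (i := y) x)) -> Q m].

(** The common kernel of all balanced evaluations. *)
Definition tensor_rel : set M := [set m | finsupp m /\
  forall (V : zmodType) (c : X -> Y -> V), balanced c -> bal_eval c m = 0].

Lemma tensor_piece_finsupp d m : tensor_piece d m -> finsupp m.
Proof.
by apply; [exact: finsupp0 | exact: finsuppD | move=> *; exact: finsupp_dunit].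
Qed.

Lemma tensor_piece0 d : tensor_piece d 0.
Proof. by move=> Q. Qed.

Lemma tensor_pieceD d m n : tensor_piece d m -> tensor_piece d n -> tensor_piece d (m + n).
Proof. by move=> hm hn Q Q0 QD Qu; apply: (QD); [exact: hm | exact: hn]. Qed.

Lemma tensor_piece_unit d e x y : gcmp e y -> gcmp (d - e) x ->
  tensor_piece d (dunit (X := fun _ : Y => X) (i := y) x).
Proof. by move=> ey dx Q _ _ h; exact: (h e). Qed.

Lemma tensor_pieceZ e d a m : rc e a -> tensor_piece d m -> tensor_piece (e + d) (a *: m).
Proof.
move=> ea hm; apply: (hm [set m | tensor_piece (e + d) (a *: m)]) => /=.
- by rewrite scaler0; exact: tensor_piece0.
- by move=> m1 n1 h1 h2; rewrite scalerDr; exact: tensor_pieceD.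
- move=> e' x y ey dx; rewrite -dunitZ; apply: tensor_piece_unit ey _.
  by rewrite -addrA; exact: gscal.
Qed.

Lemma tensor_pieceB d m n : tensor_piece d m -> tensor_piece d n -> tensor_piece d (m - n).
Proof.
move=> hm hn; apply: tensor_pieceD => //.
apply: (hn [set n | tensor_piece d (- n)]) => /=.
- by rewrite oppr0; exact: tensor_piece0.
- by move=> m1 n1 h1 h2; rewrite opprD; exact: tensor_pieceD.
- move=> e x y ey dx; rewrite -scaleN1r -dunitZ scaleN1r; apply: tensor_piece_unit ey _.
  by rewrite -[- x]sub0r; apply: gcmpB => //; exact: gcmp0.
Qed.

Lemma tensor_rel_sub : submodule tensor_rel.
Proof.
split.
- by split; [exact: finsupp0 | move=> V c bc; exact: bal_eval0].
- move=> m n [fm hm] [fn hn]; split; first exact: finsuppD.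
  by move=> V c bc; rewrite bal_evalD // hm // hn // addr0.
- move=> a m [fm hm]; split; first exact: finsuppZ.
  by move=> V c bc; rewrite bal_evalZ // hm //; exact: balanced_scale.
Qed.

Lemma bal_eval_comp (V : zmodType) (c : X -> Y -> V) d d' m : balanced c ->
  tensor_piece d' m -> bal_eval (bal_comp c d) m = if d == d' then bal_eval c m else 0.
Proof.
move=> bc hm; have bcd := bal_comp_balanced d bc.
suff [] : finsupp m /\ bal_eval (bal_comp c d) m = if d == d' then bal_eval c m else 0 by [].
apply: (hm [set m | finsupp m /\ bal_eval (bal_comp c d) m =
  if d == d' then bal_eval c m else 0]) => /=.
- by split; [exact: finsupp0 | rewrite !bal_eval0 // if_same].
- move=> m1 n1 [f1 h1] [f2 h2]; split; first exact: finsuppD.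
  by rewrite !bal_evalD // h1 h2; case: eqP => _; rewrite ?addr0.
- move=> e x y ey dx; split; first exact: finsupp_dunit.
  by rewrite !bal_eval_unit // (bal_comp_hom _ bc dx ey) subrK.
Qed.

(** Evaluation with the component of degree [d] of c isolates the term of
    degree [d]. *)
Lemma tensor_indep s (a : G -> M) : uniq s -> (forall d, tensor_piece d (a d)) ->
  tensor_rel (\sum_(d <- s) a d) -> forall d, d \in s -> tensor_rel (a d).
Proof.
move=> us ha [_ hs] d ds; split; first exact: tensor_piece_finsupp (ha d).
move=> V c bc; have bcd := bal_comp_balanced d bc.
rewrite -(hs V _ bcd).
have -> : bal_eval (bal_comp c d) (\sum_(d <- s) a d) = \sum_(e <- s) bal_eval (bal_comp c d) (a e).
  suff [] : finsupp (\sum_(d <- s) a d) /\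
    bal_eval (bal_comp c d) (\sum_(d <- s) a d) = \sum_(e <- s) bal_eval (bal_comp c d) (a e) by [].
  elim: s {us hs ds} => [|e s [IH1 IH2]].
    by rewrite !big_nil; split; [exact: finsupp0 | exact: bal_eval0].
  have fe := tensor_piece_finsupp (ha e).
  by rewrite !big_cons; split; [exact: finsuppD | rewrite bal_evalD // IH2].
rewrite (bigD1_seq d) //= big1 ?addr0; first by rewrite (bal_eval_comp d bc (ha d)) eqxx.
by move=> e ed; rewrite (bal_eval_comp d bc (ha e)) eq_sym (negbTE ed).
Qed.

Lemma tensor_ex : exists (T : gmod) (b : X -> Y -> T),
  [/\ (forall x, linear (b x)) /\ (forall y, linear (b^~ y)),
      forall (L : lmodType R) (c : X -> Y -> L),
        (forall x, linear (c x)) -> (forall y, linear (c^~ y)) ->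
        exists f : {linear T -> L}, forall x y, f (b x y) = c x y,
      forall (i j : G) x y, gcmp i x -> gcmp j y -> gcmp (i + j) (b x y)
    & forall Q : T -> Prop, Q 0 -> (forall t u, Q t -> Q u -> Q (t + u)) ->
        (forall x y, Q (b x y)) -> forall t, Q t].
Proof.
have gs := gspan_sub tensor_piece0 tensor_pieceB tensor_pieceZ.
have [P0 PD PZ] := gs.
have [T [cl [clD clZ cl0 clS clC]]] := graded_subquotient_ex tensor_piece0
  tensor_pieceB tensor_pieceZ tensor_rel_sub tensor_indep.
have PN m : gspan tensor_piece m -> gspan tensor_piece (- m) by exact: submodN.
have fP m : gspan tensor_piece m -> finsupp m.
  move=> [f [hf [s [_ _ ->]]]]; elim/big_ind: _ => [||d _]; [exact: finsupp0|exact: finsuppD|].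
  exact: tensor_piece_finsupp (hf d).
have CP d m : tensor_piece d m -> gspan tensor_piece m.
  by move=> h; apply: gspan_homog h; exact: tensor_piece0.
have cl_eq m n : gspan tensor_piece m -> gspan tensor_piece n ->
    (forall (V : zmodType) (c : X -> Y -> V), balanced c -> bal_eval c m = bal_eval c n) ->
    cl m = cl n.
  move=> Pm Pn e; apply/eqP; rewrite -subr_eq0; apply/eqP.
  have Pmn : gspan tensor_piece (m - n) by apply: PD => //; exact: PN.
  rewrite -[- cl n]scaleN1r -clZ // scaleN1r -clD //; last exact: PN.
  apply/cl0 => //; split; first exact: fP.
  move=> V c bc; have fn := fP _ (PN _ Pn); have h0 := bal_eval0 bc.
  rewrite bal_evalD //; last exact: fP.
  by rewrite (e _ _ bc) -bal_evalD ?subrr //; exact: fP.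
have Bex (xy : X * Y) : exists m, gspan tensor_piece m /\
    forall (V : zmodType) (c : X -> Y -> V), balanced c -> bal_eval c m = c xy.1 xy.2.
  case: xy => x y /=; move: x; apply: (gpr_ind (gsum X)).
  - by exists 0; split=> // V c bc; rewrite bal_eval0 // bal0l.
  - move=> x x' [m [Pm hm]] [n [Pn hn]]; exists (m + n); split; first exact: PD.
    move=> V c bc; rewrite bal_evalD // ?hm ?hn // ?(balDl bc) //; exact: fP.
  move=> p x px; move: y; apply: (gpr_ind (gsum Y)).
  - by exists 0; split=> // V c bc; rewrite bal_eval0 // bal0r.
  - move=> y y' [m [Pm hm]] [n [Pn hn]]; exists (m + n); split; first exact: PD.
    move=> V c bc; rewrite bal_evalD // ?hm ?hn // ?(balDr bc) //; exact: fP.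
  move=> q y qy; exists (dunit (X := fun _ : Y => X) (i := y) x); split.
    by apply: (CP (p + q)); apply: tensor_piece_unit qy _; rewrite addrK.
  by move=> V c bc; rewrite bal_eval_unit.
have /choice[B0 hB0] := Bex; pose B x y := B0 (x, y).
have PB x y : gspan tensor_piece (B x y) by case: (hB0 (x, y)).
have BE x y (V : zmodType) (c : X -> Y -> V) : balanced c -> bal_eval c (B x y) = c x y.
  by move=> bc; case: (hB0 (x, y)) => _ ->.
have fB x y : finsupp (B x y) by exact: fP.
have bal_lin (L : lmodType R) (c : X -> Y -> L) :
    (forall x, linear (c x)) -> (forall y, linear (c^~ y)) -> balanced c.
  move=> c1 c2.
  have c0 x : c x 0 = 0 by have := c1 x (-1) 0 0; rewrite scaler0 addr0 scaleN1r addNr.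
  have c0' y : c 0 y = 0 by have := c2 y (-1) 0 0; rewrite scaler0 addr0 scaleN1r addNr.
  split=> [x x' y|x y y'|a x y].
  - by have := c2 y 1 x x'; rewrite !scale1r.
  - by have := c1 x 1 y y'; rewrite !scale1r.
  - have := c2 y a x 0; have := c1 x a y 0.
    by rewrite !addr0 c0 c0' !addr0 => -> ->.
exists T, (fun x y => cl (B x y)); split.
- split=> [x a y y'|y a x x'].
    rewrite -clZ // -clD //; last exact: PZ.
    apply: cl_eq => [//||V c bc]; first by apply: PD => //; exact: PZ.
    rewrite bal_evalD //; last exact: finsuppZ.
    by rewrite bal_evalZ // !BE ?(balDr bc) ?(balZ bc) //; exact: balanced_scale.
  rewrite -clZ // -clD //; last exact: PZ.
  apply: cl_eq => [//||V c bc]; first by apply: PD => //; exact: PZ.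
  rewrite bal_evalD //; last exact: finsuppZ.
  by rewrite bal_evalZ // !BE ?(balDl bc) //; exact: balanced_scale.
- move=> L c c1 c2; have bc := bal_lin L c c1 c2.
  have /choice[r hr] q : exists m, gspan tensor_piece m /\ cl m = q.
    by have [m ? ?] := clS q; exists m.
  have wd m : gspan tensor_piece m -> bal_eval c (r (cl m)) = bal_eval c m.
    move=> Pm; have [Pr e] := hr (cl m).
    have Pd : gspan tensor_piece (m - r (cl m)) by apply: PD => //; exact: PN.
    have [_ /(_ _ _ bc) h0] : tensor_rel (m - r (cl m)).
      apply/cl0 => //; rewrite clD //; last exact: PN.
      by rewrite -scaleN1r clZ // e scaleN1r subrr.
    rewrite -[in RHS](subrK (r (cl m)) m) bal_evalD ?h0 ?add0r //; exact: fP.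
  have evZ a m : finsupp m -> bal_eval c (a *: m) = a *: bal_eval c m.
    move=> [s [us m0]]; rewrite (bal_evalE bc us m0) (@bal_evalE _ _ bc _ s) //.
      rewrite scaler_sumr; apply: eq_bigr => y _; rewrite dprodZE.
      by have := c2 y a (m y) 0; rewrite !addr0 (bal0l y bc) addr0.
    by move=> y /m0 my; rewrite dprodZE my scaler0.
  have [f fE] : exists f : {linear T -> L}, f =1 fun q => bal_eval c (r q).
    apply: lin_ex => [p q|a q].
      have [Pp <-] := hr p; have [Pq <-] := hr q.
      rewrite -clD // !wd //; last exact: PD.
      by apply: bal_evalD => //; exact: fP.
    have [Pq <-] := hr q; rewrite -clZ // !wd ?evZ //; last exact: PZ.
    exact: fP.
  by exists f => x y; rewrite fE wd // BE.
- move=> i j x y ix jy; apply/clC.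
  have tu : tensor_piece (i + j) (dunit (X := fun _ : Y => X) (i := y) x).
    by apply: tensor_piece_unit jy _; rewrite addrK.
  exists (dunit (X := fun _ : Y => X) (i := y) x) => //.
  by apply: cl_eq => // [|V c bc]; [exact: CP tu | rewrite BE // bal_eval_unit].
- move=> Q Q0 QD Qb; apply: (gpr_ind (gsum T)) => // d q /clC[m hm <-].
  suff [] : gspan tensor_piece m /\ Q (cl m) by [].
  apply: (hm [set m | gspan tensor_piece m /\ Q (cl m)]) => /=.
  + split=> //; suff -> : cl 0 = 0 by [].
    by apply/cl0 => //; case: tensor_rel_sub.
  + by move=> m1 n1 [P1 Q1] [P2 Q2]; split; [exact: PD | rewrite clD //; exact: QD].
  + move=> e x y ey dx; have tu := tensor_piece_unit ey dx.
    split; first exact: CP tu.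
    rewrite (cl_eq _ (B x y)) //; first exact: CP tu.
    by move=> V c bc; rewrite BE // bal_eval_unit.
Qed.

End TensorProduct.

(** * Tensor torsion classes and shifts *)

Section TensorTorsion.
Variables (A : graded_ring) (ms : seq A).
Hypothesis ms_pos : forall a, a \in ms -> exists2 j, (0 < j)%N & gr_comp j a.
Hypothesis ms_gen : forall J : set A, hideal (g := zgrading A) J ->
  (forall a, a \in ms -> J a) -> @irrelevant_ideal A `<=` J.
Local Notation g := (zgrading A).
Local Notation D := (QGr_modcat ms_pos ms_gen).
Local Notation GrC := (Gr_modcat A).
Local Notation F := (mcF D).

Let gF : gabriel F := mcF_gab D.

(** A map to a closed module with torsion kernel and torsion cokernel is a
    reflection. *)
Lemma is_Q_intro (T : graded_module A) (Z : D) (eta : {linear T -> QGr_module Z}) :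
  deg0 (M := gmod_of T) (N := und Z) eta ->
  (forall m, eta m = 0 -> tors F (m : gmod_of T)) ->
  (forall z : und Z, @sat g F (und Z) (range eta) z) ->
  is_Q (T : Gr A) (Z : QGr A).
Proof.
move=> de ke dense; exists (@GradedHom A T (QGr_module Z) eta de).
move=> W f.
have [|h hE] := @extend_dense g D (gmod_of T) Z W eta (gh_lin f) de (@gh_degree _ _ _ f) dense.
  move=> m /ke tm; apply: (@und_tors g D W); apply/sat_preim.
  by apply: sat_mono tm => // x /= ->; rewrite linear0.
exists h; split.
  by apply: (@act_inj g GrC _ (sval W)) => x; exact: hE.
move=> h' h'E; apply: (@dense_epi g D (gmod_of T) Z W eta h h' dense) => m.
by rewrite hE -h'E.
Qed.

(** What kills x kills its tensor with any y, so the tensor product is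
    torsion; then so is its reflection, by [torsion_retract]. *)
Lemma shift_tensor_torsion (S : D -> Prop) : torsion_class S -> shift_invariant S ->
  tensor_torsion_class (S : QGr A -> Prop).
Proof.
move=> hS shS; split=> // X Y Z [T [b [[[b1 b2] bu bd] [eta ueta]]]] SX.
have gS := filter_of_gabriel hS shS.
have tX := (S_char hS shS X).1 SX.
have bZ a x y : b (a *: x) y = a *: b x y.
  have b0 : b 0 y = 0.
    by have := b2 y (-1) 0 0; rewrite scaler0 addr0 scaleN1r addNr.
  by have := b2 y a x 0; rewrite !addr0 b0 addr0.
have b0 y : b 0 y = 0 by rewrite -(scale0r (0 : QGr_module X)) bZ scale0r.
have tb x y : tors (filter_of S) (b x y : gmod_of T).
  have [I FI Ix] := tX x; exists I => // a Ia; rewrite /= -bZ.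
  by rewrite (Ix a Ia) b0.
have [K [i [di ii ir]]] := gsub_ex (tors_homsub gS (gmod_of T)).
have /choice[c0 hc0] (xy : QGr_module X * QGr_module Y) : exists k, i k = b xy.1 xy.2.
  have [k _ kE] : range i (b xy.1 xy.2) by rewrite ir; exact: tb.
  by exists k.
have hc x y : i (c0 (x, y)) = b x y by exact: hc0.
have [f [fE _]] : exists! f : {linear T -> gcar K}, forall x y, f (b x y) = c0 (x, y).
  apply: (bu (gcar K) (fun x y => c0 (x, y))); split=> [x a y y'|y a x x']; apply: ii.
    by rewrite linearD linearZ /= !hc b1.
  by rewrite linearD linearZ /= !hc b2.
have tT (t : gmod_of T) : tors (filter_of S) t.
  have [w [_ wu]] := bu T b (conj b1 b2).
  have [h hE] := lin_comp_ex (i) (f).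
  have [e eE] : exists e : {linear T -> T}, e =1 id by exact: lin_ex.
  have : h = e.
    rewrite -(wu h); last by move=> x y; rewrite hE /= fE hc.
    by rewrite (wu e) // => x y; rewrite eE.
  move=> he; rewrite -ir; exists (f t) => //.
  by rewrite -[RHS](eE t) -he hE.
apply/(S_char hS shS).
apply: (@torsion_retract g D (filter_of S) gS (sub_filter_of hS)) => K' i' i'i i'r.
have [|v vE] := @factor_inj g GrC (sval K') (sval Z) T i' eta i'i.
  by move=> _ [t _ <-]; rewrite [range _]i'r; exact: (@tors_map g (filter_of S) (gmod_of T) (@und g D Z) (gh_lin eta) t (tT t)).
have [r [rE _]] := ueta K' v; exists r.
have [w [_ wu]] := ueta Z eta.
rewrite -(wu (i' \oc r)); first by rewrite (wu (idm Z)) //; exact: (cmp1m (c := Gr A)).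
by rewrite -[RHS]vE -rE; exact: (esym (cmpA (c := Gr A) i' r eta)).
Qed.

(** A shift X' = X(t), with f : X -> X' the identity, is the reflection of the
    tensor product of X with Y, the reflection of A(t). Let e in Y come from
    1. A member of the filter multiplies any y in Y into A e, so there is a
    pairing mu of X and Y with values in X' such that a (mu x y) = r (f x)
    whenever a y = r e, for a in a member of the filter. It defines a map from
    the tensor product to X', which is onto since mu x e = f x, and whose
    kernel is torsion since each tensor is multiplied by a member of the
    filter into the tensors with e. *)
Lemma tensor_shift (S : D -> Prop) :
  tensor_torsion_class (S : QGr A -> Prop) -> shift_invariant S.
Proof.
move=> [_ tS] X X' t f fb fd SX; have [fi [ff fK Kf]] := (bij_inj fb, fb).
have [Y0 [eta0 [de0 ke0 dense0]]] := refl_obj D (regular_gmod g).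
have [Y [k [kb kd]]] := shift_obj Y0 t; have [ki [kk kK Kk]] := (bij_inj kb, kb).
pose e : und Y := k (eta0 (1 : A^o)).
have et : gcmp t e by rewrite -[t]add0r; apply/kd/de0; exact: rc_one.
have aeE a : a *: e = k (eta0 (a : A^o)).
  by rewrite /e -!linearZ /= [a *: (1 : A^o)](mulr1 a).
have e_dense (y : und Y) : exists2 I, F I & forall a, I a -> exists r, a *: y = r *: e.
  have [I FI h] := dense0 (kk y); exists I => // a /h[r _ rE]; exists r.
  by rewrite aeE rE linearZ /= Kk.
have tX' : torsfree F (und X') by exact: und_tors.
have key r x : r *: e = 0 -> r *: f x = 0.
  rewrite aeE => re; have /ke0[I FI h] : eta0 (r : A^o) = 0 by apply: ki; rewrite re linear0.
  apply: tX'; exists I => // a /h ar /=; rewrite scalerA.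
  by have -> : a * r = 0; [exact: ar | rewrite scale0r].
have key2 r r' x : r *: e = r' *: e -> r *: f x = r' *: f x.
  move=> h; apply/eqP; rewrite -subr_eq0 -scalerBl; apply/eqP/key.
  by rewrite scalerBl h subrr.
(* Quantifying over all r makes Mu additive in x without a choice of r. *)
pose Mu x y z := exists2 I, F I & forall a, I a -> forall r, a *: y = r *: e -> a *: z = r *: f x.
have MuF x y z z' : Mu x y z -> Mu x y z' -> z = z'.
  move=> [I FI h] [J FJ h']; have [L FL hL] := e_dense y.
  apply: (tors_eq tX' (gab_cap gF FL (gab_cap gF FI FJ))) => a [La [Ia Ja]].
  by have [r rE] := hL a La; rewrite (h a Ia r rE) (h' a Ja r rE).
have MuDl x x' y z z' : Mu x y z -> Mu x' y z' -> Mu (x + x') y (z + z').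
  move=> [I FI h] [J FJ h']; exists (I `&` J); first exact: gab_cap.
  move=> a [Ia Ja] r rE.
  by rewrite linearD /= !scalerDr (h a Ia r rE) (h' a Ja r rE).
have MuDr x y y' z z' : Mu x y z -> Mu x y' z' -> Mu x (y + y') (z + z').
  move=> [I FI h] [J FJ h']; have [L FL hL] := e_dense y; have [L' FL' hL'] := e_dense y'.
  exists ((L `&` L') `&` (I `&` J)); first by do !apply: gab_cap.
  move=> a [[La L'a] [Ia Ja]] r rE.
  have [r1 r1E] := hL a La; have [r2 r2E] := hL' a L'a.
  rewrite scalerDr (h a Ia r1 r1E) (h' a Ja r2 r2E) -scalerDl; apply: key2.
  by rewrite scalerDl -r1E -r2E -scalerDr.
have MuZl c x y z : Mu x y z -> Mu (c *: x) y (c *: z).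
  move=> [I FI h]; exists I => // a Ia r rE.
  by rewrite [f _]linearZ /= [LHS]scalerA [a * c]mulrC -[LHS]scalerA (h a Ia r rE) !scalerA [c * r]mulrC.
have MuZr c x y z : Mu x y z -> Mu x (c *: y) (c *: z).
  move=> [I FI h]; have [L FL hL] := e_dense y; exists (L `&` I); first exact: gab_cap.
  move=> a [La Ia] r rE; have [r1 r1E] := hL a La.
  rewrite scalerA mulrC -scalerA (h a Ia r1 r1E) scalerA; apply: key2.
  by rewrite -scalerA -r1E -rE !scalerA mulrC.
have Muhom d x : gcmp d x -> forall y, exists z, Mu x y z /\
    forall d', gcmp d' y -> gcmp (d + d') z.
  move=> dx; have [X2 [s [sb sd]]] := shift_obj X' (- d).
  have [si [ss sK Ks]] := (bij_inj sb, sb).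
  have tsx : gcmp t (s (f x)).
    by rewrite -[t](addKr d) addrC; apply/sd/fd.
  have [|||||h [dh hE]] := @closed_extend g F (und Y) (und X2)
      (fun y z => exists2 r, y = r *: e & z = r *: s (f x)) gF (und_closed X2).
  - by move=> _ _ _ _ [r -> ->] [r' -> ->]; exists (r + r'); rewrite scalerDl.
  - by move=> a _ _ [r -> ->]; exists (a * r); rewrite scalerA.
  - move=> d' _ _ [r -> ->]; exists (gpr (rc_sum g) (d' - t) r).
      by rewrite -(pr_scale _ _ et) subrK.
    by rewrite -(pr_scale _ _ tsx) subrK.
  - move=> _ [r /esym re ->]; rewrite -linearZ -[RHS](linear0 s); congr (s _).
    exact: key.
  - move=> y; have [I FI hI] := e_dense y; exists I => // a /hI[r rE].
    by exists (r *: s (f x)), r.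
  move=> y; exists (ss (h y)); split; last first.
    move=> d' d'y; apply/sd; rewrite Ks [d + d']addrC addrK; exact: dh.
  exists setT; first exact: gab_full.
  move=> a _ r rE; apply: si; rewrite !linearZ /= Ks -linearZ; apply: hE.
  by exists r.
have Mutot x y : exists z, Mu x y z.
  move: x; apply: (gpr_ind (gsum (und X))).
  - have [z [hz _]] := Muhom 0 0 (gcmp0 _ _) y; by exists z.
  - by move=> x x' [z hz] [z' hz']; exists (z + z'); exact: MuDl.
  - by move=> d x dx; have [z [hz _]] := Muhom d x dx y; exists z.
have /choice[mu0 hmu0] (xy : und X * und Y) : exists z, Mu xy.1 xy.2 z by exact: Mutot.
pose mu x y := mu0 (x, y); have hmu x y : Mu x y (mu x y) by exact: (hmu0 (x, y)).
have [T0 [b [[b1 b2] bu bd bgen]]] := tensor_ex (und X) (und Y).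
have mu1 x : linear (mu x).
  by move=> a y y'; apply: MuF (hmu _ _) _; apply: MuDr => //; exact: MuZr.
have mu2 y : linear (mu^~ y).
  by move=> a x x'; apply: MuF (hmu _ _) _; apply: MuDl => //; exact: MuZl.
have [eta etaE] := bu (und X') mu mu1 mu2.
have mu_deg d d' x y : gcmp d x -> gcmp d' y -> gcmp (d + d') (mu x y).
  move=> dx d'y; have [z [hz zd]] := Muhom d x dx y.
  by rewrite (MuF _ _ _ _ (hmu x y) hz); exact: zd.
have bZl a x y : b (a *: x) y = a *: b x y.
  have b0 : b 0 y = 0 by have := b2 y (-1) 0 0; rewrite scaler0 addr0 scaleN1r addNr.
  by have := b2 y a x 0; rewrite !addr0 b0 addr0.
have bZr a x y : b x (a *: y) = a *: b x y.
  have b0 : b x 0 = 0 by have := b1 x (-1) 0 0; rewrite scaler0 addr0 scaleN1r addNr.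
  by have := b1 x a y 0; rewrite !addr0 b0 addr0.
have bDl x x' y : b (x + x') y = b x y + b x' y.
  by have := b2 y 1 x x'; rewrite !scale1r.
have bDr x y y' : b x (y + y') = b x y + b x y'.
  by have := b1 x 1 y y'; rewrite !scale1r.
have mue x : mu x e = f x.
  apply: MuF (hmu _ _) _; exists setT; first exact: gab_full.
  by move=> a _ r; exact: key2.
have prT (u : T0) d : gpr (gsum (und X')) d (eta u) = eta (gpr (gsum T0) d u).
  move: u; apply: bgen.
  - by rewrite gpr0 !linear0 gpr0.
  - by move=> u v hu hv; rewrite !(linearD, gprD) hu hv.
  move=> x y; move: x; apply: (gpr_ind (gsum (und X))).
  - by rewrite -(scale0r (0 : und X)) bZl scale0r !(linear0, gpr0).
  - by move=> x x' hx hx'; rewrite bDl !(linearD, gprD) hx hx'.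
  move=> p x px; move: y; apply: (gpr_ind (gsum (und Y))).
  - by rewrite -(scale0r (0 : und Y)) bZr scale0r !(linear0, gpr0).
  - by move=> y y' hy hy'; rewrite bDr !(linearD, gprD) hy hy'.
  move=> q y qy; rewrite etaE; have [->|ne] := eqVneq d (p + q).
    by rewrite !gpr_id ?etaE //; [exact: bd | exact: mu_deg].
  rewrite (gpr_neq _ (mu_deg _ _ _ _ px qy) ne) (gpr_neq _ (bd _ _ _ _ px qy) ne).
  by rewrite linear0.
have deta : deg0 eta.
  by move=> d u du; rewrite -(gpr_id (gsum T0) du) -prT; exact: (gprP (gsum (und X'))).
have bspan (u : T0) : exists2 I, F I & forall a, I a -> exists x, a *: u = b x e.
  move: u; apply: bgen.
  - exists setT; first exact: gab_full.
    by move=> a _; exists 0; rewrite scaler0 -(scale0r (0 : und X)) bZl scale0r.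
  - move=> u v [I FI h] [J FJ h']; exists (I `&` J); first exact: gab_cap.
    move=> a [/h[x xE] /h'[x' x'E]]; exists (x + x').
    by rewrite scalerDr xE x'E bDl.
  - move=> x y; have [I FI h] := e_dense y; exists I => // a /h[r rE].
    by exists (r *: x); rewrite -bZr rE bZr bZl.
pose T := of_gmod T0.
apply: (tS X Y X') SX; exists T, b; split.
  split=> // L c [c1 c2]; have [h hE] := bu L c c1 c2; exists h; split=> // h' h'E.
  apply: linear_ext; apply: bgen => [|u v hu hv|x y].
  - by rewrite !linear0.
  - by rewrite !linearD hu hv.
  - by rewrite hE h'E.
apply: (@is_Q_intro T X' eta) => //.
- move=> u eu; have [I FI h] := bspan u; exists I => // a /h[x xE].
  have : eta (b x e) = 0 by rewrite -xE linearZ eu /= scaler0.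
  rewrite etaE mue => fx; have x0 : x = 0 by apply: fi; rewrite fx linear0.
  by rewrite /= [LHS]xE x0 -(scale0r (0 : und X)) bZl scale0r.
- move=> z; exists setT; first exact: gab_full.
  move=> a _; exists (b (ff (a *: z)) e) => //.
  by rewrite etaE mue Kf.
Qed.

End TensorTorsion.

Theorem mainTheorem1 :
  (forall R : comPzRingType,
    inverse_bijections
      (fun V : set (Spec R) => union_of_qc_co_open V)
      (fun S : Mod R -> Prop => torsion_class S /\ finite_type S)
      (fun (V : set (Spec R)) (M : Mod R) => supp M `<=` V)
      (fun S : Mod R -> Prop =>
        [set P : Spec R | exists M : Mod R, S M /\ supp M P]))
  /\
  (forall A : graded_ring, fg_algebra A ->
    inverse_bijections
      (fun V : set (Proj A) => union_of_qc_co_open V)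
      (fun S : QGr A -> Prop => tensor_torsion_class S /\ finite_type S)
      (fun (V : set (Proj A)) (M : QGr A) => gsupp (QGr_module M) `<=` V)
      (fun S : QGr A -> Prop =>
        [set P : Proj A | exists M : QGr A, S M /\ gsupp (QGr_module M) P])).
Proof.
split; first exact: affine_case.
move=> A /irrelevant_fg[ms [mpos mgen]].
apply: inverse_bijections_ext (QGr_correspondence mpos mgen) => // S.
split=> -[hS fS]; split=> //.
  by case: hS => hS shS; exact: (shift_tensor_torsion hS shS).
by split; [exact: hS.1 | exact: tensor_shift hS].
Qed.
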